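(* Let $\widehat L:BUC_\eta\to\mathbb{R}^n$ be a bounded linear operator. Each $\lambda_0\in\sigma(A+L)$ with $\mathrm{Re}(\lambda_0)\ge\omega_{0,ess}((A+L)_0)$ is a pole of $\lambda\mapsto(\lambda I-(A+L))^{-1}$ of order $k_0\ge1$. Moreover $k_0$ is the only integer such that there exists $\Delta_{-k_0}\in M_n(\mathbb{C})$ with $\Delta_{-k_0}\ne0$ such that $$\Delta_{-k_0}=\lim_{\lambda\to\lambda_0}(\lambda-\lambda_0)^{k_0}\Delta(\lambda)^{-1}.$$ Furthermore the projector $B_{-1}^{\lambda_0}$ on the generalized eigenspace of $A+L$ associated to $\lambda_0$ is given by $$B_{-1}^{\lambda_0}\begin{pmatrix}\alpha\\ \varphi\end{pmatrix}=\begin{pmatrix}0_{\mathbb{R}^n}\\ \sum_{j=0}^{k_0-1}\frac1{j!}\Delta_{-1-j}\,L_j^2(\lambda_0)\begin{pmatrix}\alpha\\ \varphi\end{pmatrix}\end{pmatrix},$$ where, for $j=1,\dots,k_0$, $$\Delta_{-j}=\lim_{\lambda\to\lambda_0}\frac1{(k_0-j)!}\frac{d^{k_0-j}}{d\lambda^{k_0-j}}\Big((\lambda-\lambda_0)^{k_0}\Delta(\lambda)^{-1}\Big),$$ $$L_0^2(\lambda)\begin{pmatrix}\alpha\\ \varphi\end{pmatrix}(\theta)=e^{\lambda\theta}\Big[\alpha+\varphi(0)+\widehat L\Big(\int_\cdot^0e^{\lambda(\cdot-s)}\varphi(s)\,ds\Big)\Big],$$ and for $j\ge1$ $$L_j^2(\lambda)\begin{pmatrix}\alpha\\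 \varphi\end{pmatrix}(\theta)=\frac{d^j}{d\lambda^j}\Big[L_0^2(\lambda)\begin{pmatrix}\alpha\\ \varphi\end{pmatrix}(\theta)\Big]=\sum_{k=0}^{j}\binom jk\theta^ke^{\lambda\theta}\frac{d^{j-k}}{d\lambda^{j-k}}\Big[\alpha+\varphi(0)+\widehat L\Big(\int_\cdot^0e^{\lambda(\cdot-s)}\varphi(s)\,ds\Big)\Big],$$ with, for $i\ge1$, $$\frac{d^i}{d\lambda^i}\Big[\alpha+\varphi(0)+\widehat L\Big(\int_\cdot^0e^{\lambda(\cdot-s)}\varphi(s)\,ds\Big)\Big]=\widehat L\Big(\int_\cdot^0(\cdot-s)^ie^{\lambda(\cdot-s)}\varphi(s)\,ds\Big).$$
   Context: Fix an integer $n\ge1$ and a real $\eta>0$. $BUC_\eta$ is the Banach space of all $\varphi\in C((-\infty,0],\mathbb{R}^n)$ such that $\theta\mapsto e^{\eta\theta}\varphi(\theta)$ is bounded and uniformly continuous, with norm $\|\varphi\|_\eta=\sup_{\theta\le0}e^{\eta\theta}\|\varphi(\theta)\|$; $BUC_\eta^1=\{\varphi\in C^1((-\infty,0],\mathbb{R}^n):\varphi,\varphi'\in BUC_\eta\}$. $X=\mathbb{R}^n\times BUC_\eta$ with norm $\|(\alpha,\varphi)\|=\|\alpha\|+\|\varphi\|_\eta$. $A:D(A)\subset X\to X$, $A(0,\varphi)=(-\varphi'(0),\varphi')$, $D(A)=\{0_{\mathbb{R}^n}\}\times BUC_\eta^1$, so that $\overline{D(A)}=\{0_{\mathbb{R}^n}\}\times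 BUC_\eta$. $L:\overline{D(A)}\to X$, $L(0,\varphi)=(\widehat L(\varphi),0)$. For spectral questions all spaces and operators are complexified ($\mathbb{R}^n$ replaced by $\mathbb{C}^n$). $(A+L)_0$ is the part of $A+L$ in $\overline{D(A)}$: $(A+L)_0(0,\varphi)=(0,\varphi')$ with domain $\{(0,\varphi):\varphi\in BUC_\eta^1,\ \varphi'(0)=\widehat L(\varphi)\}$. It generates a strongly continuous semigroup $\{T_{(A+L)_0}(t)\}_{t\ge0}$ on $\overline{D(A)}$. Its essential growth bound is $\omega_{0,ess}((A+L)_0)=\lim_{t\to+\infty}\frac1t\ln\|T_{(A+L)_0}(t)\|_{ess}\in[-\infty,+\infty)$, where, for a bounded linear operator $T$ on a Banach space, $\|T\|_{ess}$ is the measure of non-compactness of the image under $T$ of the closed unit ball (the measure of non-compactness of a bounded set being the infimum of the $\varepsilon>0$ such that the set can be covered by finitely many balls of radius $\le\varepsilon$). One has $\omega_{0,ess}((A+L)_0)\le-\eta$. $\Delta(\lambda)=\lambda I-\widehat L(e^{\lambda\cdot}I)\in M_n(\mathbb{C})$ (introduced for $\lambda\in\mathbb{C}$ with $\mathrm{Re}(\lambda)>-\eta$), where $\widehat L(e^{\lambda\cdot}I)$ is the matrix $v\mapsto\widehat L(\theta\mapsto e^{\lambda\theta}v)$. The notation $\int_\cdot^0e^{\lambda(\cdot-s)}\varphi(s)ds$ denotes the function $\theta\mapsto\int_\theta^0e^{\lambda(\theta-s)}\varphi(s)ds$ (similarly with the factor $(\cdot-s)^i$). When $\lambda_0$ is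 a pole of order $k_0$ of the resolvent, $(\lambda I-(A+L))^{-1}=\sum_{m\ge-k_0}(\lambda-\lambda_0)^mB_m^{\lambda_0}$ near $\lambda_0$, and $B_{-1}^{\lambda_0}$ is the projector on the generalized eigenspace of $A+L$ associated to $\lambda_0$.
   Formalization: Re(λ0) ≥ ω_{0,ess}((A+L)_0) is replaced by the strict inequality: ω_{0,ess} = −η and the half-plane Re λ ≤ −η lies in σ(A+L), so a λ0 with Re(λ0) = ω_{0,ess} is never isolated in the spectrum and never a pole. *)

(* Defs.v *)
From HB Require Import structures.
From mathcomp Require Import all_boot all_order all_algebra.
From mathcomp Require Import complex.
From mathcomp Require Import all_classical all_reals all_analysis.

Set Implicit Arguments.
Unset Strict Implicit.
Unset Printing Implicit Defensive.

Import Order.TTheory GRing.Theory Num.Theory.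
Import numFieldNormedType.Exports.

Local Open Scope ring_scope.
Local Open Scope complex_scope.
Local Open Scope classical_set_scope.

(* R[i] carries a topology in the library only when it is seen as a
   numFieldType. *)
Definition cplx (R : realType) : numFieldType := R[i].

(* The scalar field K is either R or R[i]; [emb] is the inclusion of R in K.
   It lets the real space and its complexification share one construction. *)
Record scalars (R : realType) (K : numFieldType) := Scalars {
  emb : {rmorphism R -> K};
  emb_le : {mono emb : x y / x <= y};
  emb_norm : forall z : K, exists r : R, `|z| = emb r }.

Section Scalars.
Variable R : realType.

Fact emb_real_norm (z : R) : exists r : R, `|z| = (idfun : {rmorphism R -> R}) r.
Proof. by exists `|z|. Qed.

Definition real_scalars : scalars R R :=
  @Scalars R R idfun (fun _ _ => erefl) emb_real_norm.

Fact emb_cplx_norm (z : cplx R) : exists r : R, `|z| = real_complex R r.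
Proof. by exists (complex.Re `|z|); rewrite RRe_real// normr_real. Qed.

Definition cplx_scalars : scalars R (cplx R) :=
  @Scalars R (cplx R) (real_complex R) (@lecR R) emb_cplx_norm.

End Scalars.

Section BUC.
Variables (R : realType) (K : numFieldType) (s : scalars R K) (eta : R) (n : nat).
Implicit Types phi : R -> 'cV[K]_n.

Definition weighted phi (theta : R) : 'cV[K]_n :=
  emb s (expR (eta * theta)) *: phi theta.

(* A function on (-oo, 0] is represented by its extension to R that is constant
   on [0, +oo), so that equality of representatives is equality on (-oo, 0].
   Continuity of phi follows from that of its weighted version. *)
Definition is_buc phi := [/\
  forall theta, 0 <= theta -> phi theta = phi 0,
  exists M : R, forall theta, theta <= 0 -> `|weighted phi theta| <= emb s M &
  forall e : R, 0 < e -> exists2 d : R, 0 < d &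
    forall t u, t <= 0 -> u <= 0 -> `|t - u| < d ->
      `|weighted phi t - weighted phi u| < emb s e].

Definition buc_pred : {pred R -> 'cV[K]_n} := [pred phi | `[< is_buc phi >]].

Fact emb_lt : {mono emb s : x y / x < y}.
Proof. exact: leW_mono (emb_le s). Qed.

Fact emb_ge0 x : (0 <= emb s x) = (0 <= x).
Proof. by rewrite -(emb_le s) rmorph0. Qed.

Fact mx_norm_emb (v : 'cV[K]_n) : exists r : R, `|v| = emb s r.
Proof.
rewrite /Num.norm/=; have [->|/mx_norm_neq0[i ->]] := eqVneq (mx_norm v) 0.
  by exists 0; rewrite rmorph0.
exact: emb_norm.
Qed.

Fact weightedP a phi psi theta :
  weighted (a *: phi + psi) theta = a *: weighted phi theta + weighted psi theta.
Proof. by rewrite /weighted scalerDr !scalerA mulrC. Qed.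

Fact buc_submod_closed : submod_closed buc_pred.
Proof.
split=> [|a phi psi].
  apply/asboolP; split=> //.
    by exists 0 => t _; rewrite /weighted scaler0 normr0 rmorph0.
  move=> e e0; exists 1 => // t u _ _ _.
  by rewrite /weighted !scaler0 subrr normr0 -(rmorph0 (emb s)) emb_lt.
move=> /asboolP[c1 [M1 b1] u1] /asboolP[c2 [M2 b2] u2].
have [r ar] := emb_norm s a.
have r0 : 0 <= r by rewrite -emb_ge0 -ar.
apply/asboolP; split.
- move=> t t0; have -> : (a *: phi + psi) t = a *: phi t + psi t by [].
  by rewrite c1// c2.
- exists (r * M1 + M2) => t t0; rewrite weightedP (le_trans (ler_normD _ _))//.
  by rewrite normrZ ar rmorphD rmorphM lerD ?b2// ler_wpM2l ?emb_ge0 ?b1.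
move=> e e0.
have e2 : 0 < e / 2 by rewrite divr_gt0.
have e1 : 0 < e / 2 / (r + 1) by rewrite divr_gt0 ?ltr_wpDl.
have [d1 d10 h1] := u1 _ e1; have [d2 d20 h2] := u2 _ e2.
exists (Num.min d1 d2); first by rewrite lt_min d10.
move=> t u t0 u0; rewrite lt_min => /andP[/(h1 _ _ t0 u0){}h1 /(h2 _ _ t0 u0){}h2].
rewrite !weightedP opprD addrACA -scalerBr (le_lt_trans (ler_normD _ _))//.
rewrite [e in emb s e](splitr e) rmorphD ler_ltD//= normrZ ar.
rewrite (le_trans (ler_wpM2l _ (ltW h1))) ?emb_ge0// -rmorphM emb_le.
rewrite mulrA ler_pdivrMr ?ltr_wpDl// mulrC ler_wpM2l ?(ltW e2)//.
by rewrite lerDl.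
Qed.

HB.instance Definition _ :=
  GRing.isSubmodClosed.Build _ _ buc_pred buc_submod_closed.

Record BUC := MkBUC { buc_fun :> R -> 'cV[K]_n; _ : buc_fun \in buc_pred }.

HB.instance Definition _ := [isSub for buc_fun].
HB.instance Definition _ := [Choice of BUC by <:].
HB.instance Definition _ := [SubChoice_isSubLmodule of BUC by <:].

(* The norm on K^n is the library's maximum norm.
   The value lies in K because a norm on a K-vector space takes its values in K
   in the library. *)
Definition buc_norm (phi : BUC) : K :=
  emb s (sup [set r : R |
    exists2 theta : R, theta <= 0 & `|weighted phi theta| = emb s r]).

Let nset (phi : BUC) := [set r : R |
    exists2 theta : R, theta <= 0 & `|weighted phi theta| = emb s r].

Fact nset_has_sup (phi : BUC) : has_sup (nset phi).
Proof.
split; first by have [r hr] := mx_norm_emb (weighted phi 0); exists r; exists 0.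
have /asboolP[_ [M b] _] := valP phi.
by exists M => r [t t0 tr]; rewrite -(emb_le s) -tr b.
Qed.

Fact le_buc_norm (phi : BUC) theta :
  theta <= 0 -> `|weighted phi theta| <= buc_norm phi.
Proof.
move=> t0; have [r hr] := mx_norm_emb (weighted phi theta).
rewrite hr emb_le ub_le_sup//; first exact: (nset_has_sup phi).2.
by exists theta.
Qed.

Fact buc_norm_le (phi : BUC) (c : R) :
  (forall theta, theta <= 0 -> `|weighted phi theta| <= emb s c) ->
  buc_norm phi <= emb s c.
Proof.
move=> h; rewrite emb_le ge_sup//; first exact: (nset_has_sup phi).1.
by move=> r [t t0 tr]; rewrite -(emb_le s) -tr h.
Qed.

Fact ler_buc_normD (phi psi : BUC) : buc_norm (phi + psi) <= buc_norm phi + buc_norm psi.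
Proof.
rewrite -[leRHS](rmorphD (emb s) (sup (nset phi)) (sup (nset psi))).
apply: buc_norm_le => t t0; rewrite rmorphD.
have -> : weighted (phi + psi) t = weighted phi t + weighted psi t.
  by rewrite -[in RHS](scale1r (weighted phi t)) -weightedP scale1r.
by rewrite (le_trans (ler_normD _ _))// lerD// le_buc_norm.
Qed.

Let buc_normZ_le a (phi : BUC) : buc_norm (a *: phi) <= `|a| * buc_norm phi.
Proof.
have [r ar] := emb_norm s a.
rewrite ar -[leRHS](rmorphM (emb s) r (sup (nset phi))).
apply: buc_norm_le => t t0; rewrite rmorphM.
have -> : weighted (a *: phi) t = a *: weighted phi t.
  by rewrite -[RHS]addr0 -[0 in RHS](scaler0 _ (emb s (expR (eta * t)))) -weightedP addr0.
by rewrite normrZ -ar ler_wpM2l// le_buc_norm.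
Qed.

Fact buc_normZ a (phi : BUC) : buc_norm (a *: phi) = `|a| * buc_norm phi.
Proof.
apply/eqP; rewrite eq_le buc_normZ_le /=; have [->|a0] := eqVneq a 0.
  rewrite normr0 mul0r /buc_norm emb_ge0.
  have [r hr] := mx_norm_emb (weighted (0 *: phi) 0).
  rewrite (@le_trans _ _ r)//; first by rewrite -emb_ge0 -hr.
  by rewrite ub_le_sup//; [exact: (nset_has_sup _).2|exists 0].
rewrite -ler_pdivlMl ?normr_gt0// -normfV.
by rewrite (le_trans _ (buc_normZ_le _ _))// scalerA mulVf// scale1r.
Qed.

Fact buc_norm_eq0 (phi : BUC) : buc_norm phi = 0 -> phi = 0.
Proof.
move=> h; have w0 t : t <= 0 -> phi t = 0.
  move=> t0; have := le_buc_norm phi t0; rewrite h normr_le0 scaler_eq0.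
  by rewrite fmorph_eq0 gt_eqF ?expR_gt0//= => /eqP.
apply/val_inj/funext => t /=; case: (leP t 0) => [/w0//|t0].
have /asboolP[c _ _] := valP phi.
by rewrite [LHS](c t (ltW t0)); exact: w0.
Qed.

HB.instance Definition _ := Lmodule_isNormed.Build K BUC
  ler_buc_normD buc_normZ buc_norm_eq0.

(* [mkBUC f] is the restriction of f to (-oo, 0] when that restriction belongs
   to BUC_eta, and 0 otherwise. *)
Definition mkBUC (f : R -> 'cV[K]_n) : BUC :=
  insubd 0 (fun theta => f (Num.min theta 0)).

(* One-sided at theta = 0. *)
Definition buc_derivative (phi psi : BUC) := forall theta : R, theta <= 0 ->
  (emb s (t - theta)^-1 *: (phi t - phi theta))
    @[t --> within [set t | t <= 0] theta^'] --> psi theta.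

Definition BUC1 : set BUC := [set phi | exists psi, buc_derivative phi psi].

(* The derivative of phi when phi is in BUC1, and 0 otherwise. *)
Definition buc_deriv (phi : BUC) : BUC := xget 0 [set psi | buc_derivative phi psi].

(* R^n x BUC_eta (or C^n x BUC_eta); the library's product carries the maximum
   norm, hence this alias carrying the sum of the norms. *)
Definition Xspace := ('cV[K]_n * BUC)%type.

HB.instance Definition _ := GRing.Lmodule.on Xspace.

Definition mkX (alpha : 'cV[K]_n) (phi : BUC) : Xspace := (alpha, phi).

Definition X_norm (x : Xspace) : K := `|x.1| + `|x.2|.

Fact ler_X_normD x y : X_norm (x + y) <= X_norm x + X_norm y.
Proof. by rewrite /X_norm addrACA lerD// ler_normD. Qed.

Fact X_normZ a x : X_norm (a *: x) = `|a| * X_norm x.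
Proof. by rewrite /X_norm mulrDr -!normrZ. Qed.

Fact X_norm_eq0 x : X_norm x = 0 -> x = 0.
Proof.
case: x => a b /eqP; rewrite /X_norm /= paddr_eq0 ?normr_ge0//.
by rewrite !normr_eq0 => /andP[/eqP -> /eqP ->].
Qed.

HB.instance Definition _ := Lmodule_isNormed.Build K Xspace
  ler_X_normD X_normZ X_norm_eq0.

End BUC.

Arguments buc_pred {R K} s eta n.

Notation BUC_R := (BUC (real_scalars _)).
Notation BUC_C := (BUC (cplx_scalars _)).
Notation X_C := (Xspace (cplx_scalars _)).

Section Operators.
Variables (K : numFieldType) (V : normedModType K).

(* An operator with domain [dom]; only the values of [act] on [dom] matter. *)
Record operator := Operator { dom : set V; act : V -> V }.

Definition part (A : operator) (Y : set V) : operator :=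
  Operator [set x | [/\ dom A x, Y x & Y (act A x)]] (act A).

Definition is_resolvent (A : operator) (l : K) (S : {linear V -> V}) := [/\
  continuous S,
  forall y, dom A (S y) /\ l *: S y - act A (S y) = y &
  forall x, dom A x -> S (l *: x - act A x) = x].

Definition resolvent_set (A : operator) : set K :=
  [set l | exists S, is_resolvent A l S].

Definition spectrum (A : operator) : set K := ~` resolvent_set A.

Definition op_norm_cvg (S_ : nat -> V -> V) (S : V -> V) :=
  forall e : K, 0 < e ->
    \forall N \near \oo, forall x, `|S_ N x - S x| <= e * `|x|.

(* l0 is a pole of order k of the resolvent, with Laurent expansion
   sum_(m >= - k) (l - l0)^m B_m near l0. *)
Definition pole_expansion (A : operator) (l0 : K) (k : nat)
    (B : int -> {linear V -> V}) := [/\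
  (0 < k)%N,
  forall m, continuous (B m),
  exists x, B (- k%:Z) x != 0 &
  exists2 r : K, 0 < r & forall l, 0 < `|l - l0| < r ->
    exists2 S, is_resolvent A l S &
      op_norm_cvg (fun N x => \sum_(j < N)
        ((l - l0) ^ (j%:Z - k%:Z)) *: B (j%:Z - k%:Z) x) S].

Fixpoint ker_pow (A : operator) (l : K) (m : nat) : set V :=
  if m is m'.+1 then [set x | dom A x /\ ker_pow A l m' (l *: x - act A x)]
  else [set 0].

Definition gen_eigenspace (A : operator) (l : K) : set V :=
  \bigcup_m ker_pow A l m.

Definition projector_onto (P : V -> V) (Y : set V) :=
  (forall x, P (P x) = P x) /\ range P = Y.

End Operators.

Section Semigroups.
Variables (R : realType) (V : normedModType (cplx R)).
Implicit Types (Y : set V) (T : R -> V -> V).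

Definition C0_semigroup Y T :=
  (forall t, 0 <= t ->
    [/\ forall x, Y x -> Y (T t x),
        forall (a : cplx R) x y, Y x -> Y y -> T t (a *: x + y) = a *: T t x + T t y &
        exists M : R, forall x, Y x -> `|T t x| <= M%:C * `|x|]) /\
  [/\ forall x, Y x -> T 0 x = x,
      forall t u x, 0 <= t -> 0 <= u -> Y x -> T (t + u) x = T t (T u x) &
      forall x, Y x -> T t x @[t --> 0^'+] --> x].

Definition generates (A : operator V) Y T := forall x y,
  (dom A x /\ act A x = y) <->
  (Y x /\ (t^-1)%:C *: (T t x - x) @[t --> 0^'+] --> y).

Definition covered_by_balls Y (S : set V) (e : R) :=
  exists2 cr : seq (V * R),
    forall p, p \in cr -> Y p.1 /\ p.2 <= e &
    forall x, S x -> exists2 p, p \in cr & `|x - p.1| < (p.2)%:C.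

(* Measure of non-compactness in the Banach space Y. *)
Definition noncompactness Y (S : set V) : R :=
  inf [set e : R | 0 < e /\ covered_by_balls Y S e].

Definition ess_norm Y (P : V -> V) : R :=
  noncompactness Y (P @` [set x | Y x /\ `|x| <= 1]).

(* w is the limit of (1/t) ln ||T(t)||_ess at +oo; lne 0 is -oo. *)
Definition ess_growth_bound Y T (w : \bar R) :=
  ((t^-1)%:E * lne (ess_norm Y (T t))%:E)%E @[t --> +oo%R] --> w.

End Semigroups.

Section Complex.
Variable R : realType.

Definition cexp (z : cplx R) : cplx R :=
  (expR (complex.Re z))%:C * (cos (complex.Im z) +i* sin (complex.Im z)).

Definition cvec_integral (n : nat) (a b : R) (f : R -> 'cV[cplx R]_n) : 'cV[cplx R]_n :=
  \col_i ((\int[@lebesgue_measure R]_(u in `[a, b]) complex.Re (f u i 0)) +i*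
          (\int[@lebesgue_measure R]_(u in `[a, b]) complex.Im (f u i 0))).

End Complex.

Section Complexification.
Variables (R : realType) (n : nat) (eta : R).

Let real_part_norm (f : cplx R -> R) (v : 'cV[cplx R]_n) :
  (forall z, `|f z|%:C <= `|z|) -> `|map_mx f v|%:C <= `|v|.
Proof.
move=> fz; rewrite {1}/Num.norm /=.
have [->|/mx_norm_neq0[ij ->]] := eqVneq (mx_norm (map_mx f v)) 0; first exact: normr_ge0.
rewrite mxE (le_trans (fz _))// {2}/Num.norm /= mx_normE.
by rewrite -[leLHS]nngE num_le; exact: (le_bigmax _ (fun i => `|v i.1 i.2|%:nng)).
Qed.

Let real_part_is_buc (f : {additive cplx R -> R}) (phi : BUC_C eta n) :
  (forall (a : R) z, f (a%:C * z) = a * f z) -> (forall z, `|f z|%:C <= `|z|) ->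
  (fun t => map_mx f (phi t) : 'cV[R]_n) \in buc_pred (real_scalars R) eta n.
Proof.
move=> fM fz.
have wE t : weighted (real_scalars R) eta (fun t => map_mx f (phi t)) t =
            map_mx f (weighted (cplx_scalars R) eta phi t).
  by apply/matrixP => i j; rewrite !mxE fM.
have /asboolP[c [M b] u] := valP phi.
apply/asboolP; split=> [t t0||e e0].
- by rewrite [phi t]c.
- by exists M => t t0; rewrite wE -lecR (le_trans (real_part_norm _ fz))// b.
have [d d0 h] := u e e0; exists d => // t v t0 v0 tv.
rewrite !wE -raddfB -ltcR (le_lt_trans (real_part_norm _ fz))//.
exact: h.
Qed.

Fact buc_Re_proof (phi : BUC_C eta n) :
  (fun t => map_mx (@complex.Re R) (phi t) : 'cV[R]_n) \in buc_pred (real_scalars R) eta n.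
Proof.
apply: real_part_is_buc => [a [x y]|z]; first by rewrite /= mul0r subr0.
exact: normc_ge_Re.
Qed.

Fact buc_Im_proof (phi : BUC_C eta n) :
  (fun t => map_mx (@complex.Im R) (phi t) : 'cV[R]_n) \in buc_pred (real_scalars R) eta n.
Proof.
apply: real_part_is_buc => [a [x y]|[x y]]; first by rewrite /= mul0r addr0.
by rewrite normc_def/= lecR -sqrtr_sqr ler_wsqrtr// lerDr sqr_ge0.
Qed.

Definition buc_Re (phi : BUC_C eta n) : BUC_R eta n := MkBUC (buc_Re_proof phi).
Definition buc_Im (phi : BUC_C eta n) : BUC_R eta n := MkBUC (buc_Im_proof phi).

(* phi |-> Lh (Re phi) + i Lh (Im phi) *)
Definition complexify (Lh : BUC_R eta n -> 'cV[R]_n) (phi : BUC_C eta n) : 'cV[cplx R]_n :=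
  \col_i (Lh (buc_Re phi) i 0 +i* Lh (buc_Im phi) i 0).

End Complexification.

Section Problem.
Variables (R : realType) (n : nat) (eta : R) (Lh : BUC_R eta n -> 'cV[R]_n).
Local Notation C := (cplx R).
Local Notation X := (X_C eta n).
Local Notation LC := (complexify Lh).
Local Notation mkBUC_C := (mkBUC (cplx_scalars R) eta).

Definition A_op : operator X :=
  Operator [set x : X | x.1 = 0 /\ BUC1 x.2]
           (fun x : X => mkX (- buc_deriv x.2 0) (buc_deriv x.2)).

(* This is {0} x BUC_eta. *)
Definition X0 : set X := closure (dom A_op).

Definition L_op (x : X) : X := mkX (LC x.2) 0.

Definition AL_op : operator X :=
  Operator (dom A_op) (fun x : X => act A_op x + L_op x).

Definition AL0_op : operator X := part AL_op X0.

(* Column j of the subtracted matrix is Lh (theta |-> e^(l theta) e_j). This and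
   [exp_integral] are meant for Re l > - eta, where the functions passed to
   [mkBUC] belong to BUC_eta. *)
Definition Delta (l : C) : 'M[C]_n :=
  l%:M - \matrix_(i, j)
    LC (mkBUC_C (fun t => cexp (l * t%:C) *: delta_mx j 0)) i 0.

(* t |-> int_t^0 (t - u)^i e^(l (t - u)) phi(u) du *)
Definition exp_integral (i : nat) (l : C) (phi : BUC_C eta n) (t : R) : 'cV[C]_n :=
  cvec_integral t 0 (fun u => (((t - u) ^+ i)%:C * cexp (l * (t - u)%:C)) *: phi u).

Definition L20_bracket (x : X) (l : C) : 'cV[C]_n :=
  x.1 + x.2 0 + LC (mkBUC_C (exp_integral 0 l x.2)).

Definition L20 (x : X) (theta : R) (l : C) : 'cV[C]_n :=
  cexp (l * theta%:C) *: L20_bracket x l.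

Definition L2 (j : nat) (l : C) (x : X) (theta : R) : 'cV[C]_n :=
  derive1n j (L20 x theta) l.

End Problem.

Arguments A_op {R} n eta.
Arguments X0 {R} n eta.

(* Main.v *)
Require Import Defs.
From HB Require Import structures.
From mathcomp Require Import all_boot all_order all_algebra.
From mathcomp Require Import complex ring lra zify.
From mathcomp Require Import all_classical all_reals all_analysis.

Import Order.TTheory GRing.Theory Num.Theory.
Import numFieldNormedType.Exports.

Set Implicit Arguments.
Unset Strict Implicit.
Unset Printing Implicit Defensive.

Local Open Scope ring_scope.
Local Open Scope complex_scope.
Local Open Scope classical_set_scope.

(** For [Re l > - eta] let [Eop l v] be the function [t |-> e^(l t) v] and [Jop l phi]
    the integral of [e^(l (t - s)) phi(s)] over [t <= s <= 0]. Every solution of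
    [psi' = l psi - phi] is [Eop l (psi 0) + Jop l phi]; inserting this in the boundary
    condition shows that, as soon as [Delta l] is invertible, the resolvent of
    [A + L] at [l] maps [(alpha, phi)] to
      [(0, Eop l (Delta(l)^-1 (alpha + phi 0 + L (Jop l phi))) + Jop l phi)]
    ([Sop_resolvent]). Near a spectral point [lam0] of the half-plane everything
    in this formula is analytic except [Delta(l)^-1]. The determinant of [Delta] does
    not vanish at large real numbers, since [L] is bounded, so by connectedness
    ([identity_segment], [Delta_pole]) it has a zero of finite order at [lam0], and
    Cramer's rule gives the pole of [Delta(l)^-1] ([inverse_pole]). Its order is
    also the order of the pole of the resolvent, because the leading coefficient
    of the latter, evaluated at 0 on the vectors [(alpha, 0)], is the leading
    coefficient of [Delta(l)^-1].

    Analyticity is handled through the predicate [expands], which asks for the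
    coefficients and for geometric bounds on all remainders with explicit
    constants; it is stable under sums, Cauchy products, division by powers of
    [l - c] and inverses. Since the constants for [Eop] and [Jop] are proportional to
    the norm of the argument, one obtains expansions in operator norm. These come
    from the resolvent identities, such as [Jop l = Jop c - (l - c) Jop c (Jop l)], by
    iteration ([expands_neumann]); integration by parts identifies the iterates
    of [Jop c] with the integrals whose kernel is [(t - s)^i e^(c (t - s))], which
    yields the derivative formulas ([bracket_coefE], [L2_leibniz]).

    The residue is treated for an arbitrary operator: comparing coefficients in
    [(l - A) S l = 1] and [S l (l - A) = 1] shows that it takes its values in the
    generalized eigenspace and is the identity there ([laurent_projector]). Its
    explicit form is the coefficient of index [k0 - 1] of the product of
    [(l - lam0)^k0 Delta(l)^-1] and [L20], to which the regular term [Jop l phi] does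
    not contribute ([Gcoef_eval]).

    It remains to see that [Re lam0 > - eta], that is, that the essential growth
    bound is at least [- eta] ([ess_growth_bound_ge]). An orbit starting in the
    domain solves the transport equation, hence [T t x] at [tau - t] equals [x] at
    [tau] ([orbit_translation]); so the weighted distance between two functions
    on the half-line is at most divided by [e^(eta t)]. The exponentials with
    exponents [- eta + i / (k + 1)], corrected by small multiples of [e^(m t)] so as to
    lie in the domain, are uniformly separated in the weighted norm
    ([separated_family]). Finitely many balls of radius less than [e^(- eta t) / 4]
    therefore do not cover the image of the unit ball under [T t]. *)

(** * Real-valued norms *)

Section RealNorm.
Variable R : realType.
Local Notation C := (cplx R).

(** Norms on complex spaces take their values in the partially ordered field C;
    their real part lives in R, where inequalities can be decided linearly. *)
Definition nrm (V : normedModType C) (v : V) : R := complex.Re `|v|.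

Section Theory.
Variable V : normedModType C.
Implicit Types u v : V.

Lemma nrmE v : `|v| = (nrm v)%:C.
Proof. by rewrite /nrm RRe_real// normr_real. Qed.

Lemma nrm_ge0 v : 0 <= nrm v.
Proof. by rewrite -lecR -nrmE normr_ge0. Qed.

Lemma nrm0 : nrm (0 : V) = 0.
Proof. by rewrite /nrm normr0. Qed.

Lemma nrm_eq0 v : nrm v = 0 -> v = 0.
Proof. by move=> h; apply/eqP; rewrite -normr_eq0 nrmE h. Qed.

Lemma nrm_le0 v : nrm v <= 0 -> v = 0.
Proof. by move=> h; apply: nrm_eq0; apply/eqP; rewrite eq_le h nrm_ge0. Qed.

Lemma nrm_gt0 v : v != 0 -> 0 < nrm v.
Proof.
by move=> v0; rewrite lt_neqAle nrm_ge0 andbT; apply: contra_neq v0 => /esym/nrm_eq0.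
Qed.

Lemma nrmN v : nrm (- v) = nrm v.
Proof. by rewrite /nrm normrN. Qed.

Lemma nrmD u v : nrm (u + v) <= nrm u + nrm v.
Proof. by rewrite -lecR rmorphD/= -!nrmE ler_normD. Qed.

Lemma nrmB u v : nrm (u - v) <= nrm u + nrm v.
Proof. by rewrite -(nrmN v) nrmD. Qed.

Lemma nrm_distC u v : nrm (u - v) = nrm (v - u).
Proof. by rewrite -nrmN opprB. Qed.

Lemma nrm_sum (I : Type) (r : seq I) (P : pred I) (F : I -> V) :
  nrm (\sum_(i <- r | P i) F i) <= \sum_(i <- r | P i) nrm (F i).
Proof.
elim/big_rec2 : _ => [|i y x _ h]; first by rewrite nrm0.
by rewrite (le_trans (nrmD _ _))// lerD2l.
Qed.

Lemma nrm_dist w u v : nrm (u - v) <= nrm (u - w) + nrm (w - v).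
Proof. by rewrite -{1}(subrK w u) -addrA nrmD. Qed.

Lemma nrmZ (a : C) v : nrm (a *: v) = nrm a * nrm v.
Proof. by apply: (@complexI R); rewrite -nrmE normrZ !nrmE rmorphM. Qed.

End Theory.

Lemma nrmM (a b : C) : nrm (a * b) = nrm a * nrm b.
Proof. by apply: (@complexI R); rewrite -nrmE normrM !nrmE rmorphM. Qed.

Lemma nrm1 : nrm (1 : C) = 1.
Proof. by rewrite /nrm normr1. Qed.

Lemma nrmX (a : C) k : nrm (a ^+ k) = nrm a ^+ k.
Proof. by elim: k => [|k ih]; rewrite ?expr0 ?nrm1// !exprS nrmM ih. Qed.

Lemma nrmV (a : C) : nrm a^-1 = (nrm a)^-1.
Proof. by apply: (@complexI R); rewrite -nrmE normfV nrmE fmorphV. Qed.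

Lemma nrm_real (x : R) : nrm (x%:C : C) = `|x|.
Proof. by rewrite /nrm normc_def/= expr0n/= addr0 sqrtr_sqr. Qed.

Lemma nrm_nat k : nrm (k%:R : C) = k%:R.
Proof. by rewrite -(rmorph_nat (real_complex R)) nrm_real ger0_norm. Qed.

Lemma nrm_Re (z : C) : `|complex.Re z| <= nrm z.
Proof. by rewrite -lecR -nrmE; exact: normc_ge_Re. Qed.

Lemma nrm_Im (z : C) : `|complex.Im z| <= nrm z.
Proof.
by rewrite /nrm normc_def/= -sqrtr_sqr ler_wsqrtr// lerDr sqr_ge0.
Qed.

Lemma nrm_ReIm (z : C) : nrm z <= `|complex.Re z| + `|complex.Im z|.
Proof.
rewrite {1}(complexE z) (le_trans (nrmD _ _))// nrmM !nrm_real.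
by rewrite lerD2l /nrm normc_def/= expr0n/= add0r expr1n sqrtr1 mul1r.
Qed.

End RealNorm.

Section RealNormTopology.
Variable R : realType.
Local Notation C := (cplx R).

Lemma cvg_nrmP (T : Type) (F : set_system T) (FF : Filter F)
    (V : normedModType C) (f : T -> V) (l : V) :
  f @ F --> l <-> forall e : R, 0 < e -> \forall t \near F, nrm (f t - l) < e.
Proof.
split=> [/cvgrPdist_lt h e e0|h].
  have := h e%:C; rewrite ltcR => /(_ e0); apply: filterS => t.
  by rewrite nrmE ltcR nrm_distC.
apply/cvgrPdist_lt => e e0.
have ee : e = (complex.Re e)%:C by rewrite RRe_real// gtr0_real.
rewrite ee ltcR in e0; have := h _ e0; apply: filterS => t.
by rewrite nrmE nrm_distC ee ltcR.
Qed.

Lemma near_nrmP (V : normedModType C) (c : V) (P : V -> Prop) :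
  (\forall x \near c, P x) <-> exists2 r : R, 0 < r & forall x, nrm (x - c) < r -> P x.
Proof.
split=> [/nbhs_normP [e /= e0 h]|[r r0 h]].
  have ee : e = (complex.Re e)%:C by rewrite RRe_real// gtr0_real.
  exists (complex.Re e); first by rewrite -ltcR -ee.
  by move=> x xc; apply: h => /=; rewrite ee nrmE nrm_distC ltcR.
apply/nbhs_normP; exists r%:C; first by rewrite /= ltcR.
by move=> x /=; rewrite nrmE nrm_distC ltcR; exact: h.
Qed.

Lemma dnbhs_nrmP (c : C) (P : C -> Prop) :
  (\forall x \near c^', P x) <->
  exists2 r : R, 0 < r & forall x, x != c -> nrm (x - c) < r -> P x.
Proof.
split=> [|[r r0 h]].
  move=> /(@near_nrmP C^o c) [r r0 h].
  by exists r => // x xc /h; exact.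
by apply/(@near_nrmP C^o c); exists r => // x + xc; move/h; exact.
Qed.

End RealNormTopology.

(** * Quantitative power series expansions *)

Section Expansions.
Variable R : realType.
Local Notation C := (cplx R).

(** [f] is, near [c], the sum of its power series with coefficients [a], with
    geometric bounds for both the coefficients and the remainders. As every
    constant is explicit, a family of expansions depending linearly on a vector
    [u] can be asked to hold with the constant [M * nrm u], which makes the
    expansion one in operator norm. *)
Definition expands (V : normedModType C) (c : C) (a : nat -> V) (f : C -> V)
    (M q : R) := [/\
  0 <= M, 0 < q, forall k, nrm (a k) <= M * q ^+ k &
  forall N (z : C), q * nrm z <= 2^-1 ->
    nrm (f (c + z) - \sum_(j < N) z ^+ j *: a j) <= M * (q * nrm z) ^+ N].

Definition analytic (V : normedModType C) (c : C) (f : C -> V) :=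
  exists a M q, expands c a f M q.

Lemma natr_lt_exp2 k : k.+1%:R <= 2 ^+ k :> R.
Proof. by rewrite -natrX ler_nat ltn_expl. Qed.

Lemma le_geometric_le0 (x M : R) : (forall k, x <= M * 2^-1 ^+ k) -> x <= 0.
Proof.
move=> h; rewrite leNgt; apply/negP => x0.
have [k hk] : exists k : nat, M / x < k%:R.
  by exists (Num.truncn (M / x)).+1; exact: truncnS_gt.
have := h k; apply/negP; rewrite -ltNge exprVn ltr_pdivrMr ?exprn_gt0//.
rewrite mulrC -ltr_pdivrMr//; apply: (lt_le_trans hk).
by rewrite (le_trans _ (natr_lt_exp2 k))// ler_nat.
Qed.

Section Theory.
Variable V : normedModType C.
Implicit Types (a b : nat -> V) (f g : C -> V) (c : C) (M q : R).

Lemma expandsW c a f M q M' q' : M <= M' -> q <= q' ->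
  expands c a f M q -> expands c a f M' q'.
Proof.
move=> MM qq [M0 q0 ha hf]; split; [exact: le_trans MM|exact: lt_le_trans qq| |].
  move=> k; apply: (le_trans (ha k)).
  by rewrite ler_pM ?exprn_ge0// ?(ltW q0)// lerXn2r// nnegrE ?(ltW q0)// (le_trans (ltW q0)).
move=> N z hz; have qz : q * nrm z <= q' * nrm z by rewrite ler_wpM2r ?nrm_ge0.
apply: (le_trans (hf N z (le_trans qz hz))).
have qz0 : 0 <= q * nrm z by rewrite mulr_ge0 ?nrm_ge0 ?ltW.
by rewrite ler_pM ?exprn_ge0// lerXn2r// nnegrE// (le_trans qz0).
Qed.

(** Adding [r^-1] to [q] shrinks the disc of the expansion to one of radius less
    than [r], on which [f] and [g] agree. *)
Lemma expands_congr c a b f g M q (r : R) : 0 < r -> a =1 b ->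
  (forall l, nrm (l - c) < r -> f l = g l) ->
  expands c a f M q -> expands c b g M (q + r^-1).
Proof.
move=> r0 ab fg [M0 q0 ha hf].
have ir0 : 0 < r^-1 by rewrite invr_gt0.
have qr : q <= q + r^-1 by rewrite lerDl ltW.
have [_ q'0 hb hg] := expandsW (lexx M) qr (And4 M0 q0 ha hf).
split => // [k|N z hz]; first by rewrite -ab.
rewrite -fg; first by under eq_bigr do rewrite -ab; exact: hg.
rewrite addrC addKr -(ltr_pM2l ir0) mulVf ?gt_eqF//.
have : 0 <= q * nrm z by rewrite mulr_ge0 ?nrm_ge0 ?ltW.
by move: hz; rewrite mulrDl; lra.
Qed.

Lemma expands_center c a f M q : expands c a f M q -> f c = a 0%N.
Proof.
move=> [_ _ _ /(_ 1%N 0)]; rewrite nrm0 mulr0 invr_ge0 ler0n => /(_ isT).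
rewrite addr0 big_ord1 expr0 scale1r expr1 mulr0 => /nrm_le0/eqP.
by rewrite subr_eq0 => /eqP.
Qed.

Lemma expands_bound c a f M q z : expands c a f M q -> q * nrm z <= 2^-1 ->
  nrm (f (c + z)) <= M.
Proof. by move=> [_ _ _ /(_ 0%N z) h] /h; rewrite big_ord0 subr0 expr0 mulr1. Qed.

Lemma expandsD c a b f g M M' q : expands c a f M q -> expands c b g M' q ->
  expands c (a \+ b) (f \+ g) (M + M') q.
Proof.
move=> [M0 q0 ha hf] [M'0 _ hb hg]; split => // [|k|N z hz].
- exact: addr_ge0.
- by rewrite /= mulrDl (le_trans (nrmD _ _))// lerD.
under eq_bigr do rewrite scalerDr.
rewrite big_split/= opprD addrACA mulrDl (le_trans (nrmD _ _))//.
by rewrite lerD ?hf ?hg.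
Qed.

Lemma expands_cst c (v : V) :
  expands c (fun k => if k is 0%N then v else 0) (fun=> v) (nrm v) 1.
Proof.
split; [exact: nrm_ge0|by []|by case=> [|k]; rewrite ?nrm0 expr1n mulr1// nrm_ge0|].
case=> [|N] z _; first by rewrite big_ord0 subr0 expr0 mulr1.
rewrite big_ord_recl/= expr0 scale1r big1 => [|i _]; last by rewrite scaler0.
by rewrite addr0 subrr nrm0 mulr_ge0 ?exprn_ge0 ?nrm_ge0// mul1r nrm_ge0.
Qed.

(** The remainder bound holds at every order, and [(q * nrm z) ^+ N] tends to 0. *)
Lemma expands_vanish c a f M q z : expands c a f M q -> (forall k, a k = 0) ->
  q * nrm z <= 2^-1 -> f (c + z) = 0.
Proof.
move=> [M0 q0 _ hf] a0 hz; apply: nrm_le0; apply: (@le_geometric_le0 _ M) => k.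
have := hf k z hz; rewrite big1 ?subr0 => [h|i _]; last by rewrite a0 scaler0.
apply: (le_trans h); rewrite ler_wpM2l// lerXn2r ?nnegrE ?invr_ge0//.
by rewrite mulr_ge0 ?nrm_ge0 ?ltW.
Qed.

Lemma complex_small (r : R) : 0 < r -> exists2 z : C, z != 0 & nrm z < r.
Proof.
move=> r0; exists ((r / 2)%:C); last by rewrite nrm_real gtr0_norm; lra.
by rewrite -(rmorph0 (real_complex R)) (inj_eq (@complexI R)) gt_eqF// divr_gt0.
Qed.

(** Near the center the first nonzero term dominates the sum of the others. *)
Lemma expands_lead c a f M q p : expands c a f M q -> (forall k, (k < p)%N -> a k = 0) ->
  a p != 0 -> exists2 r : R, 0 < r & forall z, z != 0 -> nrm z < r -> f (c + z) != 0.
Proof.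
move=> [M0 q0 _ hf] ap0 /nrm_gt0 ap.
pose K := M * q ^+ p.+1.
have K0 : 0 <= K by rewrite mulr_ge0 ?exprn_ge0 ?(ltW q0).
exists (Num.min (2^-1 / q) (nrm (a p) / (K + 1))).
  by rewrite !lt_min !divr_gt0 ?invr_gt0// ltr_wpDl.
move=> z z0; rewrite lt_min => /andP[zq zk]; apply/negP => /eqP f0.
have nz : 0 < nrm z by exact: nrm_gt0.
have := hf p.+1 z; rewrite mulrC -ler_pdivlMr// => /(_ (ltW zq)).
rewrite f0// big_ord_recr/= big1 => [|i _]; last by rewrite ap0// scaler0.
rewrite !add0r nrmN nrmZ nrmX [nrm z * q]mulrC exprMn mulrA -/K exprSr.
rewrite [leRHS]mulrCA ler_pM2l ?exprn_gt0//.
move: zk; rewrite ltr_pdivlMr ?ltr_wpDl// mulrDr mulr1 => zk.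
by rewrite mulrC; lra.
Qed.

Lemma expands_zero c a f M q (r : R) : expands c a f M q -> 0 < r ->
  (forall z, z != 0 -> nrm z < r -> f (c + z) = 0) -> forall k, a k = 0.
Proof.
move=> hf r0 f0; elim/ltn_ind => k ih; apply/eqP/negPn/negP => ak.
have [r' r'0 h] := expands_lead hf ih ak.
have [|z z0] := @complex_small (Num.min r r'); first by rewrite lt_min r0.
by rewrite lt_min => /andP[/(f0 z z0) zr /(h z z0)]; rewrite zr eqxx.
Qed.

Lemma subrBB (x y z t : V) : (x - y) - (z - t) = (x - z) - (y - t).
Proof. by rewrite !opprB addrACA [RHS]addrACA [- y - z]addrC. Qed.

Lemma expands_uniq c a b f g M M' q (r : R) : expands c a f M q -> expands c b g M' q ->
  0 < r -> (forall z, z != 0 -> nrm z < r -> f (c + z) = g (c + z)) -> a =1 b.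
Proof.
move=> [M0 q0 ha hf] [M'0 _ hb hg] r0 fg k; apply/eqP; rewrite -subr_eq0; apply/eqP.
pose d k := a k - b k.
have hd : expands c d (fun l => f l - g l) (M + M') q.
  split => // [|{}k|N z hz].
  - exact: addr_ge0.
  - by rewrite mulrDl (le_trans (nrmB _ _))// lerD.
  under eq_bigr do rewrite scalerBr.
  rewrite sumrB subrBB mulrDl.
  by rewrite (le_trans (nrmB _ _))// lerD ?hf ?hg.
apply: (expands_zero hd r0) => z z0 zr.
by rewrite fg ?subrr.
Qed.

End Theory.

Section Maps.
Variables U V : normedModType C.

Lemma expands_lin (L : {linear U -> V}) (K : R) c a f M q : 0 <= K ->
  (forall u, nrm (L u) <= K * nrm u) ->
  expands c a f M q -> expands c (L \o a) (L \o f) (K * M) q.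
Proof.
move=> K0 hL [M0 q0 ha hf]; split => // [|k|N z hz].
- exact: mulr_ge0.
- by rewrite -mulrA (le_trans (hL _))// ler_wpM2l.
rewrite -mulrA /=; under eq_bigr do rewrite -linearZ.
by rewrite -linear_sum -linearB (le_trans (hL _))// ler_wpM2l// hf.
Qed.

(** The Cauchy product. The remainder of order [N] of [F l (g l)] is the
    remainder of [F] applied to [g l], plus each coefficient of [F] applied to
    a remainder of [g]; there are [N + 1 <= 2 ^ N] terms of the same size. *)
Lemma expands_app (A : nat -> {linear U -> V}) (F : C -> U -> V) c b g M M' q :
  0 <= M -> (forall u, expands c (A ^~ u) (F ^~ u) (M * nrm u) q) ->
  expands c b g M' q ->
  expands c (fun k => \sum_(i < k.+1) A i (b (k - i)%N)) (fun l => F l (g l))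
    (M * M') (2 * q).
Proof.
move=> M0 hA hb; have [M'0 q0 bb hg] := hb.
have hAb i u : nrm (A i u) <= M * nrm u * q ^+ i by have [] := hA u.
split => [||k|N z hz]; [exact: mulr_ge0|exact: mulr_gt0| |].
  rewrite exprMn (le_trans (nrm_sum _ _ _))//.
  rewrite (@le_trans _ _ (\sum_(i < k.+1) M * M' * q ^+ k))//.
    apply: ler_sum => i _; apply: (le_trans (hAb _ _)).
    have ik : (i <= k)%N by rewrite -ltnS.
    rewrite -[in leRHS](subnK ik) exprD mulrA ler_wpM2r ?exprn_ge0 ?(ltW q0)//.
    by rewrite -mulrA ler_wpM2l// bb.
  rewrite sumr_const card_ord -[leLHS]mulr_natl [leLHS]mulrCA ler_wpM2l ?mulr_ge0//.
  by rewrite ler_wpM2r ?exprn_ge0 ?(ltW q0)// natr_lt_exp2.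
have qz0 : 0 <= q * nrm z by rewrite mulr_ge0 ?nrm_ge0 ?ltW.
have hz' : q * nrm z <= 2^-1 by lra.
have -> : \sum_(k < N) z ^+ k *: (\sum_(i < k.+1) A i (b (k - i)%N)) =
    \sum_(i < N) z ^+ i *: A i (\sum_(j < N - i) z ^+ j *: b j).
  elim: N => [|N ih]; first by rewrite !big_ord0.
  rewrite [LHS]big_ord_recr/= ih [RHS]big_ord_recr/= subSnn big_ord1 expr0 scale1r.
  rewrite [X in _ + _ *: X]big_ord_recr/= subnn scalerDr addrA; congr (_ + _).
  rewrite scaler_sumr -big_split/=; apply: eq_bigr => i _.
  rewrite subSn ?(ltnW (ltn_ord i))// big_ord_recr/= linearD scalerDr linearZ/=.
  by rewrite scalerA -exprD subnKC// ltnW.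
have -> : F (c + z) (g (c + z)) -
    \sum_(i < N) z ^+ i *: A i (\sum_(j < N - i) z ^+ j *: b j) =
    (F (c + z) (g (c + z)) - \sum_(i < N) z ^+ i *: A i (g (c + z))) +
    \sum_(i < N) z ^+ i *: A i (g (c + z) - \sum_(j < N - i) z ^+ j *: b j).
  under [X in _ = _ + X]eq_bigr do rewrite linearB scalerBr.
  by rewrite sumrB addrA subrK.
rewrite (le_trans (nrmD _ _))//.
have h1 : nrm (F (c + z) (g (c + z)) - \sum_(i < N) z ^+ i *: A i (g (c + z))) <=
    M * M' * (q * nrm z) ^+ N.
  have [_ _ _ /(_ N z hz')] := hA (g (c + z)) => /le_trans; apply.
  by rewrite ler_wpM2r ?exprn_ge0// ler_wpM2l// (expands_bound hb).
have h2 : nrm (\sum_(i < N) z ^+ i *: A i (g (c + z) - \sum_(j < N - i) z ^+ j *: b j))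
    <= N%:R * (M * M' * (q * nrm z) ^+ N).
  rewrite (le_trans (nrm_sum _ _ _))// mulr_natl -[N in _ *+ N]card_ord -sumr_const.
  apply: ler_sum => i _; rewrite nrmZ nrmX.
  apply: (@le_trans _ _ (nrm z ^+ i * (M * (M' * (q * nrm z) ^+ (N - i)) * q ^+ i))).
    rewrite ler_wpM2l ?exprn_ge0 ?nrm_ge0// (le_trans (hAb _ _))//.
    by rewrite ler_wpM2r ?exprn_ge0 ?(ltW q0)// ler_wpM2l// hg.
  have iN : (i <= N)%N by exact: ltnW.
  rewrite -[in leRHS](subnK iN) [in leRHS]exprD [(_ * _) ^+ i]exprMn.
  by rewrite le_eqVlt; apply/orP; left; apply/eqP; ring.
apply: (le_trans (lerD h1 h2)); rewrite -[X in X + _]mul1r -mulrDl.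
rewrite -[1 + _](natrD _ 1 N) add1n -[2 * q * _]mulrA [(2 * _) ^+ _]exprMn.
rewrite [leLHS]mulrCA ler_wpM2l ?mulr_ge0// ler_wpM2r ?exprn_ge0//.
exact: natr_lt_exp2.
Qed.

End Maps.
End Expansions.

Section Shifts.
Variable R : realType.
Local Notation C := (cplx R).
Variable V : normedModType C.
Implicit Types (a b : nat -> V) (f g : C -> V) (c : C) (M q : R).

Lemma expands_shift c a f M q p : expands c a f M q ->
  expands c (fun k => if (k < p)%N then 0 else a (k - p)%N)
    (fun l => (l - c) ^+ p *: f l) (M / q ^+ p) q.
Proof.
move=> [M0 q0 ha hf]; have qp : 0 < q ^+ p by rewrite exprn_gt0.
split => // [|k|N z hz].
- by rewrite divr_ge0// ltW.
- case: ltnP => [_|pk].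
    by rewrite nrm0 mulr_ge0 ?exprn_ge0 ?divr_ge0// ltW.
  rewrite (le_trans (ha _))// -mulrA ler_wpM2l// ler_pdivlMl// -exprD.
  by rewrite subnKC.
have qz0 : 0 <= q * nrm z by rewrite mulr_ge0 ?nrm_ge0 ?(ltW q0).
have -> : \sum_(j < N) z ^+ j *: (if (j < p)%N then 0 else a (j - p)%N) =
    z ^+ p *: \sum_(j < N - p) z ^+ j *: a j.
  elim: N => [|N ih]; first by rewrite sub0n !big_ord0 scaler0.
  rewrite big_ord_recr/= ih; case: ltnP => [Np|pN].
    by rewrite scaler0 addr0 (eqP (ltnW Np : (N - p == 0)%N)) (eqP (Np : (N.+1 - p == 0)%N)).
  by rewrite subSn// big_ord_recr/= scalerDr scalerA -exprD subnKC.
rewrite [c + z]addrC addrK [z + c]addrC -scalerBr nrmZ nrmX.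
apply: (@le_trans _ _ (nrm z ^+ p * (M * (q * nrm z) ^+ (N - p)))).
  by rewrite ler_wpM2l ?exprn_ge0 ?nrm_ge0// hf.
have -> : nrm z ^+ p * (M * (q * nrm z) ^+ (N - p)) =
    M / q ^+ p * (q * nrm z) ^+ (p + (N - p)).
  by rewrite exprD [(q * nrm z) ^+ p]exprMn; field; rewrite gt_eqF.
rewrite ler_wpM2l ?divr_ge0 ?(ltW qp)// ler_wiXn2l//; last by rewrite -maxnE leq_maxr.
by rewrite (le_trans hz)// invf_le1// ler1n.
Qed.

(** Removable singularity: dividing by a power of [l - c] shifts the
    coefficients. *)
Lemma expands_div c a f g M q p : expands c a f M q ->
  (forall k, (k < p)%N -> a k = 0) -> g c = a p ->
  (forall l, l != c -> g l = (l - c) ^- p *: f l) ->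
  expands c (fun k => a (p + k)%N) g (M * q ^+ p) q.
Proof.
move=> [M0 q0 ha hf] a0 gc gE; have qp : 0 < q ^+ p by rewrite exprn_gt0.
split => // [|k|N z hz].
- by rewrite mulr_ge0// ltW.
- by rewrite -mulrA -exprD.
have [->|z0] := eqVneq z 0.
  rewrite addr0 gc nrm0 mulr0; case: N => [|N].
    by rewrite big_ord0 subr0 expr0 mulr1.
  rewrite big_ord_recl/= expr0 scale1r addn0 big1 => [|i _].
    by rewrite addr0 subrr nrm0 mulr_ge0 ?exprn_ge0// mulr_ge0// ltW.
  by rewrite /= expr0n/= scale0r.
have zp : 0 < nrm z ^+ p by rewrite exprn_gt0// nrm_gt0.
rewrite gE; last by rewrite -subr_eq0 [c + z]addrC addrK.
rewrite -(ler_pM2l zp) -nrmX -nrmZ scalerBr [c + z]addrC addrK scalerA.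
rewrite mulfV ?expf_neq0// scale1r [z + c]addrC nrmX.
have -> : z ^+ p *: (\sum_(j < N) z ^+ j *: a (p + j)%N) =
    \sum_(j < p + N) z ^+ j *: a j.
  rewrite big_split_ord/= [X in _ = X + _]big1 => [|i _]; last by rewrite a0 ?scaler0.
  by rewrite add0r scaler_sumr; apply: eq_bigr => i _; rewrite scalerA exprD.
rewrite (le_trans (hf _ _ hz))// le_eqVlt; apply/orP; left; apply/eqP.
by rewrite exprD exprMn; ring.
Qed.

End Shifts.

Section Completeness.
Variable R : realType.
Local Notation C := (cplx R).

(** Convergence of geometrically dominated series, the only form of
    completeness that power series require. *)
Definition geom_complete (V : normedModType C) := forall (s : nat -> V) (M : R),
  (forall k, nrm (s k) <= M * 2^-1 ^+ k) ->
  exists l : V, (fun N => \sum_(k < N) s k) @ \oo --> l.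

Lemma real_geom_complete (s : nat -> R) (M : R) :
  (forall k, `|s k| <= M * 2^-1 ^+ k) ->
  exists l : R, (fun N => \sum_(k < N) s k) @ \oo --> l.
Proof.
move=> h; have : cvgn (series s).
  apply: normed_cvg; apply: (@series_le_cvg _ _ (geometric M 2^-1)) => //=.
    by move=> n; exact: le_trans (h n).
  by apply: is_cvg_geometric_series; rewrite ger0_norm ?invr_ge0// invf_lt1// ltr1n.
move=> cs; exists (limn (series s)).
rewrite (_ : (fun N => _) = series s)//.
by apply/funext => N; rewrite /series/= big_mkord.
Qed.

Lemma complex_geom_complete : geom_complete C^o.
Proof.
move=> s M h.
have [x /cvgrPdist_lt hx] := @real_geom_complete (fun k => complex.Re (s k)) M
  (fun k => le_trans (nrm_Re (s k)) (h k)).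
have [y /cvgrPdist_lt hy] := @real_geom_complete (fun k => complex.Im (s k)) M
  (fun k => le_trans (nrm_Im (s k)) (h k)).
exists (x +i* y); apply/cvg_nrmP => e e0.
have e2 : 0 < e / 2 by rewrite divr_gt0.
near=> N; rewrite (le_lt_trans (nrm_ReIm _))// [ltRHS]splitr ltrD//.
  rewrite raddfB raddf_sum/= distrC; near: N; exact: hx.
rewrite raddfB raddf_sum/= distrC; near: N; exact: hy.
Unshelve. all: by end_near.
Qed.

End Completeness.

Section Matrices.
Variable R : realType.
Local Notation C := (cplx R).

Lemma nrm_entry m n (A : 'M[C]_(m, n)) i j : nrm (A i j) <= nrm A.
Proof.
rewrite -lecR -!nrmE {2}/Num.norm /= mx_normE.
by rewrite -[leLHS]nngE num_le; exact: (le_bigmax _ (fun i => `|A i.1 i.2|%:nng) (i, j)).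
Qed.

Lemma nrm_mx_le m n (A : 'M[C]_(m, n)) (r : R) : 0 <= r ->
  (forall i j, nrm (A i j) <= r) -> nrm A <= r.
Proof.
move=> r0 h; rewrite -lecR -nrmE {1}/Num.norm /=.
have [->|/mx_norm_neq0[ij ->]] := eqVneq (mx_norm A) 0; first by rewrite lecR.
by rewrite nrmE lecR.
Qed.

Lemma nrm_mulmx m n p (A : 'M[C]_(m, n)) (B : 'M[C]_(n, p)) :
  nrm (A *m B) <= n%:R * nrm A * nrm B.
Proof.
apply: nrm_mx_le => [|i j]; first by rewrite !mulr_ge0 ?nrm_ge0.
rewrite mxE (le_trans (nrm_sum _ _ _))// -mulrA mulr_natl.
have -> : nrm A * nrm B *+ n = \sum_(k < n) nrm A * nrm B.
  by rewrite sumr_const card_ord.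
apply: ler_sum => k _.
by rewrite nrmM ler_pM ?nrm_ge0 ?nrm_entry.
Qed.

Lemma matrix_geom_complete m n : geom_complete 'M[C]_(m, n).
Proof.
move=> s M h.
have M0 : 0 <= M by have := h 0%N; rewrite expr0 mulr1; apply: le_trans; exact: nrm_ge0.
have /choice[x hx] (ij : 'I_m * 'I_n) : exists l : C^o,
    (fun N => \sum_(k < N) s k ij.1 ij.2) @ \oo --> l.
  apply: (@complex_geom_complete R (fun k => s k ij.1 ij.2) M) => k.
  by apply: le_trans (h k); exact: nrm_entry.
exists (\matrix_(i, j) x (i, j)); apply/cvg_nrmP => e e0.
have e2 : 0 < e / 2 by rewrite divr_gt0.
have : \forall N \near \oo, forall ij, nrm ((\sum_(k < N) s k ij.1 ij.2 : C^o) - x ij) < e / 2.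
  apply: filter_forall => ij; have /cvg_nrmP := hx ij; exact.
apply: filterS => N hN; apply: (@le_lt_trans _ _ (e / 2)); last by lra.
apply: nrm_mx_le => [|i j]; first exact: ltW.
by rewrite !mxE summxE; have /ltW := hN (i, j).
Qed.

End Matrices.

(** * Analytic functions *)

Section Sums.
Variable R : realType.
Local Notation C := (cplx R).

Lemma geometric_sum_le2 (x : R) m : 0 <= x -> x <= 2^-1 ->
  \sum_(j < m) x ^+ j <= 2.
Proof.
move=> x0 x2; suff : \sum_(j < m) x ^+ j + 2 * x ^+ m <= 2.
  by have := exprn_ge0 m x0; lra.
elim: m => [|m ih]; first by rewrite big_ord0 expr0; lra.
rewrite big_ord_recr/= exprS; apply: le_trans ih.
by have := ler_wpM2r (exprn_ge0 m x0) x2; lra.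
Qed.

(** The remainder is a geometric tail of ratio at most [1 / 2], hence the factor 2. *)
Lemma expands_sum (V : normedModType C) (c : C) (a : nat -> V) (M q : R) :
  geom_complete V -> 0 <= M -> 0 < q -> (forall k, nrm (a k) <= M * q ^+ k) ->
  exists f, expands c a f (2 * M) q.
Proof.
move=> cV M0 q0 ha.
pose good (z : C) (l : V) := (fun N => \sum_(k < N) z ^+ k *: a k) @ \oo --> l.
exists (fun l => xget 0 [set v | good (l - c) v]).
split => // [||N z hz]; first exact: mulr_ge0.
  move=> k; apply: (le_trans (ha k)); rewrite ler_wpM2r ?exprn_ge0 ?(ltW q0)//.
  lra.
set x := q * nrm z in hz *.
have x0 : 0 <= x by rewrite mulr_ge0 ?nrm_ge0 ?(ltW q0).
have hzk k : nrm (z ^+ k *: a k) <= M * x ^+ k.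
  rewrite nrmZ nrmX /x exprMn mulrC [q ^+ k * _]mulrC mulrA.
  rewrite [M * _]mulrC -mulrA [leRHS]mulrC.
  by rewrite [M * _]mulrC mulrC [leRHS]mulrC ler_wpM2l ?exprn_ge0 ?nrm_ge0// mulrC.
have [l hl] : exists l, good z l.
  apply: (@cV (fun k => z ^+ k *: a k) M) => k; apply: (le_trans (hzk k)).
  by rewrite ler_wpM2l// lerXn2r ?nnegrE ?invr_ge0.
rewrite [c + z]addrC addrK; case: xgetP => [v _ {hl l}/cvg_nrmP hv|/(_ l)//].
apply/ler_addgt0Pl => e e0; have [m _ hm] := hv e e0.
pose D := \sum_(j < m) z ^+ (N + j) *: a (N + j)%N.
have SD : \sum_(k < N + m) z ^+ k *: a k = \sum_(k < N) z ^+ k *: a k + D.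
  by rewrite big_split_ord.
have := hm (N + m)%N (leq_addl _ _); rewrite SD => {}hm.
apply: (le_trans (nrm_dist (\sum_(k < N) z ^+ k *: a k + D) _ _)).
rewrite nrm_distC lerD ?(ltW hm)// [_ + D]addrC addrK (le_trans (nrm_sum _ _ _))//.
apply: (@le_trans _ _ (\sum_(j < m) M * x ^+ N * x ^+ j)).
  by apply: ler_sum => j _; rewrite (le_trans (hzk _))// exprD mulrA.
rewrite -mulr_sumr mulrC -mulrA ler_wpM2r ?mulr_ge0 ?exprn_ge0//.
exact: geometric_sum_le2.
Qed.

End Sums.

Section Analytic.
Variable R : realType.
Local Notation C := (cplx R).

Definition lin_of (K : pzRingType) (U V : lmodType K) (f : U -> V) (H : linear f)
  : {linear U -> V} := HB.pack f (GRing.isLinear.Build K U V _ f H).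

Lemma analytic_congr (V : normedModType C) (c : C) (f g : C -> V) (r : R) :
  0 < r -> (forall l, nrm (l - c) < r -> f l = g l) -> analytic c f -> analytic c g.
Proof.
by move=> r0 fg [a [M [q h]]]; exists a, M, (q + r^-1); exact: expands_congr h.
Qed.

Lemma analytic_cst (V : normedModType C) (c : C) (v : V) : analytic c (fun=> v).
Proof. by eexists; eexists; eexists; exact: expands_cst. Qed.

Lemma expands_join (V W : normedModType C) (c : C) (f : C -> V) (g : C -> W) :
  analytic c f -> analytic c g ->
  exists a M b M' q, expands c a f M q /\ expands c b g M' q.
Proof.
move=> [a [M [q ha]]] [b [M' [q' hb]]]; exists a, M, b, M', (Num.max q q').
have qq : q <= Num.max q q' /\ q' <= Num.max q q' by rewrite !le_max !lexx orbT.
by split; [exact: expandsW (lexx M) qq.1 ha|exact: expandsW (lexx M') qq.2 hb].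
Qed.

Lemma analyticD (V : normedModType C) (c : C) (f g : C -> V) :
  analytic c f -> analytic c g -> analytic c (fun l => f l + g l).
Proof.
move=> hf /(expands_join hf)[a [M [b [M' [q [ha hb]]]]]].
by eexists; eexists; eexists; exact: expandsD ha hb.
Qed.

Lemma analytic_sum (V : normedModType C) (c : C) (I : Type) (r : seq I) (f : I -> C -> V) :
  (forall i, analytic c (f i)) -> analytic c (fun l => \sum_(i <- r) f i l).
Proof.
move=> h; elim: r => [|i r ih].
  by under eq_fun do rewrite big_nil; exact: analytic_cst.
by under eq_fun do rewrite big_cons; exact: analyticD.
Qed.

Lemma analytic_lin (U V : normedModType C) (L : {linear U -> V}) (K : R) c f :
  0 <= K -> (forall u, nrm (L u) <= K * nrm u) -> analytic c f -> analytic c (L \o f).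
Proof.
by move=> K0 hL [a [M [q h]]]; do 3 eexists; exact: (expands_lin K0 hL h).
Qed.

(** Turns a scalar or matrix function into the kind of operator family that the
    Cauchy product multiplies with a vector function. *)
Lemma expands_bilin (W U V : normedModType C) (B : W -> U -> V) (K : R)
    c (a : nat -> W) f M q :
  (forall u, linear (B ^~ u)) -> 0 <= K ->
  (forall w u, nrm (B w u) <= K * nrm w * nrm u) -> expands c a f M q ->
  forall u, expands c (fun k => B (a k) u) (fun l => B (f l) u) (K * M * nrm u) q.
Proof.
move=> lB K0 hB h u; rewrite mulrAC.
apply: (@expands_lin _ _ _ (lin_of (lB u))) h; first by rewrite mulr_ge0 ?nrm_ge0.
by move=> w; rewrite mulrAC; exact: hB.
Qed.

Lemma expands_scale (V : normedModType C) c (a : nat -> C) (f : C -> C)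
    (b : nat -> V) g M M' q :
  expands c a f M q -> expands c b g M' q ->
  expands c (fun k => \sum_(i < k.+1) a i *: b (k - i)%N) (fun l => f l *: g l)
    (M * M') (2 * q).
Proof.
move=> ha hb; have [M0 _ _ _] := ha.
apply: (@expands_app _ _ _ (fun i => GRing.scale (a i) : {linear V -> V})
  (fun l u => f l *: u)) => // u.
rewrite -[M]mul1r; apply: (@expands_bilin C V V *:%R) => // [{}u k x y|x {}u].
  by rewrite scalerDl scalerA.
by rewrite nrmZ mul1r.
Qed.

Lemma expands_mulmx m n p c (a : nat -> 'M[C]_(m, n)) f (b : nat -> 'M[C]_(n, p)) g M M' q :
  expands c a f M q -> expands c b g M' q ->
  expands c (fun k => \sum_(i < k.+1) a i *m b (k - i)%N) (fun l => f l *m g l)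
    (n%:R * M * M') (2 * q).
Proof.
move=> ha hb; have [M0 _ _ _] := ha.
apply: (@expands_app _ _ _ (fun i => mulmx (a i) : {linear _ -> _})
  (fun l u => f l *m u)) => // [|u]; first by rewrite mulr_ge0.
apply: (@expands_bilin _ _ _ mulmx) => // [{}u k x y|x {}u].
  by rewrite mulmxDl scalemxAl.
exact: nrm_mulmx.
Qed.

Lemma analyticZ (V : normedModType C) c (f : C -> C) (g : C -> V) :
  analytic c f -> analytic c g -> analytic c (fun l => f l *: g l).
Proof.
move=> hf /(expands_join hf)[a [M [b [M' [q [ha hb]]]]]].
by eexists; eexists; eexists; exact: expands_scale ha hb.
Qed.

Lemma analytic_prod c (I : Type) (r : seq I) (f : I -> C -> C) :
  (forall i, analytic c (f i)) -> analytic c (fun l => \prod_(i <- r) f i l).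
Proof.
move=> h; elim: r => [|i r ih].
  by under eq_fun do rewrite big_nil; exact: analytic_cst.
by under eq_fun do rewrite big_cons; exact: analyticZ.
Qed.

Lemma analytic_det n c (f : C -> 'M[C]_n) :
  (forall i j, analytic c (fun l => f l i j)) -> analytic c (fun l => \det (f l)).
Proof.
move=> h; apply: analytic_sum => s.
by apply: analyticZ; [exact: analytic_cst|exact: analytic_prod].
Qed.

Lemma analytic_matrix m n c (f : C -> 'M[C]_(m, n)) :
  (forall i j, analytic c (fun l => f l i j)) -> analytic c f.
Proof.
move=> h.
have -> : f = fun l => \sum_i \sum_j f l i j *: delta_mx i j.
  by apply/funext => l; exact: matrix_sum_delta.
apply: analytic_sum => i; apply: analytic_sum => j.
by apply: analyticZ => //; exact: analytic_cst.
Qed.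

Lemma analytic_adj n c (f : C -> 'M[C]_n) :
  (forall i j, analytic c (fun l => f l i j)) -> analytic c (fun l => \adj (f l)).
Proof.
move=> h; apply: analytic_matrix => i j.
under eq_fun do rewrite mxE /cofactor.
apply: analyticZ; first exact: analytic_cst.
apply: analytic_det => i' j'.
by under eq_fun do rewrite !mxE; exact: h.
Qed.

Lemma analytic_bounded (V : normedModType C) (c : C) (f : C -> V) : analytic c f ->
  exists M r : R, [/\ 0 <= M, 0 < r &
    forall l, nrm (l - c) < r -> nrm (f l - f c) <= M * nrm (l - c)].
Proof.
move=> [a [M [q h]]]; have [M0 q0 _ hf] := h.
exists (M * q), (2^-1 / q); split; first by rewrite mulr_ge0// ltW.
  by rewrite divr_gt0.
move=> l; rewrite ltr_pdivlMr// mulrC => /ltW/(hf 1%N).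
rewrite big_ord1 expr0 scale1r -(expands_center h) expr1 mulrA.
by rewrite [c + _]addrC subrK.
Qed.

End Analytic.

Section Inverse.
Variable R : realType.
Local Notation C := (cplx R).

(** Course-of-values recursion for the convolution equation satisfied by the
    coefficients of a reciprocal. *)
Lemma convolution_rec (h : nat -> C) (v : C) : exists b : nat -> C,
  b 0%N = v /\ forall k, b k.+1 = \sum_(i < k.+1) h i * b (k - i)%N.
Proof.
pose step (g : nat -> C) k :=
  if k is k'.+1 then \sum_(i < k'.+1) h i * g (k' - i)%N else v.
pose it m := iter m step (fun=> 0).
have stable k m m' : (k < m)%N -> (k < m')%N -> it m k = it m' k.
  elim/ltn_ind: k m m' => -[|k] ih [|m] [|m']//= km km'.
  apply: eq_bigr => i _; congr (_ * _); apply: ih.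
  - by rewrite ltnS leq_subr.
  - by rewrite (leq_ltn_trans (leq_subr _ _)).
  - by rewrite (leq_ltn_trans (leq_subr _ _)).
exists (fun k => it k.+1 k); split => // k.
rewrite -[LHS]/(\sum_(i < k.+1) h i * it k.+1 (k - i)%N).
by apply: eq_bigr => i _; congr (_ * _); apply: stable; rewrite ltnS ?leq_subr.
Qed.

(** The coefficients [b] solving [f * b = 1] formally grow geometrically, so they
    have a sum [g], and [f * g - 1] vanishes because all its coefficients do. *)
Lemma analytic_inv (f : C -> C) c : f c != 0 -> analytic c f ->
  analytic c (fun l => (f l)^-1).
Proof.
move=> fc0 [a [M [q hf]]]; have [M0 q0 ha _] := hf.
have a0 : a 0%N != 0 by rewrite -(expands_center hf).
have na0 : 0 < nrm (a 0%N) by exact: nrm_gt0.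
pose h i := - a i.+1 / a 0%N.
have [b [b0 bS]] := convolution_rec h (a 0%N)^-1.
(* the growth rate q + H absorbs the convolution: H sum q^i s^(k-i) <= s^(k+1) *)
pose H := M * q / nrm (a 0%N); pose s := q + H.
have H0 : 0 <= H by rewrite divr_ge0 ?mulr_ge0// ltW.
have qs : q <= s by rewrite lerDl.
have s0 : 0 < s by exact: lt_le_trans qs.
have hH i : nrm (h i) <= H * q ^+ i.
  rewrite nrmM nrmN nrmV /H mulrAC ler_wpM2r ?invr_ge0 ?nrm_ge0//.
  by rewrite (le_trans (ha _))// exprS mulrA.
have bb k : nrm (b k) <= (nrm (a 0%N))^-1 * s ^+ k.
  elim/ltn_ind: k => -[|k] ih; first by rewrite b0 nrmV expr0 mulr1.
  rewrite bS (le_trans (nrm_sum _ _ _))//.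
  apply: (@le_trans _ _ (\sum_(i < k.+1) (nrm (a 0%N))^-1 *
      (H * (s ^+ (k - i) * q ^+ i)))).
    apply: ler_sum => i _; rewrite nrmM.
    apply: (@le_trans _ _ (H * q ^+ i * ((nrm (a 0%N))^-1 * s ^+ (k - i)))).
      by rewrite ler_pM ?nrm_ge0// ih// ltnS leq_subr.
    by rewrite le_eqVlt; apply/orP; left; apply/eqP; ring.
  rewrite -mulr_sumr ler_wpM2l ?invr_ge0 ?nrm_ge0// -mulr_sumr.
  have -> : H = s - q by rewrite /s addrC addKr.
  rewrite (_ : \sum_(i < k.+1) _ = \sum_(i < k.+1) s ^+ (k.+1.-1 - i) * q ^+ i)//.
  by rewrite -subrXX lerBlDr lerDl exprn_ge0 ?(ltW q0).
have [|g hg] := expands_sum c (@complex_geom_complete R) _ s0 bb.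
  by rewrite invr_ge0 nrm_ge0.
have hf' := expandsW (lexx _) qs hf.
have hfg := expands_scale hf' hg.
have coef k : \sum_(i < k.+1) a i *: b (k - i)%N = (if k is 0%N then 1 else 0 : C).
  case: k => [|k]; first by rewrite big_ord1 b0; exact: mulfV.
  rewrite big_ord_recl subn0 bS /=.
  rewrite -[a 0%N *: _]/(a 0%N * _) mulr_sumr -big_split/= big1// => i _.
  rewrite subSS -[a _ *: _]/(a (lift ord0 i) * b (k - i)%N) /h.
  by rewrite mulrA [a 0%N * _]mulrC mulfVK// mulNr addNr.
have q1 : 2 * s <= 2 * s + 1 /\ 1 <= 2 * s + 1.
  by rewrite lerDl lerDr ler01 mulr_ge0// ltW.
have hd := expandsD (expandsW (lexx _) q1.1 hfg)
  (expandsW (lexx _) q1.2 (expands_cst c (-1 : C^o))).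
have d0 k : ((fun k : nat => \sum_(i < k.+1) a i *: b (k - i)%N) \+
    (fun k => if k is 0%N then -1 else 0 : C^o)) k = 0.
  by rewrite /= coef; case: k => [|k]; [exact: subrr|exact: addr0].
exists b, (2 * (nrm (a 0%N))^-1), (s + (2^-1 / (2 * s + 1))^-1).
have r0 : 0 < 2^-1 / (2 * s + 1).
  by rewrite divr_gt0// ltr_wpDl// mulr_ge0// ltW.
apply: (expands_congr r0 (fun=> erefl)) hg => l.
rewrite ltr_pdivlMr ?ltr_wpDl ?mulr_ge0 ?(ltW s0)// mulrC => /ltW hl.
have := expands_vanish hd d0 hl; rewrite /= [c + _]addrC subrK => /eqP.
rewrite subr_eq0 => /eqP fg; have fl : f l != 0.
  by apply/negP => /eqP fl; move: fg; rewrite fl scale0r => /eqP; rewrite eq_sym oner_eq0.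
by apply: (mulfI fl); rewrite mulfV.
Qed.

(** If all coefficients at [d] were 0, then the infimum of the parameters beyond
    which [f] vanishes would be a zero of infinite order; [f] would vanish on both
    sides of it, so the infimum would be the parameter 0 of [c]. *)
Lemma identity_segment (f : C -> C) (c d : C) a M q :
  (forall t : R, 0 <= t <= 1 -> analytic (c + t%:C * (d - c)) f) ->
  f c != 0 -> expands d a f M q -> exists k, a k != 0.
Proof.
move=> fan fc hd; apply/not_existsP => /= a0.
have {}a0 k : a k = 0 by apply/eqP/negPn/negP; exact: a0.
pose g (t : R) : C := c + t%:C * (d - c).
have gB t u : g t - g u = (t - u)%:C * (d - c).
  by rewrite /g opprD addrACA subrr add0r -mulrBl rmorphB.
have g1 : g 1 = d by rewrite /g mul1r addrC subrK.
have g0 : g 0 = c by rewrite /g mul0r addr0.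
have [_ q0 _ _] := hd.
have dc : d != c.
  apply: contra_neq fc => <-.
  by rewrite -[d]addr0 (expands_vanish hd)// nrm0 mulr0 invr_ge0.
have ndc : 0 < nrm (d - c) by rewrite nrm_gt0// subr_eq0.
pose S := [set t : R | 0 <= t <= 1 /\ forall u, t <= u <= 1 -> f (g u) = 0].
have S1 : S 1.
  split; first by rewrite ler01 lexx.
  move=> u; rewrite -eq_le => /eqP <-; rewrite g1 -[d]addr0.
  by rewrite (expands_vanish hd)// nrm0 mulr0 invr_ge0.
have Slb : lbound S 0 by move=> t [/andP[]].
have Sinf : has_inf S by split; [exists 1|exists 0].
pose m := inf S.
have m0 : 0 <= m by apply: lb_le_inf => //; exists 1.
have m1 : m <= 1 by apply: ge_inf => //; exists 0.
have mz u : m < u <= 1 -> f (g u) = 0.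
  move=> /andP[mu u1]; have [t [_ ht] tu] := inf_lt (proj1 Sinf) mu.
  by apply: ht; rewrite (ltW tu).
(* f vanishes at the points to the right of m, which excludes a first nonzero
   coefficient at m *)
have [b [N [p [hb b0]]]] : exists b N p, expands (g m) b f N p /\ forall k, b k = 0.
  move: m1; rewrite le_eqVlt => /predU1P[->|m1].
    by rewrite g1; exists a, M, q.
  have [|b [N [p hb]]] := fan m; first by rewrite m0 ltW.
  exists b, N, p; split=> //; elim/ltn_ind => k ih; apply/eqP/negPn/negP => bk.
  have [r r0 h] := expands_lead hb ih bk.
  pose e := Num.min (1 - m) (r / 2 / nrm (d - c)).
  have e0 : 0 < e by rewrite lt_min subr_gt0 m1 !divr_gt0.
  have := h (e%:C * (d - c)); rewrite nrmM nrm_real gtr0_norm//.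
  have -> : g m + e%:C * (d - c) = g (m + e).
    by rewrite /g rmorphD mulrDl addrA.
  have er : e * nrm (d - c) < r.
    rewrite -ltr_pdivlMr// (@le_lt_trans _ _ (r / 2 / nrm (d - c)))//.
      by rewrite ge_min lexx orbT.
    by rewrite ltr_pM2r ?invr_gt0//; lra.
  move=> /(_ _ er); rewrite mz ?eqxx => [|]; last first.
    by rewrite ltrDl e0/= -lerBrDl ge_min lexx.
  move=> /(_ _)/negP; apply=> //.
  by rewrite mulf_neq0 ?subr_eq0// -(rmorph0 (real_complex R)) (inj_eq (@complexI R)) gt_eqF.
have [_ p0 _ _] := hb.
pose e := 2^-1 / p / nrm (d - c).
have e0 : 0 < e by rewrite !divr_gt0.
have near u : `|u - m| <= e -> f (g u) = 0.
  move=> ue; have -> : g u = g m + (g u - g m) by rewrite addrC subrK.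
  apply: (expands_vanish hb b0).
  by rewrite gB nrmM nrm_real mulrC -ler_pdivlMr// -ler_pdivlMr.
pose t := Num.max 0 (m - e).
have tm : t <= m by rewrite ge_max m0 lerBlDr lerDl ltW.
have tz u : t <= u -> u <= 1 -> f (g u) = 0.
  move=> tu u1; have [mu|um] := ltP m u; first by rewrite mz ?mu.
  apply: near; rewrite distrC ger0_norm ?subr_ge0//.
  by rewrite lerBlDr -lerBlDl (le_trans _ tu)// le_max lexx orbT.
have St : S t.
  split; first by rewrite le_max lexx (le_trans tm).
  by move=> u /andP[]; exact: tz.
have mt : m <= t by apply: ge_inf => //; exists 0.
have tE : t = 0.
  move: mt; rewrite /t maxEle; case: ifP => // _ me.
  by exfalso; move: me e0; rewrite lerDl oppr_ge0 leNgt => /negP.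
by move: fc; rewrite -g0 tz ?tE// eqxx.
Qed.

End Inverse.

Section Derivatives.
Variable R : realType.
Local Notation C := (cplx R).
Variable V : normedModType C.

Lemma is_derive_nrmP (f : C -> V) (l : C) (v : V) : is_derive l 1 f v <->
  forall e : R, 0 < e -> exists2 d : R, 0 < d &
    forall h : C, h != 0 -> nrm h < d -> nrm (h^-1 *: (f (l + h) - f l) - v) < e.
Proof.
have E : (fun h : C => h^-1 *: (f (h *: (1 : C^o) + l) - f l)) =
         (fun h : C => h^-1 *: (f (l + h) - f l)).
  by apply/funext => h; rewrite [h *: _]mulr1 [h + l]addrC.
split=> [[/cvg_ex[w hw] <-]|h].
  have hw0 := hw; rewrite E in hw => e e0.
  have -> : 'D_1 f l = w by rewrite /derive; exact: cvg_lim hw0.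
  have /cvg_nrmP/(_ e e0)/dnbhs_nrmP[d d0 hd] := hw.
  by exists d => // z z0 zd; apply: hd => //; rewrite subr0.
have : (fun h : C => h^-1 *: (f (l + h) - f l)) @ (0 : C)^' --> v.
  apply/cvg_nrmP => e /h[d d0 hd]; apply/dnbhs_nrmP; exists d => // z z0.
  by rewrite subr0; exact: hd.
rewrite -E => hv; apply: DeriveDef; first by apply/cvg_ex; exists v.
by rewrite /derive; exact: cvg_lim hv.
Qed.

Lemma is_derive_congr (f g : C -> V) (l : C) (v : V) (r : R) : 0 < r ->
  (forall h, nrm (h - l) < r -> f h = g h) -> is_derive l 1 f v -> is_derive l 1 g v.
Proof.
move=> r0 fg /is_derive_nrmP h; apply/is_derive_nrmP => e /h[d d0 hd].
exists (Num.min d r); first by rewrite lt_min d0.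
move=> z z0; rewrite lt_min => /andP[zd zr].
by rewrite -!fg ?subrr ?nrm0 ?[l + z]addrC ?addrK// addrC; exact: hd.
Qed.

(** The second order remainders [T k = (z + h)^k - z^k - k h z^(k-1)] satisfy
    [T (k+1) = (z + h) T k + k h^2 z^(k-1)], hence are small of order [h^2]. *)
Lemma expands_derive c (a : nat -> V) f M q : geom_complete V -> expands c a f M q ->
  exists f' M' q', expands c (fun k => a k.+1 *+ k.+1) f' M' q' /\
    exists2 r : R, 0 < r &
      forall l, nrm (l - c) < r -> is_derive l 1 f (f' l).
Proof.
move=> cV [M0 q0 ha hf].
have ha' k : nrm (a k.+1 *+ k.+1) <= M * q * (2 * q) ^+ k.
  have -> : M * q * (2 * q) ^+ k = 2 ^+ k * (M * q ^+ k.+1).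
    by rewrite exprMn exprS; ring.
  rewrite -scaler_nat nrmZ nrm_nat ler_pM ?nrm_ge0 ?ha//.
  exact: natr_lt_exp2.
have [||f' hf'] := expands_sum c cV _ _ ha'.
- by rewrite mulr_ge0// ltW.
- by rewrite mulr_gt0.
exists f', (2 * (M * q)), (2 * q); split=> //.
have [M'0 _ _ {}hf'] := hf'.
pose r := (8 * q)^-1.
have r0 : 0 < r by rewrite invr_gt0 mulr_gt0.
have qr : q * r = 8^-1 by rewrite /r; field; rewrite gt_eqF.
exists r => // l lr; apply/is_derive_nrmP => e e0.
pose z := l - c; have lE : l = c + z by rewrite /z addrC subrK.
rewrite -/z in lr.
pose K := 2 * M / r ^+ 2.
have K0 : 0 <= K by rewrite divr_ge0 ?mulr_ge0 ?exprn_ge0 ?(ltW r0).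
exists (Num.min (r - nrm z) (e / (K + 1))).
  by rewrite lt_min subr_gt0 lr divr_gt0// ltr_wpDl.
move=> h h0; rewrite lt_min => /andP[hr he].
have nh : 0 < nrm h by exact: nrm_gt0.
have zhr : nrm (z + h) <= r by rewrite (le_trans (nrmD _ _))// -lerBrDl ltW.
have disc (w : C) : nrm w <= r -> q * nrm w <= 2^-1 /\ 2 * q * nrm w <= 2^-1.
  move=> /(ler_wpM2l (ltW q0)); rewrite qr => wr; split.
    by apply: (le_trans wr); lra.
  by rewrite -mulrA; lra.
pose T k := (z + h) ^+ k - z ^+ k - k%:R * h * z ^+ k.-1.
have TE k : r ^+ 2 * nrm (T k) <= nrm h ^+ 2 * (2 * r) ^+ k.
  elim: k => [|k ih].
    by rewrite /T !expr0 subrr !mul0r subr0 nrm0 mulr0 mulr_ge0 ?exprn_ge0 ?nrm_ge0.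
  have -> : T k.+1 = (z + h) * T k + k%:R * h ^+ 2 * z ^+ k.-1.
    by rewrite /T; case: k {ih} => [|k] /=; rewrite ?exprS -?natr1; ring.
  apply: (@le_trans _ _ (r * (nrm h ^+ 2 * (2 * r) ^+ k) + nrm h ^+ 2 * (k%:R * r ^+ k.+1))).
    rewrite (le_trans (ler_wpM2l _ (nrmD _ _))) ?exprn_ge0 ?(ltW r0)//.
    rewrite mulrDr lerD// !nrmM.
      rewrite mulrCA; apply: ler_pM => //; rewrite ?nrm_ge0//.
      by rewrite mulr_ge0 ?exprn_ge0 ?nrm_ge0 ?(ltW r0).
    rewrite nrm_nat !nrmX; case: k {ih} => [|k] /=; first by rewrite !mul0r !mulr0.
    rewrite mulrCA -mulrA mulrCA -mulrA.
    have : nrm z ^+ k <= r ^+ k by rewrite lerXn2r ?nnegrE ?nrm_ge0 ?(ltW r0) ?(ltW lr).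
    move=> /(ler_wpM2l (_ : 0 <= k.+1%:R * nrm h ^+ 2 * r ^+ 2)) zk.
    apply: le_trans (le_trans (zk _) _); last 1 first.
    - by rewrite le_eqVlt; apply/orP; left; apply/eqP; rewrite !exprS; ring.
    - by rewrite le_eqVlt; apply/orP; left; apply/eqP; ring.
    - by rewrite !mulr_ge0 ?exprn_ge0 ?nrm_ge0 ?(ltW r0).
  have -> : nrm h ^+ 2 * (2 * r) ^+ k.+1 =
     r * (nrm h ^+ 2 * (2 * r) ^+ k) + nrm h ^+ 2 * (2 ^+ k * r ^+ k.+1).
    by rewrite !exprMn !exprS; ring.
  rewrite lerD2l ler_wpM2l ?exprn_ge0 ?nrm_ge0// ler_wpM2r ?exprn_ge0 ?(ltW r0)//.
  by rewrite (le_trans _ (natr_lt_exp2 _ _))// ler_nat.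
pose D := f (c + (z + h)) - f (c + z) - h *: f' (c + z).
have DK : nrm D - K * nrm h ^+ 2 <= 0.
  apply: (@le_geometric_le0 R _ (2 * M + nrm h * (2 * (M * q)))) => N.
  pose S w := \sum_(j < N.+1) w ^+ j *: a j.
  pose S' := \sum_(j < N) z ^+ j *: (a j.+1 *+ j.+1).
  have SE : S (z + h) - S z - h *: S' = \sum_(j < N.+1) T j *: a j.
    have -> : h *: S' = \sum_(j < N.+1) (j%:R * h * z ^+ j.-1) *: a j.
      rewrite big_ord_recl /= !mul0r scale0r add0r scaler_sumr; apply: eq_bigr => j _.
      by rewrite -scaler_nat !scalerA /bump/= add1n /=; congr (_ *: _); ring.
    by rewrite /S -!sumrB; apply: eq_bigr => j _; rewrite !scalerBl.
  have DE : D = (f (c + (z + h)) - S (z + h)) - (f (c + z) - S z)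
      - h *: (f' (c + z) - S') + \sum_(j < N.+1) T j *: a j.
    by rewrite -SE scalerBr (subrBB (f (c + (z + h)))) (subrBB (_ - f (c + z))) subrK.
  have half (x : R) n m : (m <= n)%N -> 0 <= x <= 2^-1 -> x ^+ n <= 2^-1 ^+ m.
    move=> mn /andP[x0 x1]; apply: (@le_trans _ _ (2^-1 ^+ n)).
      by rewrite lerXn2r ?nnegrE ?invr_ge0.
    by rewrite ler_wiXn2l ?invr_ge0// invf_le1 ?ler1n.
  have rem (w : C) : nrm w <= r -> nrm (f (c + w) - S w) <= M * 2^-1 ^+ N.
    move=> /disc[wq _]; rewrite (le_trans (hf N.+1 w wq))// ler_wpM2l//.
    by apply: half => //; rewrite wq mulr_ge0 ?nrm_ge0// ltW.
  have hT : nrm (\sum_(j < N.+1) T j *: a j) <= K * nrm h ^+ 2.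
    rewrite (le_trans (nrm_sum _ _ _))//.
    apply: (@le_trans _ _ (\sum_(j < N.+1) M * nrm h ^+ 2 / r ^+ 2 * 4^-1 ^+ j)).
      apply: ler_sum => j _; rewrite nrmZ.
      have {}TE : nrm (T j) <= nrm h ^+ 2 * (2 * r) ^+ j / r ^+ 2.
        by rewrite ler_pdivlMr ?exprn_gt0// mulrC.
      apply: (le_trans (ler_pM (nrm_ge0 _) (nrm_ge0 _) TE (ha j))).
      rewrite le_eqVlt; apply/orP; left; apply/eqP.
      have -> : 4^-1 = 2 * (q * r) by rewrite qr; field.
      by rewrite !exprMn; ring.
    rewrite -mulr_sumr /K; apply: (@le_trans _ _ (M * nrm h ^+ 2 / r ^+ 2 * 2)).
      rewrite ler_wpM2l ?mulr_ge0 ?invr_ge0 ?exprn_ge0 ?nrm_ge0 ?(ltW r0)//.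
      by apply: geometric_sum_le2; lra.
    by rewrite le_eqVlt; apply/orP; left; apply/eqP; ring.
  have hS' : nrm (h *: (f' (c + z) - S')) <= nrm h * (2 * (M * q)) * 2^-1 ^+ N.
    have [_ zq] := disc z (ltW lr).
    rewrite nrmZ -mulrA ler_wpM2l ?nrm_ge0// (le_trans (hf' N z zq))//.
    rewrite ler_wpM2l//; apply: half => //.
    by rewrite zq !mulr_ge0 ?nrm_ge0// ltW.
  have h1 := rem _ zhr; have h2 := rem z (ltW lr).
  rewrite DE lerBlDr (le_trans (nrmD _ _))// lerD//.
  rewrite (le_trans (nrmB _ _))// [leRHS]mulrDl lerD//.
  by rewrite (le_trans (nrmB _ _))//; lra.
have -> : h^-1 *: (f (l + h) - f l) - f' l = h^-1 *: D.
  by rewrite /D lE [c + (z + h)]addrA [in RHS]scalerBr [in RHS]scalerA mulVf// scale1r.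
rewrite nrmZ nrmV mulrC ltr_pdivrMr//.
apply: (@le_lt_trans _ _ (K * nrm h * nrm h)); first by move: DK; rewrite expr2 mulrA; lra.
rewrite ltr_pM2r//; move: he; rewrite ltr_pdivlMr ?ltr_wpDl// mulrDr mulr1.
by rewrite mulrC; lra.
Qed.

(** Term by term derivation, iterated: each derivative again has an expansion, on
    a possibly smaller disc. *)
Lemma expands_derive1n c (a : nat -> V) f M q i : geom_complete V -> expands c a f M q ->
  exists fi M' q', expands c (fun k => a (k + i)%N *+ (k + i) ^_ i) fi M' q' /\
    exists2 r : R, 0 < r & forall l, nrm (l - c) < r ->
      derive1n i f l = fi l /\ derivable (derive1n i f) l 1.
Proof.
move=> cV hf; suff : exists fi M' q',
    expands c (fun k => a (k + i)%N *+ (k + i) ^_ i) fi M' q' /\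
    exists2 r : R, 0 < r & forall l, nrm (l - c) < r -> derive1n i f l = fi l.
  move=> [fi [M' [q' [h [r r0 hr]]]]]; exists fi, M', q'; split=> //.
  have [f' [_ [_ [_ [r' r'0 hr']]]]] := expands_derive cV h.
  exists (Num.min r r'); first by rewrite lt_min r0.
  move=> l; rewrite lt_min => /andP[lr lr']; split; first exact: hr.
  have [] // := @is_derive_congr fi (derive1n i f) l (f' l) (r - nrm (l - c)).
  - by rewrite subr_gt0.
  - move=> h'; rewrite ltrBrDr => h'l; rewrite hr//.
    by rewrite (le_lt_trans (nrm_dist l _ _)).
  - exact: hr'.
elim: i => [|i [fi [M' [q' [h [r r0 hr]]]]]].
  exists f, M, q; split; last by exists 1.
  by move: hf; congr (expands _ _ _ _ _); apply/funext => k; rewrite addn0 ffactn0.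
have [f' [M'' [q'' [h' [r' r'0 hr']]]]] := expands_derive cV h.
exists f', M'', q''; split.
  move: h'; congr (expands _ _ _ _ _); apply/funext => k.
  rewrite addSnnS -mulrnA ffactnSr; congr (_ *+ (_ * _)).
  by rewrite addnS -addSn addnK.
exists (Num.min r r'); first by rewrite lt_min r0.
move=> l; rewrite lt_min => /andP[lr lr'].
rewrite derive1nS derive1E.
have [] // := @is_derive_congr fi (derive1n i f) l (f' l) (r - nrm (l - c)).
- by rewrite subr_gt0.
- move=> h''; rewrite ltrBrDr => h'l; rewrite hr//.
  by rewrite (le_lt_trans (nrm_dist l _ _)).
- exact: hr'.
Qed.

Lemma expands_taylor c (a : nat -> V) f M q i : geom_complete V -> expands c a f M q ->
  derivable (derive1n i f) c 1 /\ derive1n i f c = a i *+ i`!.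
Proof.
move=> cV hf; have [fi [M' [q' [h [r r0 hr]]]]] := expands_derive1n i cV hf.
have [|e d] := hr c; first by rewrite subrr nrm0.
by split=> //; rewrite e (expands_center h) add0n ffactnn.
Qed.

(** [g] may take any value at the center itself, as a function extended by default
    at its singularity does; so only a limit at the center can be stated. *)
Lemma punctured_derive1n c (a : nat -> V) f g M q i : geom_complete V ->
  expands c a f M q -> (\forall l \near c^', g l = f l) ->
  (\forall l \near c^', derivable (derive1n i g) l 1) /\
  derive1n i g l @[l --> c^'] --> a i *+ i`!.
Proof.
move=> cV hf /dnbhs_nrmP[r0 r00 gf].
have gfn j : exists2 r : R, 0 < r & forall l, l != c -> nrm (l - c) < r ->
    derive1n j g l = derive1n j f l.
  elim: j => [|j [r r1 ih]]; first by exists r0.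
  have [fj [_ [_ [_ [r' r'0 hr']]]]] := expands_derive1n j cV hf.
  exists (Num.min r r'); first by rewrite lt_min r1.
  move=> l lc; rewrite lt_min => /andP[lr lr'].
  have lc0 : 0 < nrm (l - c) by rewrite nrm_gt0// subr_eq0.
  have [_ /derivableP dl] := hr' l lr'.
  have [] := @is_derive_congr (derive1n j f) (derive1n j g) l _
    (Num.min (nrm (l - c)) (r - nrm (l - c))) _ _ dl.
  - by rewrite lt_min lc0 subr_gt0.
  - move=> h; rewrite lt_min ltrBrDr => /andP[hl hr]; rewrite ih//.
      by apply: contraTN hl => /eqP ->; rewrite nrm_distC ltxx.
    by rewrite (le_lt_trans (nrm_dist l _ _)).
  by rewrite !derive1nS !derive1E.
have [fi [M' [q' [h [r r1 hr]]]]] := expands_derive1n i cV hf.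
have [r2 r20 gfi] := gfn i.
split.
  apply/dnbhs_nrmP; exists (Num.min r2 r); first by rewrite lt_min r20.
  move=> l lc; rewrite lt_min => /andP[lr2 lr].
  have lc0 : 0 < nrm (l - c) by rewrite nrm_gt0// subr_eq0.
  have [_ /derivableP dl] := hr l lr.
  have [] // := @is_derive_congr (derive1n i f) (derive1n i g) l _
    (Num.min (nrm (l - c)) (r2 - nrm (l - c))) _ _ dl.
  - by rewrite lt_min lc0 subr_gt0.
  - move=> h'; rewrite lt_min ltrBrDr => /andP[hl hr']; rewrite gfi//.
      by apply: contraTN hl => /eqP ->; rewrite nrm_distC ltxx.
    by rewrite (le_lt_trans (nrm_dist l _ _)).
have fic : fi c = a i *+ i`! by rewrite (expands_center h) add0n ffactnn.
have [|K [r3 [K0 r30 hK]]] := @analytic_bounded R V c fi; first by do 3 eexists; exact: h.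
apply/cvg_nrmP => e e0; apply/dnbhs_nrmP.
exists (Num.min (Num.min r2 r) (Num.min r3 (e / (K + 1)))).
  by rewrite !lt_min r20 r1 r30 divr_gt0// ltr_wpDl.
move=> l lc; rewrite !lt_min => /andP[/andP[l2 lr] /andP[l3 le]].
rewrite gfi// (hr l lr).1 -fic (le_lt_trans (hK l l3))//.
move: le; rewrite ltr_pdivlMr ?ltr_wpDl// mulrDr mulr1 mulrC.
by have := nrm_ge0 (l - c); lra.
Qed.

End Derivatives.

(** * Laurent expansion of a resolvent *)

Section Taylor.
Variable R : realType.
Local Notation C := (cplx R).

(** The coefficients matter in identities between expansions, the constants do
    not. *)
Definition taylor (V : normedModType C) (c : C) (a : nat -> V) (f : C -> V) :=
  exists M q, expands c a f M q.

Variables (V W : normedModType C) (c : C).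
Implicit Types (a b : nat -> V) (f g : C -> V).

Lemma taylorD a b f g : taylor c a f -> taylor c b g ->
  taylor c (fun k => a k + b k) (fun l => f l + g l).
Proof.
move=> [M [q ha]] [M' [q' hb]]; exists (M + M'), (Num.max q q').
by apply: expandsD; [apply: expandsW ha|apply: expandsW hb]; rewrite ?le_max ?lexx ?orbT.
Qed.

Lemma taylor_lin (L : {linear V -> W}) (K : R) a f :
  (forall u, nrm (L u) <= K * nrm u) -> taylor c a f -> taylor c (L \o a) (L \o f).
Proof.
move=> hL [M [q h]]; exists (Num.max 0 K * M), q; apply: expands_lin h.
  by rewrite le_max lexx.
by move=> u; rewrite (le_trans (hL u))// ler_wpM2r ?nrm_ge0// le_max lexx orbT.
Qed.

Lemma taylorZ (k : C) a f : taylor c a f ->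
  taylor c (fun i => k *: a i) (fun l => k *: f l).
Proof.
move=> [M [q h]]; exists (nrm k * M), q.
apply: (@expands_lin _ _ _ (GRing.scale k : {linear V -> V}) (nrm k)) h; first exact: nrm_ge0.
by move=> u; rewrite nrmZ.
Qed.

Lemma taylor_shift p a f : taylor c a f ->
  taylor c (fun k => if (k < p)%N then 0 else a (k - p)%N) (fun l => (l - c) ^+ p *: f l).
Proof. by move=> [M [q h]]; do 2 eexists; exact: expands_shift h. Qed.

Lemma taylor_cst (v : V) : taylor c (fun k => if k is 0%N then v else 0) (fun=> v).
Proof. by do 2 eexists; exact: expands_cst. Qed.

Lemma taylor_uniq a b f g (r : R) : taylor c a f -> taylor c b g -> 0 < r ->
  (forall l, l != c -> nrm (l - c) < r -> f l = g l) -> a =1 b.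
Proof.
move=> [M [q ha]] [M' [q' hb]] r0 fg.
apply: (@expands_uniq R V c a b f g M M' (Num.max q q') r) => //.
- by apply: expandsW ha; rewrite ?le_max ?lexx.
- by apply: expandsW hb; rewrite ?le_max ?lexx ?orbT.
- move=> z z0 zr; have zE : c + z - c = z by rewrite addrC addKr.
  by apply: fg; rewrite ?zE// -subr_eq0 zE.
Qed.

End Taylor.

Section LaurentResolvent.
Variable R : realType.
Local Notation C := (cplx R).
Variables (V : normedModType C) (A : operator V) (l0 : C) (k0 : nat).
Variables (Bn : nat -> {linear V -> V}) (G : C -> V -> V) (M q r : R).
Hypothesis k0_gt0 : (0 < k0)%N.
Hypothesis M_ge0 : 0 <= M.
Hypothesis r_gt0 : 0 < r.
Hypothesis G_expands : forall x, expands l0 (Bn ^~ x) (G ^~ x) (M * nrm x) q.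
Hypothesis G_resolvent : forall l, l != l0 -> nrm (l - l0) < r ->
  exists2 S : {linear V -> V}, is_resolvent A l S &
    (exists K : R, forall x, nrm (S x) <= K * nrm x) /\
    forall x, G l x = (l - l0) ^+ k0 *: S x.
Hypothesis Bn0 : exists x, Bn 0 x != 0.

(** [Bn p] goes with the power [p - k0]; there are no lower powers. *)
Definition laurent_coef (m : int) : {linear V -> V} :=
  if m + k0%:Z is Posz p then Bn p else \0.

Lemma laurent_coefE p : laurent_coef (p%:Z - k0%:Z) = Bn p.
Proof. by rewrite /laurent_coef subrK. Qed.

Lemma laurent_coefN1 : laurent_coef (-1) = Bn k0.-1.
Proof. by rewrite -laurent_coefE -subn1 -subzn// addrAC subrr add0r. Qed.

Lemma bounded_continuous (W : normedModType C) (L : {linear V -> W}) (K : R) :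
  (forall x, nrm (L x) <= K * nrm x) -> continuous L.
Proof.
move=> hL x; apply/cvg_nrmP => e e0; apply/near_nrmP.
have K0 : 0 < Num.max 0 K + 1 by rewrite ltr_wpDl// le_max lexx.
exists (e / (Num.max 0 K + 1)); first by rewrite divr_gt0.
move=> y; rewrite ltr_pdivlMr// => hy.
rewrite -linearB (le_lt_trans (hL _))// (le_lt_trans _ hy)// mulrC.
by rewrite ler_wpM2l ?nrm_ge0// (@le_trans _ _ (Num.max 0 K)) ?le_max ?lexx ?orbT// lerDl.
Qed.

Lemma laurent_pole : pole_expansion A l0 k0 laurent_coef.
Proof.
split => //.
- move=> m; rewrite /laurent_coef; case: (m + k0%:Z) => p.
    apply: (@bounded_continuous _ _ (M * q ^+ p)) => x.
    by have [_ _ /(_ p) h _] := G_expands x; rewrite mulrAC.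
  by apply: (@bounded_continuous _ _ 0) => x; rewrite /= nrm0 mul0r.
- by have [x hx] := Bn0; exists x; rewrite -[- _]add0r laurent_coefE.
have [x0 _] := Bn0; have [_ q0 _ _] := G_expands x0.
pose r' := Num.min r (2^-1 / q).
have r'0 : 0 < r' by rewrite lt_min r_gt0 divr_gt0.
exists r'%:C; first by rewrite ltcR.
move=> l; rewrite normr_gt0 subr_eq0 nrmE ltcR lt_min => /andP[ll0 /andP[lr lq]].
have [S hS [_ GS]] := G_resolvent ll0 lr; exists S => //.
set z := l - l0 in lr lq GS *.
have z0 : z != 0 by rewrite subr_eq0.
have nz : 0 < nrm z by exact: nrm_gt0.
have zq : q * nrm z <= 2^-1 by rewrite mulrC -ler_pdivlMr// ltW.
have rem N x : nrm (\sum_(j < N) z ^ (j%:Z - k0%:Z) *: laurent_coef (j%:Z - k0%:Z) x - S x)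
    <= nrm z ^- k0 * M * (2^-1) ^+ N * nrm x.
  have -> : \sum_(j < N) z ^ (j%:Z - k0%:Z) *: laurent_coef (j%:Z - k0%:Z) x - S x =
      - (z ^- k0 *: (G l x - \sum_(j < N) z ^+ j *: Bn j x)).
    rewrite scalerBr opprB GS scalerA mulVf ?expf_neq0// scale1r; congr (_ - _).
    rewrite scaler_sumr; apply: eq_bigr => j _.
    by rewrite laurent_coefE scalerA expfzDr// mulrC -exprnN.
  rewrite nrmN nrmZ nrmV nrmX -!mulrA ler_wpM2l ?invr_ge0 ?exprn_ge0 ?nrm_ge0//.
  have [_ _ _ /(_ N z zq)] := G_expands x.
  rewrite [l0 + z]addrC subrK => /le_trans; apply.
  rewrite -mulrA ler_wpM2l// mulrC ler_wpM2r ?nrm_ge0// lerXn2r ?nnegrE ?invr_ge0//.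
  by rewrite mulr_ge0 ?nrm_ge0// ltW.
move=> e e0; have ee : e = (complex.Re e)%:C by rewrite RRe_real// gtr0_real.
rewrite ee ltcR in e0; set e' := complex.Re e in ee e0.
pose K := nrm z ^- k0 * M.
have K0 : 0 <= K by rewrite mulr_ge0 ?invr_ge0 ?exprn_ge0 ?nrm_ge0.
have [N0 hN0] : exists N0 : nat, K / e' < N0%:R.
  by exists (Num.truncn (K / e')).+1; exact: truncnS_gt.
exists N0 => // N /= NN x; rewrite ee !nrmE -rmorphM lecR (le_trans (rem N x))//.
rewrite ler_wpM2r ?nrm_ge0// -/K exprVn ler_pdivrMr ?exprn_gt0//.
rewrite mulrC -ler_pdivrMr// (le_trans (ltW hN0))//.
rewrite (le_trans _ (natr_lt_exp2 _ _))// ler_nat.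
exact: (leq_trans NN).
Qed.

Lemma near_point (d : R) : 0 < d -> exists2 l : C, l != l0 & nrm (l - l0) < d.
Proof.
move=> d0; have [z z0 zd] := complex_small d0.
exists (l0 + z); last by rewrite [l0 + z]addrC addrK.
by rewrite -subr_eq0 [l0 + z]addrC addrK.
Qed.

Let prev N x : V := if N is N'.+1 then Bn N' x else 0.
Let delta N x : V := if N == k0 then x else 0.

Lemma taylor_G x : taylor l0 (Bn ^~ x) (G ^~ x).
Proof. by exists (M * nrm x), q. Qed.

Lemma taylor_delta x : taylor l0 (delta ^~ x) (fun l => (l - l0) ^+ k0 *: x).
Proof.
have [M' [q' h]] := taylor_shift k0 (taylor_cst l0 x).
exists M', q'; move: h; congr (expands _ _ _ _ _); apply/funext => k.
rewrite /delta; case: ltngtP => [//|kk|->]; last by rewrite subnn.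
by move: kk; rewrite -subn_gt0; case: (k - k0)%N.
Qed.

Lemma taylor_prev x : taylor l0 (prev ^~ x) (fun l => (l - l0) *: G l x).
Proof.
have [M' [q' h]] := taylor_shift 1 (taylor_G x).
exists M', q'; move: h; congr (expands _ _ _ _ _); apply/funext => k.
by rewrite /prev; case: k => // k; rewrite subn1.
Qed.

(** Coefficients of [(l - A) S l = 1], which is used in the form
    [S l x = S mu ((mu - l) S l x + x)], whose right-hand side is
    continuous in [S l x]: in this form it passes to the coefficients although [A]
    is unbounded. *)
Lemma act_laurent N x : dom A (Bn N x) /\
  act A (Bn N x) = l0 *: Bn N x + prev N x - delta N x.
Proof.
have [mu mu0 mur] := near_point r_gt0.
have [S [cS S1 S2] [[K hK] _]] := G_resolvent mu0 mur.
have E : Bn N x = S ((mu - l0) *: Bn N x + - prev N x + delta N x).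
  move: N; apply: (taylor_uniq (taylor_G x) _ r_gt0).
    apply: (taylor_lin hK); apply: taylorD (taylor_delta x).
    apply: taylorD; first exact: taylorZ (taylor_G x).
    by have := taylorZ (-1) (taylor_prev x); under eq_fun do rewrite scaleN1r; exact.
  move=> l ll0 lr; have [Sl [_ Sl1 _] [_ GS]] := G_resolvent ll0 lr.
  have [dy ey] := Sl1 x; have /= := S2 _ dy.
  rewrite GS scaleN1r => {1}<-; rewrite -linearZ; congr (S _).
  have -> : act A (Sl x) = l *: Sl x - x by rewrite -[X in _ - X]ey opprB addrC subrK.
  rewrite opprB addrCA -scalerBl scalerDr addrC; congr (_ + _).
  rewrite -scalerBl !scalerA; congr (_ *: _).
  by rewrite opprB addrA subrK mulrC.
have [+ ] := S1 ((mu - l0) *: Bn N x + - prev N x + delta N x).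
rewrite -E => dy ey; split => //.
have -> : act A (Bn N x) = mu *: Bn N x - ((mu - l0) *: Bn N x + - prev N x + delta N x).
  by rewrite -[X in _ - X]ey opprB addrC subrK.
by rewrite !opprD opprK scalerBl opprB [l0 *: _ - _]addrC !addrA subrr add0r.
Qed.

(** Comparison of coefficients in [S l (l0 x - A x) = x - (l - l0) S l x]. *)
Lemma laurent_act N x : dom A x -> Bn N (l0 *: x - act A x) = delta N x - prev N x.
Proof.
move=> dx; set v := l0 *: x - act A x.
suff /(_ N) : (fun N => Bn N v + prev N x) =1 delta ^~ x.
  by move=> <-; rewrite addrK.
apply: (taylor_uniq _ (taylor_delta x) r_gt0).
  exact: taylorD (taylor_G v) (taylor_prev x).
move=> l ll0 lr; have [S [_ _ S2] [_ GS]] := G_resolvent ll0 lr.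
rewrite !GS scalerA mulrC -scalerA -scalerDr; congr (_ *: _).
rewrite -[RHS](S2 x dx) -linearZ -linearD /v; congr (S _).
by rewrite addrAC -scalerDl [l0 + _]addrC subrK.
Qed.

(** [Bn N.+1 (l0 x - A x) = - Bn N x] above the index [k0], so that
    vanishing propagates from [l0 x - A x] to [x]. *)
Lemma ker_pow_sub m x : ker_pow A l0 m x -> forall N, (k0 <= N)%N -> Bn N x = 0.
Proof.
elim: m x => [|m ih] x /=; first by move=> -> N _; rewrite linear0.
move=> [dx hx] N kN; have := laurent_act N.+1 dx.
rewrite ih//; last exact: leqW.
rewrite /delta gtn_eqF//= sub0r => /eqP; rewrite eq_sym oppr_eq0 => /eqP; exact.
Qed.

Lemma laurent_ker_pow N x : (N < k0)%N -> ker_pow A l0 N.+1 (Bn N x).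
Proof.
elim: N x => [|N ih] x Nk.
  have [dx e] := act_laurent 0 x; split => //=.
  by rewrite e /delta lt_eqF//= addr0 subr0 subrr.
have [dx e] := act_laurent N.+1 x; split => //.
rewrite e /delta lt_eqF// subr0 opprD addrA subrr add0r -linearN.
exact: ih (ltnW Nk).
Qed.

(** The residue is the identity on the generalized eigenspace, because
    [Bn k0] kills its image under [l0 - A], and takes its values in it. *)
Lemma laurent_projector : projector_onto (laurent_coef (-1)) (gen_eigenspace A l0).
Proof.
rewrite laurent_coefN1.
have ran x : gen_eigenspace A l0 (Bn k0.-1 x).
  by exists k0 => //; rewrite -[X in ker_pow _ _ X](prednK k0_gt0); apply: laurent_ker_pow; rewrite prednK.
have id x : gen_eigenspace A l0 x -> Bn k0.-1 x = x.
  move=> [[|m] _ hx]; first by rewrite (hx : x = 0) linear0.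
  have [dx {}hx] := hx; have := laurent_act k0 dx.
  rewrite (ker_pow_sub hx)// /delta eqxx /prev -{1}(prednK k0_gt0) => /esym/eqP.
  by rewrite subr_eq0 => /eqP.
split; first by move=> x; rewrite id.
by apply/seteqP; split=> [_ [x _ <-]//|x hx]; exists x => //; exact: id.
Qed.

End LaurentResolvent.

(** * Calculus of complex functions of a real variable *)

Section Primitive.
Variable R : realType.
Let mu := @lebesgue_measure R.

Lemma continuous_integrable (g : R -> R) a b : continuous g ->
  mu.-integrable `[a, b] (EFin \o g).
Proof.
move=> cg; apply: continuous_compact_integrable; first exact: segment_compact.
exact: continuous_subspaceT.
Qed.

(** The integral ranges over a segment [[a, b]] with [a <= b], so the primitive is
    defined by cases on the sign of its argument. Near [x] it differs by a constant
    from the integral from a base point to the left of both 0 and [x]. *)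
Lemma primitive_exists (g : R -> R) : continuous g ->
  exists F : R -> R, forall x : R, is_derive x 1 F (g x).
Proof.
move=> cg; pose H a y := (\int[mu]_(u in `[a, y]) g u)%R.
have HB a b y : a <= b -> b <= y -> H a y - H a b = H b y.
  move=> ab bY; rewrite /H Rintegral_itvB ?bnd_simp//; last exact: continuous_integrable.
  rewrite Rintegral_itv_obnd_cbnd//.
  apply: integrableS (continuous_integrable b y cg) => //.
  exact: subset_itv_oc_cc.
exists (fun x => if 0 <= x then H 0 x else - H x 0) => x.
pose a := Num.min x 0 - 1.
have ax : a < x by rewrite ltrBlDr (@le_lt_trans _ _ x) ?ge_min ?lexx// ltrDl.
have a0 : a < 0 by rewrite ltrBlDr (@le_lt_trans _ _ 0) ?ge_min ?lexx ?orbT// ltrDl.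
have [] := @continuous_FTC1_closed R g a x (x + 1) _ (continuous_integrable a (x + 1) cg) ax (cg x).
  by rewrite ltrDl.
move=> dH eH.
have dHx : is_derive x 1 (H a) (g x).
  by apply: DeriveDef; [exact: dH|rewrite -derive1E; exact: eH].
apply: (@near_eq_is_derive _ _ _ (fun y => H a y - H a 0)).
- near=> y; have ay : a < y by near: y; exact: lt_nbhsr.
  case: ifPn => [y0|]; first by rewrite HB// ltW.
  by rewrite -ltNge => y0; rewrite -(HB a y 0) ?opprB// ltW.
- rewrite -[g x]subr0; exact: is_deriveB.
Unshelve. all: by end_near.
Qed.

Lemma integral_primitive (g F : R -> R) a b : continuous g ->
  (forall x : R, is_derive x 1 F (g x)) -> a <= b ->
  (\int[mu]_(u in `[a, b]) g u)%R = F b - F a.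
Proof.
move=> cg dF; rewrite le_eqVlt => /predU1P[->|ab].
  by rewrite set_itv1 Rintegral_set1 subrr.
have cF : continuous F.
  move=> x; apply/differentiable_continuous/derivable1_diffP.
  by have [] := dF x.
rewrite /Rintegral (@continuous_FTC2 _ g F)//.
- exact: continuous_subspaceT.
- split.
  + by move=> x _; have [] := dF x.
  + by apply: cvg_at_right_filter; exact: cF.
  + by apply: cvg_at_left_filter; exact: cF.
- by move=> x _; rewrite derive1E; have [_ ->] := dF x.
Qed.

End Primitive.

Section ComplexDerivative.
Variable R : realType.
Local Notation C := (cplx R).
Implicit Types (f g : R -> C) (x : R) (d e l : C).

Definition cderiv f x d :=
  is_derive x 1 (fun t => complex.Re (f t)) (complex.Re d) /\
  is_derive x 1 (fun t => complex.Im (f t)) (complex.Im d).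

Definition ccontinuous f :=
  continuous (fun t => complex.Re (f t)) /\ continuous (fun t => complex.Im (f t)).

Lemma cplx_eq (z w : C) : complex.Re z = complex.Re w -> complex.Im z = complex.Im w -> z = w.
Proof. by case: z w => [a b] [c d] /= -> ->. Qed.

Lemma reD (z w : C) : complex.Re (z + w) = complex.Re z + complex.Re w.
Proof. by case: z w => [a b] [c d]. Qed.

Lemma imD (z w : C) : complex.Im (z + w) = complex.Im z + complex.Im w.
Proof. by case: z w => [a b] [c d]. Qed.

Lemma reB (z w : C) : complex.Re (z - w) = complex.Re z - complex.Re w.
Proof. by case: z w => [a b] [c d]. Qed.

Lemma imB (z w : C) : complex.Im (z - w) = complex.Im z - complex.Im w.
Proof. by case: z w => [a b] [c d]. Qed.

Lemma reM (z w : C) : complex.Re (z * w) =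
  complex.Re z * complex.Re w - complex.Im z * complex.Im w.
Proof. by case: z w => [a b] [c d]. Qed.

Lemma imM (z w : C) : complex.Im (z * w) =
  complex.Re z * complex.Im w + complex.Im z * complex.Re w.
Proof. by case: z w => [a b] [c d]. Qed.

Lemma cderiv_cst x d : cderiv (fun=> d) x 0.
Proof. by split; exact: is_derive_cst. Qed.

Lemma cderivD f g x d e : cderiv f x d -> cderiv g x e ->
  cderiv (fun t => f t + g t) x (d + e).
Proof.
move=> [f1 f2] [g1 g2]; split.
  rewrite (_ : (fun t => _) = (fun t => complex.Re (f t)) \+ (fun t => complex.Re (g t))).
    by rewrite raddfD; exact: is_deriveD.
  by apply/funext => t; rewrite raddfD.
rewrite (_ : (fun t => _) = (fun t => complex.Im (f t)) \+ (fun t => complex.Im (g t))).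
  by rewrite raddfD; exact: is_deriveD.
by apply/funext => t; rewrite raddfD.
Qed.

Lemma cderivM f g x d e : cderiv f x d -> cderiv g x e ->
  cderiv (fun t => f t * g t) x (f x * e + d * g x).
Proof.
move=> [f1 f2] [g1 g2]; split.
  under eq_fun do rewrite reM.
  apply: is_derive_eq (is_deriveB (is_deriveM f1 g1) (is_deriveM f2 g2)) _.
  by rewrite reD !reM /GRing.scale/=; ring.
under eq_fun do rewrite imM.
apply: is_derive_eq (is_deriveD (is_deriveM f1 g2) (is_deriveM f2 g1)) _.
by rewrite imD !imM /GRing.scale/=; ring.
Qed.

Lemma cderiv_real (f : R -> R) x (d : R) : is_derive x 1 f d ->
  cderiv (fun t => (f t)%:C) x d%:C.
Proof. by move=> fd; split => //=; exact: is_derive_cst. Qed.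

Lemma cderivZ l f x d : cderiv f x d -> cderiv (fun t => l * f t) x (l * d).
Proof.
by move=> fd; have := cderivM (cderiv_cst x l) fd; rewrite mul0r addr0.
Qed.

Lemma cderivN f x d : cderiv f x d -> cderiv (fun t => - f t) x (- d).
Proof.
move=> /(cderivZ (-1)); rewrite mulN1r.
by under eq_fun do rewrite mulN1r.
Qed.

Lemma cderivB f g x d e : cderiv f x d -> cderiv g x e ->
  cderiv (fun t => f t - g t) x (d - e).
Proof. by move=> fd /cderivN; exact: cderivD. Qed.

Lemma cderiv_continuous f (f' : R -> C) : (forall x, cderiv f x (f' x)) -> ccontinuous f.
Proof.
move=> fd; split=> x; apply/differentiable_continuous/derivable1_diffP.
  by have [[]] := fd x.
by have [_ []] := fd x.
Qed.

Lemma ccontinuousM f g : ccontinuous f -> ccontinuous g ->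
  ccontinuous (fun t => f t * g t).
Proof.
move=> [f1 f2] [g1 g2]; split.
  under eq_fun do rewrite reM.
  by move=> u; apply: cvgB; apply: cvgM; [exact: f1|exact: g1|exact: f2|exact: g2].
under eq_fun do rewrite imM.
by move=> u; apply: cvgD; apply: cvgM; [exact: f1|exact: g2|exact: f2|exact: g1].
Qed.

Lemma cexpE l (t : R) : cexp (l * t%:C) =
  (expR (complex.Re l * t))%:C * (cos (complex.Im l * t) +i* sin (complex.Im l * t)).
Proof.
by rewrite /cexp reM imM /= !mulr0 subr0 add0r.
Qed.

Lemma cexpD l (t u : R) : cexp (l * (t + u)%:C) = cexp (l * t%:C) * cexp (l * u%:C).
Proof.
rewrite !cexpE !mulrDr expRD cosD sinD; apply: cplx_eq.
  by rewrite !reM !imM /=; ring.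
by rewrite !imM !reM /=; ring.
Qed.

Lemma cexp0 : cexp (0 : C) = 1.
Proof. by rewrite /cexp /= expR0 cos0 sin0 mul1r. Qed.

Lemma cexpN l (t : R) : cexp (l * (- t)%:C) * cexp (l * t%:C) = 1.
Proof. by rewrite -cexpD addNr mulr0 cexp0. Qed.

Lemma nrm_cexp l (t : R) : nrm (cexp (l * t%:C)) = expR (complex.Re l * t).
Proof.
rewrite cexpE nrmM nrm_real ger0_norm ?expR_ge0//.
by rewrite /nrm normc_def /= cos2Dsin2 sqrtr1 mulr1.
Qed.

Lemma cderiv_cexp l x : cderiv (fun t => cexp (l * t%:C)) x (l * cexp (l * x%:C)).
Proof.
have lin (a : R) : is_derive x 1 (fun t : R => a * t) a.
  by apply: is_derive_eq (is_deriveZ a (is_derive_id x 1)) _; exact: mulr1.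
under eq_fun do rewrite cexpE.
have comp (f : R -> R) (a d : R) : is_derive (a * x) 1 f d ->
    is_derive x 1 (fun t => f (a * t)) (a * d).
  by move=> fd; have := is_derive1_comp fd (lin a); rewrite mulrC.
have [h1 h2] := (comp _ _ _ (is_derive_cos (complex.Im l * x)),
  comp _ _ _ (is_derive_sin (complex.Im l * x))).
have h0 := cderiv_real (comp _ _ _ (is_derive_expR (complex.Re l * x))).
have h : cderiv (fun t : R => cos (complex.Im l * t) +i* sin (complex.Im l * t)) x
   ((complex.Im l * - sin (complex.Im l * x)) +i* (complex.Im l * cos (complex.Im l * x))).
  by split.
have := cderivM h0 h; congr (cderiv _ _ _).
rewrite cexpE; case: l h0 h {h1 h2} => a b /= _ _.
by apply: cplx_eq; rewrite ?(reD, imD) /= ?(reM, imM) /=; ring.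
Qed.

Lemma cderiv_pow (t : R) i x :
  cderiv (fun u => ((t - u) ^+ i)%:C) x (- (i%:R * (t - x) ^+ i.-1)%:C).
Proof.
rewrite -rmorphN; apply: cderiv_real.
have h : is_derive x 1 (fun u : R => t - u) (-1).
  apply: is_derive_eq (is_deriveB (is_derive_cst t x 1) (is_derive_id x 1)) _.
  by rewrite sub0r.
rewrite (_ : (fun u => _) = (fun u : R => t - u) ^+ i); last first.
  by apply/funext => u; rewrite exprfctE.
apply: is_derive_eq (is_deriveX i h) _.
by rewrite /GRing.scale/= mulrN1.
Qed.

Lemma cprimitive_exists f : ccontinuous f -> exists F : R -> C, forall x, cderiv F x (f x).
Proof.
move=> [/primitive_exists[F1 h1] /primitive_exists[F2 h2]].
by exists (fun t => F1 t +i* F2 t) => x; split => /=.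
Qed.

Definition cintegral (a b : R) f : C :=
  (\int[@lebesgue_measure R]_(u in `[a, b]) complex.Re (f u)) +i*
  (\int[@lebesgue_measure R]_(u in `[a, b]) complex.Im (f u)).

Lemma cintegral_primitive f F (a b : R) : ccontinuous f ->
  (forall x, cderiv F x (f x)) -> a <= b -> cintegral a b f = F b - F a.
Proof.
move=> [c1 c2] h ab; rewrite /cintegral.
rewrite (integral_primitive c1 (fun x => (h x).1) ab).
rewrite (integral_primitive c2 (fun x => (h x).2) ab).
by case: (F b) (F a) => [? ?] [? ?].
Qed.

(** A bound on the derivative gives a Lipschitz bound; the factor 2 comes from
    treating the real and imaginary parts separately. *)
Lemma cderiv_lipschitz f (f' : R -> C) (K : R) (a b : R) : a <= b ->
  (forall x, cderiv f x (f' x)) -> (forall x, a <= x <= b -> nrm (f' x) <= K) ->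
  nrm (f b - f a) <= 2 * K * (b - a).
Proof.
move=> ab fd fK; have [c1 c2] := cderiv_continuous fd.
apply: (le_trans (nrm_ReIm _)); rewrite !raddfB/=.
have [x xab ->] := @MVT_segment R _ _ a b ab (fun x _ => (fd x).1) (continuous_subspaceT c1).
have [y yab ->] := @MVT_segment R _ _ a b ab (fun x _ => (fd x).2) (continuous_subspaceT c2).
rewrite !normrM -mulrDl [`|b - a|]ger0_norm ?subr_ge0// ler_wpM2r ?subr_ge0//.
have -> : 2 * K = K + K by ring.
by rewrite lerD// ?(le_trans (nrm_Re _))// ?(le_trans (nrm_Im _))// fK.
Qed.

Lemma cderiv_dominated f (f' : R -> C) (g g' : R -> R) (a b : R) : a <= b ->
  (forall x, cderiv f x (f' x)) -> (forall x : R, is_derive x 1 g (g' x)) ->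
  (forall x, a <= x <= b -> nrm (f' x) <= g' x) ->
  nrm (f b - f a) <= 2 * (g b - g a).
Proof.
move=> ab fd gd fg; have [c1 c2] := cderiv_continuous fd.
have main (h h' : R -> R) : (forall x : R, is_derive x 1 h (h' x)) ->
    (forall x, a <= x <= b -> h' x <= g' x) -> h b - h a <= g b - g a.
  move=> hd hg; have kd (x : R) : is_derive x 1 (fun t => g t - h t) (g' x - h' x).
    exact: is_deriveB (gd x) (hd x).
  have [|x xab e] := @MVT_segment R (fun t => g t - h t) (fun x => g' x - h' x) a b ab
     (fun x _ => kd x).
    apply: continuous_subspaceT => x.
    by apply/differentiable_continuous/derivable1_diffP; have [] := kd x.
  rewrite -subr_ge0; have -> : g b - g a - (h b - h a) = (g' x - h' x) * (b - a).
    by rewrite -e; ring.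
  by rewrite mulr_ge0 ?subr_ge0 ?hg.
have normle (h h' : R -> R) : (forall x : R, is_derive x 1 h (h' x)) ->
    (forall x, a <= x <= b -> `|h' x| <= g' x) -> `|h b - h a| <= g b - g a.
  move=> hd hg; rewrite ler_norml; apply/andP; split; last first.
    by apply: main hd _ => x xab; rewrite (le_trans (ler_norm _)) ?hg.
  rewrite lerNl opprB; have := main (fun t => - h t) (fun t => - h' t).
  rewrite opprK [- h b + _]addrC; apply => x xab.
  by rewrite (le_trans (ler_norm _))// normrN hg.
apply: (le_trans (nrm_ReIm _)); rewrite !raddfB/=.
have -> : 2 * (g b - g a) = (g b - g a) + (g b - g a) by ring.
apply: lerD.
  by apply: normle (fun x => (fd x).1) _ => x xab; rewrite (le_trans (nrm_Re _)) ?fg.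
by apply: normle (fun x => (fd x).2) _ => x xab; rewrite (le_trans (nrm_Im _)) ?fg.
Qed.

End ComplexDerivative.

(** * The weighted space and its derivation *)

Section RealDerivative.
Variable R : realType.

Lemma is_derive_epsP (f : R -> R) (x d : R) : is_derive x 1 f d <->
  forall e : R, 0 < e -> exists2 del : R, 0 < del &
    forall t, t != x -> `|t - x| < del -> `|(t - x)^-1 * (f t - f x) - d| < e.
Proof.
have E : (fun h : R => h^-1 *: (f (h *: (1 : R^o) + x) - f x)) =
         (fun h : R => h^-1 * (f (h + x) - f x)).
  by apply/funext => h; rewrite [h *: _]mulr1.
split=> [[/cvg_ex[w hw] <-]|h].
  have hw0 := hw; rewrite E in hw => e e0.
  have -> : 'D_1 f x = w by rewrite /derive; exact: cvg_lim hw0.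
  move: hw => /cvgrPdist_lt/(_ e e0)/nbhs_ballP[del /= del0 hd]; exists del => // t tx td.
  have := hd (t - x); rewrite /ball/= sub0r normrN => /(_ td).
  by rewrite subr_eq0 subrK distrC; apply.
have : (fun h : R => h^-1 * (f (h + x) - f x)) @ (0 : R)^' --> d.
  apply/cvgrPdist_lt => e /h[del del0 hd]; apply/nbhs_ballP; exists del => // t.
  rewrite /ball/= sub0r normrN => td t0.
  have := hd (t + x); rewrite addrK distrC; apply => //.
  by rewrite -subr_eq0 addrK.
rewrite -E => hv; apply: DeriveDef; first by apply/cvg_ex; exists d.
by rewrite /derive; exact: cvg_lim hv.
Qed.

End RealDerivative.

Section Weighted.
Variables (R : realType) (eta : R) (n : nat).
Hypothesis eta0 : 0 < eta.
Local Notation C := (cplx R).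
Local Notation BC := (BUC_C eta n).
Local Notation cs := (cplx_scalars R).
Implicit Types (phi psi : BC) (f : R -> 'cV[C]_n) (t u : R).

Lemma nrm_weighted f t : nrm (weighted cs eta f t) = expR (eta * t) * nrm (f t).
Proof. by rewrite /weighted nrmZ nrm_real ger0_norm ?expR_ge0. Qed.

Lemma nrm_eval phi t : t <= 0 -> expR (eta * t) * nrm (phi t) <= nrm phi.
Proof.
move=> t0; rewrite -nrm_weighted -lecR -!nrmE; exact: le_buc_norm.
Qed.

Lemma nrm_buc_le phi (c : R) :
  (forall t, t <= 0 -> expR (eta * t) * nrm (phi t) <= c) -> nrm phi <= c.
Proof.
move=> h; rewrite -lecR -nrmE; apply: (@buc_norm_le _ _ cs) => t t0.
by rewrite nrmE lecR nrm_weighted h.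
Qed.

Lemma buc_fun_const phi t : 0 <= t -> phi t = phi 0.
Proof. by have /asboolP[h _ _] := valP phi; exact: h. Qed.

Lemma buc_fun_min phi t : phi (Num.min t 0) = phi t.
Proof. by case: leP => // t0; rewrite [RHS]buc_fun_const// ltW. Qed.

Lemma buc_ext phi psi : (forall t, t <= 0 -> phi t = psi t) -> phi = psi.
Proof.
move=> h; apply/val_inj/funext => t /=.
by rewrite -buc_fun_min -[RHS]buc_fun_min h// ge_min lexx orbT.
Qed.

Lemma mkBUC_eq f phi : (forall t, t <= 0 -> f t = phi t) -> mkBUC cs eta f = phi.
Proof.
move=> h; have E : (fun t => f (Num.min t 0)) = phi.
  by apply/funext => t; rewrite h ?buc_fun_min// ge_min lexx orbT.
by rewrite /mkBUC E; apply: val_inj; rewrite /= insubdK//; exact: valP.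
Qed.

Definition cderiv_vec f (f' : R -> 'cV[C]_n) :=
  forall t i, cderiv (fun u => f u i 0) t (f' t i 0).

(** A function with weighted bounds on itself and on its derivative is Lipschitz
    for the weight, hence uniformly continuous. *)
Lemma mkBUC_cderiv f f' (K : R) : cderiv_vec f f' ->
  (forall t, t <= 0 -> expR (eta * t) * nrm (f t) <= K) ->
  (forall t, t <= 0 -> expR (eta * t) * nrm (f' t) <= K) ->
  forall t, t <= 0 -> mkBUC cs eta f t = f t.
Proof.
move=> fd fK f'K.
have K0 : 0 <= K.
  by apply: (le_trans _ (fK 0 (lexx _))); rewrite mulr_ge0 ?expR_ge0 ?nrm_ge0.
suff buc : (fun t => f (Num.min t 0)) \in buc_pred cs eta n.
  by move=> t t0; rewrite /mkBUC insubdK// min_l.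
pose w i t : C := (expR (eta * t))%:C * f t i 0.
have wd i t : cderiv (w i) t ((expR (eta * t))%:C * (f' t i 0 + eta%:C * f t i 0)).
  have de : is_derive t 1 (fun u : R => expR (eta * u)) (eta * expR (eta * t)).
    have lin : is_derive t 1 (fun u : R => eta * u) eta.
      by apply: is_derive_eq (is_deriveZ eta (is_derive_id t 1)) _; exact: mulr1.
    by have := is_derive1_comp (is_derive_expR (eta * t)) lin; rewrite mulrC.
  have := cderivM (cderiv_real de) (fd t i); congr (cderiv _ _ _).
  by rewrite rmorphM /=; ring.
pose L := 2 * (K + eta * K).
have L0 : 0 <= L by rewrite mulr_ge0// addr_ge0// mulr_ge0// ltW.
have wL i a b : a <= b -> b <= 0 -> nrm (w i b - w i a) <= L * (b - a).
  move=> ab b0; apply: cderiv_lipschitz ab (wd i) _ => x /andP[ax xb].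
  have x0 : x <= 0 by exact: le_trans xb b0.
  rewrite nrmM nrm_real ger0_norm ?expR_ge0// mulrC.
  apply: (@le_trans _ _ ((nrm (f' x) + eta * nrm (f x)) * expR (eta * x))).
    rewrite ler_wpM2r ?expR_ge0// (le_trans (nrmD _ _))// lerD ?nrm_entry//.
    rewrite nrmM nrm_real ger0_norm ?(ltW eta0)// ler_wpM2l ?(ltW eta0)//.
    exact: nrm_entry.
  rewrite mulrDl lerD// mulrC ?f'K// mulrA [_ * eta]mulrC -mulrA ler_wpM2l ?(ltW eta0)//.
  by rewrite fK.
have wL' i a b : a <= 0 -> b <= 0 -> nrm (w i b - w i a) <= L * `|b - a|.
  move=> a0 b0; have [ab|ba] := leP a b.
    by rewrite ger0_norm ?subr_ge0// wL.
  by rewrite nrm_distC distrC ger0_norm ?subr_ge0 ?wL// ltW.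
apply/asboolP; split.
- by move=> t t0; rewrite !min_r.
- exists K => t t0; rewrite nrmE /= lecR nrm_weighted/= min_l//; exact: fK.
move=> e e0; exists (e / (L + 1)); first by rewrite divr_gt0// ltr_wpDl.
move=> t u t0 u0; rewrite ltr_pdivlMr ?ltr_wpDl// => tu.
rewrite nrmE /= ltcR; apply: (@le_lt_trans _ _ (L * `|t - u|)).
  apply: nrm_mx_le => [|i j]; first by rewrite mulr_ge0.
  rewrite ord1 !mxE !min_l//; exact: wL'.
apply: le_lt_trans tu; rewrite mulrC ler_wpM2l// lerDl//.
Qed.

Lemma buc_derivativeP phi psi : buc_derivative phi psi <->
  forall x, x <= 0 -> forall e : R, 0 < e -> exists2 del : R, 0 < del &
    forall t, t <= 0 -> t != x -> `|t - x| < del ->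
      nrm (((t - x)^-1)%:C *: (phi t - phi x) - psi x) < e.
Proof.
split=> h x x0.
  move=> e e0; have /cvg_nrmP/(_ e e0) := h x x0.
  move=> /nbhs_ballP[del /= del0 hd]; exists del => // t t0 tx td.
  by apply: (hd t) => //; rewrite /ball/= distrC.
apply/cvg_nrmP => e /(h x x0)[del del0 hd]; apply/nbhs_ballP; exists del => // t /=.
by rewrite /ball/= distrC => td tx t0; apply: hd.
Qed.

Lemma cderiv_buc_derivative f f' phi psi : cderiv_vec f f' ->
  (forall t, t <= 0 -> phi t = f t) -> (forall t, t <= 0 -> psi t = f' t) ->
  buc_derivative phi psi.
Proof.
move=> fd ef ef'; apply/buc_derivativeP => x x0 e e0.
have e4 : 0 < e / 4 by rewrite divr_gt0.
have /choice[D hD] (i : 'I_n) : exists del : R, 0 < del /\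
    forall t, t != x -> `|t - x| < del ->
      nrm (((t - x)^-1)%:C * (f t i 0 - f x i 0) - f' x i 0 : C) <= e / 2.
  have [/is_derive_epsP/(_ _ e4)[d1 d10 h1] /is_derive_epsP/(_ _ e4)[d2 d20 h2]] := fd x i.
  exists (Num.min d1 d2); split; first by rewrite lt_min d10.
  move=> t tx; rewrite lt_min => /andP[/(h1 t tx){}h1 /(h2 t tx){}h2].
  have -> : e / 2 = e / 4 + e / 4 by field.
  rewrite (le_trans (nrm_ReIm _))// lerD//.
    by rewrite ltW// reB reM /= mul0r subr0 reB.
  by rewrite ltW// imB imM /= mul0r addr0 imB.
have [d [d0 hd]] : exists d : R, 0 < d /\ forall i, d <= D i.
  exists (\big[Num.min/1]_i D i); split.
    by apply: lt_bigmin => // i _; have [] := hD i.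
  by move=> i; exact: bigmin_le_cond.
exists d => // t t0 tx td; rewrite !ef// ef'//.
apply: (@le_lt_trans _ _ (e / 2)); last by lra.
apply: nrm_mx_le => [|i j]; first by lra.
by rewrite ord1 !mxE; apply: (hD i).2 => //; exact: lt_le_trans (hd i).
Qed.

Lemma buc_derivative_cderiv phi psi : buc_derivative phi psi ->
  forall t i, t < 0 -> cderiv (fun u => phi u i 0) t (psi t i 0).
Proof.
move=> /buc_derivativeP h x i x0.
have main (e : R) : 0 < e -> exists2 del : R, 0 < del & forall t, t != x -> `|t - x| < del ->
    nrm (((t - x)^-1)%:C * (phi t i 0 - phi x i 0) - psi x i 0 : C) < e.
  move=> e0; have [d d0 hd] := h x (ltW x0) e e0.
  exists (Num.min d (- x)); first by rewrite lt_min d0 oppr_gt0.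
  move=> t tx; rewrite lt_min => /andP[td tx0].
  apply: le_lt_trans (hd t _ tx td).
    have := nrm_entry (((t - x)^-1)%:C *: (phi t - phi x) - psi x) i 0.
    by rewrite !mxE.
  by have := ler_norm (t - x); lra.
split; apply/is_derive_epsP => e /main[d d0 hd]; exists d => // t tx /(hd t tx){}hd.
  apply: le_lt_trans hd; apply: le_trans (nrm_Re _).
  by rewrite reB reM /= mul0r subr0 reB.
apply: le_lt_trans hd; apply: le_trans (nrm_Im _).
by rewrite imB imM /= mul0r addr0 imB.
Qed.

(** The weight [expR (eta * t)] is continuous and positive, so it can be divided
    out of the uniformly continuous weighted function. *)
Lemma buc_ccontinuous phi i : ccontinuous (fun t => phi t i 0).
Proof.
have /asboolP[_ _ uc] := valP phi.
pose g t := weighted cs eta phi (Num.min t 0) i 0.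
have gc (e : R) : 0 < e -> exists2 d : R, 0 < d & forall t u, `|t - u| < d -> nrm (g t - g u) < e.
  move=> /uc[d d0 hd]; exists d => // t u tu.
  have := hd (Num.min t 0) (Num.min u 0); rewrite !ge_min lexx !orbT => /(_ isT isT).
  rewrite nrmE /= ltcR => h; apply: le_lt_trans (h _).
    have := nrm_entry (weighted cs eta phi (Num.min t 0) - weighted cs eta phi (Num.min u 0)) i 0.
    by rewrite mxE [X in _ + X]mxE.
  apply: le_lt_trans tu.
  by case: (leP t 0) => t0; case: (leP u 0) => u0 //;
    rewrite ?subrr ?normr0 ?normr_ge0// ler_norml; apply/andP; split;
    have := ler_norm (t - u); have := ler_norm (u - t); rewrite distrC; lra.
have gE t : phi t i 0 = (expR (- (eta * Num.min t 0)))%:C * g t.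
  rewrite /g /weighted mxE mulrA -rmorphM /= -expRD addNr expR0 mul1r.
  by rewrite buc_fun_min.
have cexp : continuous (fun t : R => expR (- (eta * Num.min t 0))).
  move=> t; apply: (@continuous_comp _ _ _ (fun t : R => - (eta * Num.min t 0)) expR).
    apply: cvgN; apply: cvgM; first exact: cvg_cst.
    exact: (@continuous_min _ _ id (cst 0) t (@cvg_id _ _) (@cvg_cst _ _ _ _ _)).
  exact: continuous_expR.
split.
  under eq_fun do rewrite gE reM /= mul0r subr0.
  move=> t; apply: cvgM; first exact: cexp.
  apply/cvgrPdist_lt => e /gc[d d0 hd]; apply/nbhs_ballP; exists d => // u /=.
  rewrite /ball/= => tu; rewrite -reB; exact: le_lt_trans (nrm_Re _) (hd _ _ tu).
under eq_fun do rewrite gE imM /= mul0r addr0.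
move=> t; apply: cvgM; first exact: cexp.
apply/cvgrPdist_lt => e /gc[d d0 hd]; apply/nbhs_ballP; exists d => // u /=.
rewrite /ball/= => tu; rewrite -imB; exact: le_lt_trans (nrm_Im _) (hd _ _ tu).
Qed.

Lemma buc_derivative_lin (a : C) phi phi' psi psi' :
  buc_derivative phi phi' -> buc_derivative psi psi' ->
  buc_derivative (a *: phi + psi) (a *: phi' + psi').
Proof.
move=> h1 h2 x x0.
have -> : (a *: phi' + psi') x = a *: phi' x + psi' x by [].
have -> : (fun t => emb cs (t - x)^-1 *: ((a *: phi + psi) t - (a *: phi + psi) x)) =
    (fun t => a *: (emb cs (t - x)^-1 *: (phi t - phi x)) +
              emb cs (t - x)^-1 *: (psi t - psi x)).
  apply/funext => t; rewrite !scalerA mulrC -scalerA -scalerDr; congr (_ *: _).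
  by rewrite -[(a *: phi + psi) t]/(a *: phi t + psi t)
    -[(a *: phi + psi) x]/(a *: phi x + psi x) opprD addrACA -scalerBr.
by apply: cvgD; [apply: cvgZl_tmp; exact: (h1 x x0)|exact: (h2 x x0)].
Qed.

Lemma buc_derivative_uniq phi psi psi' :
  buc_derivative phi psi -> buc_derivative phi psi' -> psi = psi'.
Proof.
move=> /buc_derivativeP h1 /buc_derivativeP h2; apply: buc_ext => x x0.
apply/eqP; rewrite -subr_eq0; apply/eqP; apply: nrm_le0.
apply/ler_addgt0Pl => e e0; rewrite addr0.
have e2 : 0 < e / 2 by rewrite divr_gt0.
have [d1 d10 {}h1] := h1 x x0 _ e2; have [d2 d20 {}h2] := h2 x x0 _ e2.
pose t := x - Num.min d1 d2 / 2.
have m0 : 0 < Num.min d1 d2 by rewrite lt_min d10.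
have tx : t - x = - (Num.min d1 d2 / 2) by rewrite /t addrAC subrr add0r.
have tn : `|t - x| < Num.min d1 d2 by rewrite tx normrN gtr0_norm; lra.
move: tn; rewrite lt_min => /andP[t1 t2].
have t0 : t <= 0 by rewrite /t; lra.
have tx0 : t != x by rewrite -subr_eq0 tx oppr_eq0 gt_eqF//; lra.
rewrite (le_trans (nrm_dist (((t - x)^-1)%:C *: (phi t - phi x)) _ _))//.
by rewrite [e]splitr lerD// ltW// ?h2// nrm_distC h1.
Qed.

Lemma buc_derivE phi psi : buc_derivative phi psi -> buc_deriv phi = psi.
Proof.
move=> h; rewrite /buc_deriv; case: xgetP => [y _ hy|/(_ psi)//].
exact: buc_derivative_uniq hy h.
Qed.

End Weighted.

(** * Exponentials and the resolvent of the derivation *)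

Section Neumann.
Variable R : realType.
Local Notation C := (cplx R).

(** Iterating a resolvent identity [X l = X c + (l - c) N (X l)] gives the
    Taylor expansion of [X], with an explicit remainder. *)
Lemma expands_neumann (V : normedModType C) (N : {linear V -> V}) (c : C) (X : C -> V)
    (k B : R) : 0 < k -> (forall u, nrm (N u) <= k * nrm u) ->
  (forall z : C, k * nrm z <= 2^-1 ->
    X (c + z) = X c + z *: N (X (c + z)) /\ nrm (X (c + z)) <= B) ->
  expands c (fun j => iter j N (X c)) X B k.
Proof.
move=> k0 hN hX.
have hN' j u : nrm (iter j N u) <= k ^+ j * nrm u.
  elim: j => [|j ih]; first by rewrite expr0 mul1r.
  by rewrite iterS exprS -mulrA (le_trans (hN _))// ler_wpM2l// ltW.
have XB : nrm (X c) <= B.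
  by have [|_] := hX 0; rewrite ?nrm0 ?mulr0 ?invr_ge0// addr0.
split=> // [|j|j z /hX[eX bX]].
- exact: le_trans (nrm_ge0 _) XB.
- by rewrite (le_trans (hN' _ _))// mulrC ler_wpM2r ?exprn_ge0 ?(ltW k0).
have -> : X (c + z) - \sum_(i < j) z ^+ i *: iter i N (X c) = z ^+ j *: iter j N (X (c + z)).
  elim: j => [|j ih]; first by rewrite big_ord0 subr0 expr0 scale1r.
  rewrite big_ord_recr/= opprD addrA ih -scalerBr exprSr -scalerA; congr (_ *: _).
  have linN : forall i u v, iter i N (u - v) = iter i N u - iter i N v.
    by elim=> //= i ih' u v; rewrite ih' linearB.
  have linZ : forall i a u, iter i N (a *: u) = a *: iter i N u.
    by elim=> //= i ih' a u; rewrite ih' linearZ.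
  by rewrite -linN {1}eX addrC addKr linZ -iterSr.
rewrite nrmZ nrmX [k * _]mulrC exprMn mulrCA ler_wpM2l ?exprn_ge0 ?nrm_ge0//.
by rewrite (le_trans (hN' _ _))// mulrC ler_wpM2r ?exprn_ge0 ?(ltW k0).
Qed.

End Neumann.

Section ODE.
Variable R : realType.
Local Notation C := (cplx R).

(** [e^(- l t) f t] has derivative 0. *)
Lemma ode_unique (f : R -> C) (l : C) : ccontinuous f ->
  (forall t, t < 0 -> cderiv f t (l * f t)) -> f 0 = 0 ->
  forall t, t <= 0 -> f t = 0.
Proof.
move=> cf fd f0 t t0.
pose g u := cexp (- l * u%:C) * f u.
have gd u : u < 0 -> cderiv g u 0.
  move=> u0; have := cderivM (cderiv_cexp (- l) u) (fd u u0).
  by congr (cderiv _ _ _); ring.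
have cg : ccontinuous g.
  exact: ccontinuousM (cderiv_continuous (cderiv_cexp (- l))) cf.
have gt0 : g t = g 0.
  have neg (u : R) : u \in `]t, 0[%R -> u < 0 by rewrite in_itv/= => /andP[].
  have [x xt e1] := @MVT_segment R (fun u => complex.Re (g u)) (fun=> 0) t 0 t0
    (fun u ut => (gd u (neg u ut)).1) (continuous_subspaceT cg.1).
  have [y yt e2] := @MVT_segment R (fun u => complex.Im (g u)) (fun=> 0) t 0 t0
    (fun u ut => (gd u (neg u ut)).2) (continuous_subspaceT cg.2).
  apply: cplx_eq; apply/esym/eqP; rewrite -subr_eq0; apply/eqP.
    by rewrite e1 mul0r.
  by rewrite e2 mul0r.
have : cexp (l * t%:C) * g t = 0 by rewrite gt0 /g f0 !mulr0.
rewrite /g mulrA mulrC; have -> : - l * t%:C = l * (- t)%:C by rewrite rmorphN mulrN mulNr.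
by rewrite [cexp _ * cexp _]mulrC cexpN mulr1.
Qed.

End ODE.

(* The locks keep unification from unfolding the integrals. *)
HB.lock Definition Eop (R : realType) (eta : R) (n : nat) (l : cplx R)
    (v : 'cV[cplx R]_n) : BUC_C eta n :=
  mkBUC (cplx_scalars R) eta (fun t => cexp (l * t%:C) *: v).

HB.lock Definition Jop (R : realType) (eta : R) (n : nat) (l : cplx R)
    (phi : BUC_C eta n) : BUC_C eta n :=
  mkBUC (cplx_scalars R) eta (exp_integral 0 l phi).

Section Operators.
Variables (R : realType) (eta : R) (n : nat).
Hypothesis eta0 : 0 < eta.
Local Notation C := (cplx R).
Local Notation BC := (BUC_C eta n).
Local Notation cs := (cplx_scalars R).
Local Notation mk := (mkBUC cs eta).
Implicit Types (phi psi : BC) (l : C) (v : 'cV[C]_n) (t u : R).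

Lemma buc_derivativeB phi phi' psi psi' : buc_derivative phi phi' ->
  buc_derivative psi psi' -> buc_derivative (phi - psi) (phi' - psi').
Proof.
move=> h h'; have := buc_derivative_lin (a := -1) h' h.
by rewrite !scaleN1r addrC [- psi' + _]addrC.
Qed.

Lemma buc_linE (a : C) phi psi t : (a *: phi + psi) t = a *: phi t + psi t.
Proof. by []. Qed.

Lemma buc_subE phi psi t : (phi - psi) t = phi t - psi t.
Proof. by []. Qed.

Local Notation Eop := (@Eop R eta n).
Local Notation Jop := (@Jop R eta n).

Lemma EopE l v : Eop l v = mk (fun t => cexp (l * t%:C) *: v).
Proof. by rewrite unlock. Qed.

Lemma JopE l phi : Jop l phi = mk (exp_integral 0 l phi).
Proof. by rewrite unlock. Qed.

Lemma expR_cexp l t : expR (eta * t) * nrm (cexp (l * t%:C)) =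
  expR ((complex.Re l + eta) * t).
Proof. by rewrite nrm_cexp -expRD mulrDl addrC. Qed.

Lemma expR_le1 (a t : R) : 0 <= a -> t <= 0 -> expR (a * t) <= 1.
Proof. by move=> a0 t0; rewrite -expR0 ler_expR mulr_ge0_le0. Qed.

Lemma Eop_fun l v t : - eta <= complex.Re l -> t <= 0 -> Eop l v t = cexp (l * t%:C) *: v.
Proof.
move=> hl.
have bnd u : u <= 0 -> expR (eta * u) * nrm (cexp (l * u%:C)) <= 1.
  move=> u0; rewrite expR_cexp; apply: expR_le1 => //.
  by rewrite -lerBlDr sub0r.
rewrite EopE; apply: (@mkBUC_cderiv _ _ _ eta0 _ (fun t => (l * cexp (l * t%:C)) *: v)
   ((1 + nrm l) * nrm v)).
- move=> u i; under eq_fun do rewrite mxE.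
  rewrite mxE; have := cderivM (cderiv_cexp l u) (cderiv_cst u (v i 0)).
  by rewrite mulr0 add0r.
- move=> u u0; rewrite nrmZ mulrA ler_wpM2r ?nrm_ge0// (le_trans (bnd u u0))//.
  by rewrite lerDl nrm_ge0.
- move=> u u0; rewrite nrmZ nrmM mulrA ler_wpM2r ?nrm_ge0// mulrCA.
  rewrite (@le_trans _ _ (nrm l))// ?lerDr//.
  by rewrite -[leRHS]mulr1 ler_wpM2l ?nrm_ge0// bnd.
Qed.

Lemma Eop0 l v : - eta <= complex.Re l -> Eop l v 0 = v.
Proof. by move=> hl; rewrite Eop_fun// mulr0 cexp0 scale1r. Qed.

Lemma nrm_Eop l v : - eta <= complex.Re l -> nrm (Eop l v) <= nrm v.
Proof.
move=> hl; apply: nrm_buc_le => t t0; rewrite Eop_fun// nrmZ mulrA expR_cexp.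
rewrite -[leRHS]mul1r ler_wpM2r ?nrm_ge0// expR_le1//.
by rewrite -lerBlDr sub0r.
Qed.

Lemma Eop_deriv l v : - eta <= complex.Re l -> buc_derivative (Eop l v) (l *: Eop l v).
Proof.
move=> hl; apply: (@cderiv_buc_derivative _ _ _ (fun t => cexp (l * t%:C) *: v)
  (fun t => (l * cexp (l * t%:C)) *: v)).
- move=> u i; under eq_fun do rewrite mxE.
  rewrite mxE; have := cderivM (cderiv_cexp l u) (cderiv_cst u (v i 0)).
  by rewrite mulr0 add0r.
- by move=> t t0; rewrite Eop_fun.
- move=> t t0; rewrite -[(l *: Eop l v) t]/(l *: Eop l v t).
  by rewrite Eop_fun// scalerA.
Qed.

Lemma Eop_linear l : - eta <= complex.Re l -> linear (Eop l).
Proof.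
move=> hl; suff lin (a : C) (v w : 'cV[C]_n) : Eop l (a *: v + w) = a *: Eop l v + Eop l w.
  exact: lin.
apply: buc_ext => t t0; rewrite -[RHS]/(a *: Eop l v t + Eop l w t).
by rewrite !Eop_fun// scalerDr !scalerA [_ * a]mulrC.
Qed.

Lemma col_lin (a : C) (v w : 'cV[C]_n) i : (a *: v - w) i 0 = a * v i 0 - w i 0.
Proof. by rewrite !mxE. Qed.

(** Variation of constants. The solution extends to the whole line, where it can
    be differentiated on both sides of 0, and its weighted bound comes from
    comparison with the primitive of [expR (- (Re l + eta) * u)]. *)
Lemma exp_integral_ode l phi : exists f : R -> 'cV[C]_n,
  [/\ cderiv_vec f (fun t => l *: f t - phi t), f 0 = 0,
      forall t, t <= 0 -> exp_integral 0 l phi t = f t &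
      - eta < complex.Re l -> forall t, t <= 0 ->
        expR (eta * t) * nrm (f t) <= 2 / (complex.Re l + eta) * nrm phi].
Proof.
pose h i u : C := cexp (- l * u%:C) * phi u i 0.
have ch i : ccontinuous (h i).
  exact: ccontinuousM (cderiv_continuous (cderiv_cexp (- l))) (buc_ccontinuous phi i).
have /choice[H hH] i : exists F : R -> C, forall x, cderiv F x (h i x).
  exact: cprimitive_exists (ch i).
pose f t : 'cV[C]_n := \col_i (cexp (l * t%:C) * (H i 0 - H i t)).
have fE t i : f t i 0 = cexp (l * t%:C) * (H i 0 - H i t) by rewrite mxE.
have ee t : cexp (l * t%:C) * cexp (- l * t%:C) = 1.
  have -> : - l * t%:C = l * (- t)%:C by rewrite rmorphN mulrN mulNr.
  by rewrite mulrC cexpN.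
have fd : cderiv_vec f (fun t => l *: f t - phi t).
  move=> t i; rewrite col_lin (_ : (fun u => f u i 0) = (fun u =>
    cexp (l * u%:C) * (H i 0 - H i u))); last by apply/funext => u; exact: fE.
  have := cderivM (cderiv_cexp l t) (cderivB (cderiv_cst t (H i 0)) (hH i t)).
  congr (cderiv _ _ _); rewrite fE /h; move: (ee t).
  move: (cexp (l * t%:C)) (cexp (- l * t%:C)) => A B AB.
  have e1 : phi t i 0 = A * B * phi t i 0 by rewrite AB mul1r.
  by rewrite [in RHS]e1; ring.
exists f; split=> //.
- by apply/matrixP => i j; rewrite !mxE subrr mulr0.
- move=> t t0; apply/matrixP => i j; rewrite !mxE -/(cintegral t 0 _).
  pose P u : C := cexp (l * t%:C) * H i u.
  have Pd u : cderiv P u (cexp (l * t%:C) * h i u) by exact: cderivZ.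
  have integrand : (fun u => (((t - u) ^+ 0)%:C * cexp (l * (t - u)%:C) *: phi u) i 0) =
      (fun u => cexp (l * t%:C) * h i u).
    apply/funext => u; rewrite mxE expr0 mul1r cexpD /h mulrA.
    by congr (_ * _ * _); rewrite rmorphN mulrN mulNr.
  rewrite integrand (cintegral_primitive _ Pd t0) /P ?mulrBr//.
  by apply: ccontinuousM (ch i); split=> u; exact: cvg_cst.
move=> hl t t0; pose r := complex.Re l + eta.
have r0 : 0 < r by rewrite /r -ltrBlDr sub0r.
have phi0 : 0 <= nrm phi by exact: nrm_ge0.
pose g u := - (nrm phi / r) * expR (- r * u).
have gd (u : R) : is_derive u 1 g (nrm phi * expR (- r * u)).
  have lin : is_derive u 1 (fun u : R => - r * u) (- r).
    by apply: is_derive_eq (is_deriveZ (- r) (is_derive_id u 1)) _; exact: mulr1.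
  have de := is_derive1_comp (is_derive_expR (- r * u)) lin.
  apply: is_derive_eq (is_deriveZ (- (nrm phi / r)) de) _.
  by rewrite /GRing.scale/=; field; rewrite gt_eqF.
have dom i : nrm (H i 0 - H i t) <= 2 * (nrm phi / r) * expR (- r * t).
  apply: le_trans (cderiv_dominated t0 (hH i) gd _) _.
    move=> u /andP[tu u0]; rewrite nrmM nrm_cexp mulrC.
    have := nrm_eval phi u0; have := nrm_entry (phi u) i 0.
    move=> h1 h2; apply: (@le_trans _ _ (nrm (phi u) * expR (complex.Re (- l) * u))).
      by rewrite ler_wpM2r ?expR_ge0.
    have -> : complex.Re (- l) = - complex.Re l by case: (l).
    have -> : expR (- complex.Re l * u) = expR (eta * u) * expR (- r * u).
      by rewrite -expRD; congr expR; rewrite /r; ring.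
    by rewrite mulrA ler_wpM2r ?expR_ge0// mulrC.
  rewrite /g mulr0 expR0 -mulrA ler_wpM2l//.
  have : 0 <= nrm phi / r by rewrite divr_ge0// ltW.
  lra.
have -> : 2 / (complex.Re l + eta) * nrm phi = 2 * (nrm phi / r) by rewrite /r; ring.
have K0 : 0 <= 2 * (nrm phi / r) by rewrite mulr_ge0// divr_ge0// ltW.
rewrite -ler_pdivlMl ?expR_gt0//; apply: nrm_mx_le => [|i j].
  by rewrite mulr_ge0 ?invr_ge0 ?expR_ge0.
rewrite mxE nrmM nrm_cexp ler_pdivlMl ?expR_gt0// [leLHS]mulrA -expRD.
have -> : eta * t + complex.Re l * t = r * t by rewrite /r; ring.
rewrite (le_trans (ler_wpM2l (expR_ge0 _) (dom i)))//.
by rewrite [leLHS]mulrCA -expRD mulNr addrN expR0 mulr1.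
Qed.

Section HalfPlane.
Variable l : C.
Hypothesis hl : - eta < complex.Re l.
Let r0 : 0 < complex.Re l + eta.
Proof. by rewrite -ltrBlDr sub0r. Qed.

Lemma Jop_fun phi t : t <= 0 -> Jop l phi t = exp_integral 0 l phi t.
Proof.
have [f [fd f0 fE /(_ hl) fK]] := exp_integral_ode l phi.
move=> t0; rewrite fE//.
have -> : Jop l phi = mk f.
  by rewrite JopE /mkBUC; congr (insubd _ _); apply/funext => u; rewrite fE// ge_min lexx orbT.
pose K := 2 / (complex.Re l + eta) * nrm phi.
apply: (@mkBUC_cderiv _ _ _ eta0 _ _ (K + (nrm l * K + nrm phi)) fd) => //.
  move=> u u0; rewrite (le_trans (fK u u0))// lerDl addr_ge0 ?nrm_ge0//.
  by rewrite !mulr_ge0 ?nrm_ge0 ?invr_ge0// ltW.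
move=> u u0; apply: (@le_trans _ _ (nrm l * K + nrm phi)); last first.
  by rewrite lerDr !mulr_ge0 ?nrm_ge0 ?invr_ge0// ltW.
rewrite (le_trans (ler_wpM2l (expR_ge0 _) (nrmB _ _)))// mulrDr lerD ?nrm_eval//.
by rewrite nrmZ mulrCA ler_wpM2l ?nrm_ge0// fK.
Qed.

Lemma nrm_Jop phi : nrm (Jop l phi) <= 2 / (complex.Re l + eta) * nrm phi.
Proof.
apply: nrm_buc_le => t t0; rewrite Jop_fun//.
by have [f [_ _ -> // /(_ hl)]] := exp_integral_ode l phi; exact.
Qed.

Lemma Jop0 phi : Jop l phi 0 = 0.
Proof. by rewrite Jop_fun//; have [f [_ f0 -> // _]] := exp_integral_ode l phi. Qed.

Lemma Jop_deriv phi : buc_derivative (Jop l phi) (l *: Jop l phi - phi).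
Proof.
have [f [fd _ fE _]] := exp_integral_ode l phi.
apply: (cderiv_buc_derivative fd) => t t0; first by rewrite Jop_fun// fE.
rewrite -[LHS]/(l *: Jop l phi t - phi t).
by rewrite Jop_fun// fE.
Qed.

Lemma buc_ode0 psi : buc_derivative psi (l *: psi) -> psi 0 = 0 -> psi = 0.
Proof.
move=> dpsi psi0; apply: buc_ext => t t0; apply/matrixP => i j; rewrite ord1 [RHS]mxE.
apply: (@ode_unique _ (fun u => psi u i 0) l _ _ _ t t0).
- exact: buc_ccontinuous.
- move=> u u0; have := buc_derivative_cderiv dpsi i u0.
  by rewrite -[(l *: psi) u]/(l *: psi u) mxE.
- by rewrite psi0 mxE.
Qed.

(** The identities between the operators below are checked on the differential
    equation and the value at 0. *)
Lemma Jop_unique phi psi : buc_derivative psi (l *: psi - phi) -> psi 0 = 0 ->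
  psi = Jop l phi.
Proof.
move=> dpsi psi0; apply/eqP; rewrite -subr_eq0; apply/eqP; apply: buc_ode0.
  have := buc_derivativeB dpsi (@Jop_deriv phi).
  by rewrite scalerBr opprB addrA subrK.
by rewrite buc_subE psi0 Jop0 subrr.
Qed.

Lemma Jop_linear : linear (Jop l).
Proof.
suff lin (a : C) (phi psi : BC) : Jop l (a *: phi + psi) = a *: Jop l phi + Jop l psi.
  exact: lin.
apply/esym/Jop_unique; last by rewrite buc_linE !Jop0 scaler0 addr0.
have := buc_derivative_lin (a := a) (@Jop_deriv phi) (@Jop_deriv psi).
congr (buc_derivative _ _).
by rewrite scalerBr scalerDr opprD addrACA !scalerA [a * l]mulrC.
Qed.

(** Integration by parts against [Jop l phi], whose boundary terms vanish. *)
Lemma exp_integralS i phi t : t <= 0 ->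
  exp_integral i.+1 l phi t = - (i.+1%:R *: exp_integral i l (Jop l phi) t).
Proof.
move=> t0; have [f [fd f0 fE _]] := exp_integral_ode l phi.
apply/matrixP => k j; rewrite !mxE -!/(cintegral t 0 _).
pose e u : C := cexp (l * (t - u)%:C).
have ed u : cderiv e u (- l * e u).
  have eE w : e w = cexp (l * t%:C) * cexp (- l * w%:C).
    by rewrite /e cexpD rmorphN mulrN mulNr.
  have -> : e = (fun w => cexp (l * t%:C) * cexp (- l * w%:C)) by apply/funext.
  by have := cderivZ (cexp (l * t%:C)) (cderiv_cexp (- l) u); congr (cderiv _ _ _); ring.
pose p m u : C := ((t - u) ^+ m)%:C * e u.
have pd m u : cderiv (p m) u (- (m%:R * (t - u) ^+ m.-1)%:C * e u - l * p m u).
  have := cderivM (cderiv_pow t m u) (ed u); congr (cderiv _ _ _).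
  by rewrite /p; ring.
have cp m : ccontinuous (p m) by exact: cderiv_continuous (pd m).
have cf : ccontinuous (fun u => f u k 0).
  by apply: cderiv_continuous => u; exact: fd.
have [Q Qd] := cprimitive_exists (ccontinuousM (cp i) cf).
have -> : cintegral t 0 (fun u => (((t - u) ^+ i)%:C * cexp (l * (t - u)%:C) *: Jop l phi u) k 0)
    = Q 0 - Q t.
  rewrite -(cintegral_primitive (ccontinuousM (cp i) cf) Qd t0).
  congr (_ +i* _); apply: eq_Rintegral => u; rewrite inE/= in_itv/= => /andP[_ u0];
    by rewrite mxE Jop_fun// fE.
pose P u : C := - (p i.+1 u * f u k 0) - i.+1%:R * Q u.
have Pd u : cderiv P u (p i.+1 u * phi u k 0).
  have := cderivB (cderivN (cderivM (pd i.+1 u) (fd u k))) (cderivZ i.+1%:R (Qd u)).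
  congr (cderiv _ _ _); rewrite /P !mxE /= /p rmorphM rmorph_nat.
  ring.
have -> : cintegral t 0 (fun u => (((t - u) ^+ i.+1)%:C * cexp (l * (t - u)%:C) *: phi u) k 0)
    = P 0 - P t.
  rewrite -(cintegral_primitive (ccontinuousM (cp i.+1) (buc_ccontinuous phi k)) Pd t0).
  by congr (_ +i* _); apply: eq_Rintegral => u _; rewrite mxE.
rewrite /P f0 mxE mulr0 oppr0 /p subrr expr0n /= !mul0r oppr0 !sub0r opprK mulrBr.
by rewrite opprB addrC.
Qed.

Lemma exp_integral_iter i phi t : t <= 0 ->
  exp_integral i l phi t = ((-1) ^+ i * i`!%:R) *: iter i.+1 (Jop l) phi t.
Proof.
move=> t0; elim: i phi => [|i ih] phi.
  by rewrite expr0 fact0 mul1r scale1r /= Jop_fun.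
rewrite exp_integralS// ih scalerA -scaleNr -iterSr.
by congr (_ *: _); rewrite factS natrM exprS; ring.
Qed.

Lemma mkBUC_exp_integral i phi :
  mk (exp_integral i l phi) = ((-1) ^+ i * i`!%:R) *: iter i.+1 (Jop l) phi.
Proof.
by apply: mkBUC_eq => t t0; rewrite exp_integral_iter.
Qed.

(** As [- Jop l phi t] is the integral of [e^(l (t - u)) phi u] for [u] from 0 to [t],
    it sends [t^i / i! e^(l t)] to the next function of this form. *)
Lemma iter_Jop_Eop i v t : t <= 0 -> iter i (fun phi => - Jop l phi) (Eop l v) t =
  ((t ^+ i)%:C / i`!%:R * cexp (l * t%:C)) *: v.
Proof.
have hl' := ltW hl.
elim: i t => [|i ih] t t0.
  by rewrite expr0 fact0 invr1 mulr1 mul1r /= Eop_fun.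
set psi := iter i (fun phi => - Jop l phi) (Eop l v) in ih.
rewrite iterS -/psi -[LHS]/(- Jop l psi t).
apply/matrixP => k j; rewrite ord1 !mxE.
pose e u : C := (u ^+ i.+1)%:C / i.+1`!%:R * cexp (l * u%:C) * v k 0.
have powd u : cderiv (fun u => (u ^+ i.+1)%:C / i.+1`!%:R) u ((u ^+ i)%:C / i`!%:R).
  have pd : is_derive u 1 (fun u : R => u ^+ i.+1) (i.+1%:R * u ^+ i).
    rewrite (_ : (fun u => _) = (id : R -> R) ^+ i.+1); last first.
      by apply/funext => w; rewrite exprfctE.
    apply: is_derive_eq (is_deriveX i.+1 (is_derive_id u 1)) _.
    by rewrite /GRing.scale/= mulr1.
  have := cderivM (cderiv_real pd) (cderiv_cst u (i.+1`!%:R)^-1).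
  congr (cderiv _ _ _); rewrite mulr0 add0r rmorphM rmorph_nat factS natrM invfM.
  by rewrite [i.+1%:R * _]mulrC mulrA mulfK// pnatr_eq0.
have ed u : cderiv e u ((u ^+ i)%:C / i`!%:R * cexp (l * u%:C) * v k 0 + l * e u).
  have := cderivM (cderivM (powd u) (cderiv_cexp l u)) (cderiv_cst u (v k 0)).
  by congr (cderiv _ _ _); rewrite /e; ring.
have [j1 j2] := buc_ccontinuous (Jop l psi) k.
have [e1 e2] := cderiv_continuous ed.
suff : Jop l psi t k 0 + e t = 0 by move=> /eqP; rewrite addr_eq0 => /eqP ->; rewrite opprK.
apply: (@ode_unique _ (fun u => Jop l psi u k 0 + e u) l _ _ _ t t0).
- split.
    by under eq_fun do rewrite reD; move=> u; apply: cvgD; [exact: j1|exact: e1].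
  by under eq_fun do rewrite imD; move=> u; apply: cvgD; [exact: j2|exact: e2].
- move=> u u0; have := cderivD (buc_derivative_cderiv (@Jop_deriv psi) k u0) (ed u).
  congr (cderiv _ _ _); rewrite -[(l *: Jop l psi - psi) u]/(l *: Jop l psi u - psi u).
  by rewrite ih ?ltW// !mxE; ring.
- by rewrite Jop0 mxE /e expr0n /= mul0r !mul0r addr0.
Qed.

End HalfPlane.

(** Both sides solve the same differential equation with the same value at 0. *)
Lemma Eop_resolvent l0 l v : - eta < complex.Re l0 -> - eta < complex.Re l ->
  Eop l v = Eop l0 v - (l - l0) *: Jop l0 (Eop l v).
Proof.
move=> hl0 hl; have hl0' := ltW hl0; have hl' := ltW hl.
have linJ := Jop_linear hl0.
apply/eqP; rewrite addrC -subr_eq; apply/eqP.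
have -> : - ((l - l0) *: Jop l0 (Eop l v)) = Jop l0 (- (l - l0) *: Eop l v).
  have h := linJ (- (l - l0)) (Eop l v) 0.
  have h0 : Jop l0 (0 : BC) = 0 by have := linearZ_LR (lin_of linJ) 0 0; rewrite /= !scale0r.
  by rewrite !addr0 h0 addr0 in h; rewrite h scaleNr.
apply: (Jop_unique hl0).
  have := buc_derivativeB (@Eop_deriv l v hl') (@Eop_deriv l0 v hl0').
  congr (buc_derivative _ _).
  by rewrite scalerBr scaleNr opprK scalerBl [RHS]addrC addrA subrK.
by rewrite buc_subE !Eop0// subrr.
Qed.

Lemma Jop_resolvent l0 l phi : - eta < complex.Re l0 -> - eta < complex.Re l ->
  Jop l phi = Jop l0 phi - (l - l0) *: Jop l0 (Jop l phi).
Proof.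
move=> hl0 hl; have linJ := Jop_linear hl0.
have -> : Jop l0 phi - (l - l0) *: Jop l0 (Jop l phi) =
    Jop l0 (- (l - l0) *: Jop l phi + phi).
  by rewrite linJ scaleNr addrC.
apply: (Jop_unique hl0); last exact: Jop0.
have := @Jop_deriv l hl phi; congr (buc_derivative _ _).
by rewrite opprD scaleNr opprK scalerBl addrA addrCA subrr addr0.
Qed.

End Operators.

(** * Poles of the inverse of an analytic matrix *)

Section InversePole.
Variable R : realType.
Local Notation C := (cplx R).

Lemma analytic_eq_center (V : normedModType C) (c : C) (f g : C -> V) (r : R) :
  analytic c f -> analytic c g -> 0 < r ->
  (forall l, l != c -> nrm (l - c) < r -> f l = g l) -> f c = g c.
Proof.
move=> [a [M [q ha]]] [b [M' [q' hb]]] r0 fg.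
rewrite (expands_center ha) (expands_center hb).
by apply: (taylor_uniq _ _ r0 fg); [exists M, q|exists M', q'].
Qed.

Lemma analytic_id (c : C) : analytic c (fun l : C => l : C^o).
Proof.
have [M [q h]] := taylor_shift 1 (taylor_cst c (1 : C^o)).
have h' : analytic c (fun l => (l - c) ^+ 1 *: (1 : C^o)) by do 3 eexists; exact: h.
apply: (analytic_congr (r := 1)) (analyticD (analytic_cst c (c : C^o)) h') => // l _.
by rewrite expr1 [_ *: _]mulr1 addrC subrK.
Qed.

Lemma min_coef (V : normedModType C) (a : nat -> V) : (exists k, a k != 0) ->
  exists2 p, a p != 0 & forall k, (k < p)%N -> a k = 0.
Proof.
move=> ex; exists (ex_minn ex); case: ex_minnP => // p ap pmin k kp.
by apply/eqP/negPn/negP => /pmin; rewrite leqNgt kp.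
Qed.

(** At a noninvertible point where the determinant does not vanish identically,
    the inverse is [(l - c)^- p] times an analytic function, by Cramer's rule, where
    [p] is the order of vanishing of the determinant; cancelling the powers of
    [l - c] that divide the adjugate leaves a pole, for otherwise the inverse would
    extend to [c]. *)
Lemma inverse_pole n (c : C) (f : C -> 'M[C]_n) a M q : (0 < n)%N ->
  (forall i j, analytic c (fun l => f l i j)) ->
  expands c a (fun l => \det (f l) : C^o) M q -> (exists k, a k != 0) ->
  f c \notin unitmx ->
  exists k0 D N s P, [/\ (0 < k0)%N, expands c D P N s, D 0%N != 0 &
    exists2 r : R, 0 < r & forall l, l != c -> nrm (l - c) < r ->
      f l \in unitmx /\ P l = (l - c) ^+ k0 *: invmx (f l)].
Proof.
move=> n0 fan ha /min_coef[p ap pmin] fc.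
pose g l : C^o := if l == c then a p else (l - c) ^- p *: (\det (f l) : C^o).
have gE l : l != c -> g l = (l - c) ^- p * \det (f l) by move=> /negbTE lc; rewrite /g lc.
have hg : expands c (fun k => a (p + k)%N) g (M * q ^+ p) q.
  by apply: expands_div ha pmin _ _ => [|l /gE->//]; rewrite /g eqxx.
have gc : g c != 0 by rewrite /g eqxx.
have gan : analytic c g by do 3 eexists; exact: hg.
have Gan : analytic c (fun l => (g l)^-1 *: \adj (f l)).
  by apply: analyticZ; [exact: analytic_inv|exact: analytic_adj].
have [Q [N [s hQ]]] := Gan.
have [r r0 hr] := expands_lead ha pmin ap.
have unitf l : l != c -> nrm (l - c) < r -> f l \in unitmx.
  move=> lc lr; rewrite unitmxE unitfE -[l](subrK c) addrC.
  by apply: hr => //; rewrite subr_eq0.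
have GE l : l != c -> nrm (l - c) < r ->
    (g l)^-1 *: \adj (f l) = (l - c) ^+ p *: invmx (f l).
  by move=> lc lr; rewrite /invmx unitf// gE// invfM invrK scalerA.
have exQ : exists k, Q k != 0.
  apply/not_existsP => /= Q0.
  have {}Q0 k : Q k = 0 by apply/eqP/negPn/negP; exact: Q0.
  have [_ s0 _ _] := hQ.
  have [|z z0] := @complex_small R (Num.min r (2^-1 / s)).
    by rewrite lt_min r0 divr_gt0.
  rewrite lt_min => /andP[zr zs].
  have lc : c + z != c by rewrite -subr_eq0 [c + z]addrC addrK.
  have lr : nrm (c + z - c) < r by rewrite [c + z]addrC addrK.
  have := expands_vanish (z := z) hQ Q0; rewrite mulrC -ler_pdivlMr// => /(_ (ltW zs)).
  rewrite GE// => /eqP; rewrite scaler_eq0 expf_eq0 [c + z]addrC addrK (negbTE z0) andbF/=.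
  move=> /eqP i0; have := mulmxV (unitf _ lc lr); rewrite [c + z]addrC i0 mulmx0.
  move=> /matrixP/(_ (Ordinal n0) (Ordinal n0)); rewrite !mxE eqxx => /eqP.
  by rewrite eq_sym oner_eq0.
have [t Qt tmin] := min_coef exQ.
pose P l := if l == c then Q t else (l - c) ^- t *: ((g l)^-1 *: \adj (f l)).
have PE l : l != c -> P l = (l - c) ^- t *: ((g l)^-1 *: \adj (f l)).
  by move=> /negbTE lc; rewrite /P lc.
have hP : expands c (fun k => Q (t + k)%N) P (N * s ^+ t) s.
  by apply: expands_div hQ tmin _ PE; rewrite /P eqxx.
have zn0 l : l != c -> l - c != 0 by rewrite subr_eq0.
have tp : (t < p)%N.
  rewrite ltnNge; apply/negP => pt; move: fc => /negP[].
  pose h l := f l *m ((l - c) ^+ (t - p) *: P l).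
  have Pan : analytic c P by do 3 eexists; exact: hP.
  have h1 : h c = 1%:M.
    apply: (@analytic_eq_center _ c h (fun=> 1%:M) r) r0 _; last 1 first.
    - move=> l lc lr; rewrite /h PE// GE// !scalerA -[X in X * _ * _]expr1.
      have -> : (l - c) ^+ 1 ^+ (t - p) * (l - c) ^- t * (l - c) ^+ p = 1.
        rewrite expr1 mulrAC -exprD subnK// divff// expf_neq0//; exact: zn0.
      by rewrite scale1r mulmxV// unitf.
    - have an1 : analytic c (fun l => (l - c) ^+ (t - p) *: P l).
        have [a' [M' [q' h']]] := Pan.
        by do 3 eexists; exact: (expands_shift (t - p) h').
      have fan' : analytic c f by exact: analytic_matrix.
      have [a1 [M1 [b1 [M2 [q1 [e1 e2]]]]]] := expands_join fan' an1.
      by do 3 eexists; exact: expands_mulmx e1 e2.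
    - exact: analytic_cst.
  by have [] := mulmx1_unit h1.
exists (p - t)%N, (fun k => Q (t + k)%N), (N * s ^+ t), s, P.
split; [by rewrite subn_gt0|exact: hP|by rewrite addn0|].
exists r => // l lc lr; split; first exact: unitf.
rewrite PE// GE// scalerA; congr (_ *: _).
by rewrite -{1}(subnK (ltnW tp)) exprD mulrCA mulVf ?mulr1// expf_neq0// zn0.
Qed.

End InversePole.

(** * The characteristic matrix and the resolvent *)

Section Complexify.
Variables (R : realType) (eta : R) (n : nat).
Local Notation C := (cplx R).
Variable Lh : {linear BUC_R eta n -> 'cV[R]_n}.
Local Notation LC := (complexify Lh).
Local Notation BC := (BUC_C eta n).

Lemma complexify_linear : linear LC.
Proof.
suff lin (a : C) (phi psi : BC) : LC (a *: phi + psi) = a *: LC phi + LC psi.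
  exact: lin.
have eRe : buc_Re (a *: phi + psi) =
    complex.Re a *: buc_Re phi + (- complex.Im a *: buc_Im phi + buc_Re psi).
  apply/val_inj/funext => t; apply/matrixP => i j.
  rewrite -[RHS]/((complex.Re a *: buc_Re phi t +
    (- complex.Im a *: buc_Im phi t + buc_Re psi t)) i j) /= !mxE.
  by rewrite reD reM; ring.
have eIm : buc_Im (a *: phi + psi) =
    complex.Re a *: buc_Im phi + (complex.Im a *: buc_Re phi + buc_Im psi).
  apply/val_inj/funext => t; apply/matrixP => i j.
  rewrite -[RHS]/((complex.Re a *: buc_Im phi t +
    (complex.Im a *: buc_Re phi t + buc_Im psi t)) i j) /= !mxE.
  by rewrite imD imM; ring.
apply/matrixP => i j; rewrite !mxE eRe eIm !linearP !mxE.
by apply: cplx_eq; rewrite ?(reD, imD) ?(reM, imM) /=; ring.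
Qed.

Definition LCl : {linear BC -> 'cV[C]_n} := lin_of complexify_linear.

Lemma real_mx_entry (v : 'cV[R]_n) i : `|v i 0| <= `|v|.
Proof.
rewrite {2}/Num.norm /= mx_normE.
by rewrite -[leLHS]nngE num_le; exact: (le_bigmax _ (fun i => `|v i.1 i.2|%:nng) (i, 0)).
Qed.

Lemma real_mx_le (v : 'cV[R]_n) (r : R) : 0 <= r ->
  (forall i, `|v i 0| <= r) -> `|v| <= r.
Proof.
move=> r0 h; rewrite /Num.norm /=.
have [->//|/mx_norm_neq0[[i j] ->]] := eqVneq (mx_norm v) 0.
by rewrite ord1.
Qed.

Lemma complexify_bounded : (exists M : R, forall phi, `|Lh phi| <= M * `|phi|) ->
  exists2 K : R, 0 <= K & forall phi, nrm (LC phi) <= K * nrm phi.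
Proof.
move=> [M hM]; exists (2 * Num.max 0 M); first by rewrite mulr_ge0// le_max lexx.
move=> phi.
have part (f : C -> R) (psi : BUC_R eta n) : (forall z, `|f z| <= nrm z) ->
    (forall t i, psi t i 0 = f (phi t i 0)) -> `|psi| <= nrm phi.
  move=> fz hpsi; apply: (@buc_norm_le _ _ (real_scalars R)) => t t0 /=.
  apply: (le_trans _ (nrm_eval phi t0)).
  rewrite /weighted normrZ ger0_norm ?expR_ge0// ler_wpM2l ?expR_ge0//.
  apply: real_mx_le => [|i]; first exact: nrm_ge0.
  by rewrite hpsi (le_trans (fz _))// nrm_entry.
have h1 : `|Lh (buc_Re phi)| <= Num.max 0 M * nrm phi.
  apply: (le_trans (hM _)); apply: (@le_trans _ _ (Num.max 0 M * `|buc_Re phi|)).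
    by rewrite ler_wpM2r// le_max lexx orbT.
  rewrite ler_wpM2l ?le_max ?lexx//; apply: part (@nrm_Re R) _ => t i.
  by rewrite /= mxE.
have h2 : `|Lh (buc_Im phi)| <= Num.max 0 M * nrm phi.
  apply: (le_trans (hM _)); apply: (@le_trans _ _ (Num.max 0 M * `|buc_Im phi|)).
    by rewrite ler_wpM2r// le_max lexx orbT.
  rewrite ler_wpM2l ?le_max ?lexx//; apply: part (@nrm_Im R) _ => t i.
  by rewrite /= mxE.
have K0 : 0 <= Num.max 0 M * nrm phi by rewrite mulr_ge0 ?nrm_ge0// le_max lexx.
apply: nrm_mx_le => [|i j]; first by rewrite -mulrA mulr_ge0.
rewrite mxE (le_trans (nrm_ReIm _))//=.
have -> : 2 * Num.max 0 M * nrm phi = Num.max 0 M * nrm phi + Num.max 0 M * nrm phi by ring.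
by rewrite lerD// (le_trans (real_mx_entry _ _)).
Qed.

End Complexify.

Section Characteristic.
Variables (R : realType) (eta : R) (n : nat).
Hypothesis eta0 : 0 < eta.
Local Notation C := (cplx R).
Variable Lh : {linear BUC_R eta n -> 'cV[R]_n}.
Local Notation LC := (complexify Lh).
Local Notation BC := (BUC_C eta n).
Local Notation X := (X_C eta n).
Local Notation Eop := (@Eop R eta n).
Local Notation Jop := (@Jop R eta n).

Definition bracket (l : C) (x : X) : 'cV[C]_n := x.1 + x.2 0 + LC (Jop l x.2).

Lemma L20_bracketE (x : X) l : L20_bracket Lh x l = bracket l x.
Proof. by rewrite /L20_bracket -JopE. Qed.

Lemma mulmx_cols (f : 'I_n -> 'cV[C]_n) (v : 'cV[C]_n) :
  (\matrix_(i, j) f j i 0) *m v = \sum_j v j 0 *: f j.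
Proof.
apply/matrixP => i k; rewrite ord1 mxE summxE; apply: eq_bigr => j _.
by rewrite !mxE mulrC.
Qed.

(** In this form the bounds on [LC] and [Eop] apply to [Delta] directly. *)
Lemma Delta_mulmx l (v : 'cV[C]_n) : - eta <= complex.Re l ->
  Delta Lh l *m v = l *: v - LC (Eop l v).
Proof.
move=> hl; rewrite /Delta mulmxBl mul_scalar_mx; congr (_ - _).
rewrite (mulmx_cols (fun j => LC (mkBUC (cplx_scalars R) eta
  (fun t => cexp (l * t%:C) *: delta_mx j 0)))).
have vE : v = \sum_j v j 0 *: delta_mx j 0.
  by rewrite {1}[v]matrix_sum_delta; apply: eq_bigr => j _; rewrite big_ord1.
rewrite [in RHS]vE.
have -> : Eop l (\sum_j v j 0 *: delta_mx j 0) = \sum_j v j 0 *: Eop l (delta_mx j 0).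
  rewrite -[LHS]/(lin_of (Eop_linear eta0 hl) _) linear_sum.
  by apply: eq_bigr => j _; rewrite linearZ.
rewrite -[RHS]/(LCl Lh _) linear_sum; apply: eq_bigr => j _.
by rewrite linearZ -EopE.
Qed.

Definition Sfun (l : C) (x : X) : X :=
  mkX 0 (Eop l (invmx (Delta Lh l) *m bracket l x) + Jop l x.2).

Lemma X_ext (x y : X) : x.1 = y.1 -> x.2 = y.2 -> x = y.
Proof. by case: x y => [a b] [c d] /= -> ->. Qed.

Lemma nrm_X (x : X) : nrm x = nrm x.1 + nrm x.2.
Proof. by rewrite /nrm {1}/Num.norm/= /X_norm reD. Qed.

Lemma nrm_at0 (phi : BC) : nrm (phi 0) <= nrm phi.
Proof. by have := nrm_eval phi (lexx 0); rewrite mulr0 expR0 mul1r. Qed.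

Section HalfPlane.
Variable l : C.
Hypothesis hl : - eta < complex.Re l.
Let hl' : - eta <= complex.Re l. Proof. exact: ltW. Qed.

Lemma bracket_linear : linear (bracket l).
Proof.
suff lin (a : C) (x y : X) : bracket l (a *: x + y) = a *: bracket l x + bracket l y.
  exact: lin.
rewrite /bracket -[(a *: x + y).1]/(a *: x.1 + y.1) -[(a *: x + y).2]/(a *: x.2 + y.2).
rewrite buc_linE (Jop_linear eta0 hl) (complexify_linear Lh) !scalerDr.
by rewrite [RHS]addrACA [X in _ = X + _]addrACA.
Qed.

Lemma Sfun_linear : linear (Sfun l).
Proof.
suff lin (a : C) (x y : X) : Sfun l (a *: x + y) = a *: Sfun l x + Sfun l y.
  exact: lin.
rewrite /Sfun bracket_linear linearP (Eop_linear eta0 hl').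
rewrite -[(a *: x + y).2]/(a *: x.2 + y.2) (Jop_linear eta0 hl).
apply: X_ext; first by rewrite -[RHS]/(a *: 0 + 0) scaler0 addr0.
rewrite -[RHS]/(a *: (Eop l (invmx (Delta Lh l) *m bracket l x) + Jop l x.2) +
  (Eop l (invmx (Delta Lh l) *m bracket l y) + Jop l y.2)).
by rewrite scalerDr addrACA.
Qed.

Definition Sop : {linear X -> X} := lin_of Sfun_linear.

Variable K : R.
Hypothesis K0 : 0 <= K.
Hypothesis hK : forall phi, nrm (LC phi) <= K * nrm phi.

Lemma nrm_bracket x : nrm (bracket l x) <=
  (1 + K * (2 / (complex.Re l + eta))) * nrm x.
Proof.
rewrite /bracket nrm_X (le_trans (nrmD _ _))//.
have h1 := nrmD x.1 (x.2 0); have h2 := nrm_at0 x.2.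
have h3 : nrm (LC (Jop l x.2)) <= K * (2 / (complex.Re l + eta)) * nrm x.2.
  apply: (le_trans (hK (Jop l x.2))); rewrite -[leRHS]mulrA; apply: ler_wpM2l => //.
    exact: (nrm_Jop eta0 hl).
have h4 : 0 <= K * (2 / (complex.Re l + eta)) * nrm x.1.
  have r0 : 0 < complex.Re l + eta by rewrite -ltrBlDr sub0r.
  by rewrite !mulr_ge0 ?nrm_ge0 ?invr_ge0// ltW.
by rewrite mulrDl mul1r mulrDr; lra.
Qed.

Lemma Sop_bounded : exists K' : R, forall x, nrm (Sop x) <= K' * nrm x.
Proof.
pose a := 2 / (complex.Re l + eta).
exists (n%:R * nrm (invmx (Delta Lh l)) * (1 + K * a) + a) => x.
rewrite -[Sop x]/(Sfun l x) nrm_X /= nrm0 add0r mulrDl (le_trans (nrmD _ _))// lerD//.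
  rewrite (le_trans (nrm_Eop eta0 _ hl'))// (le_trans (nrm_mulmx _ _))// -[leRHS]mulrA.
  by rewrite ler_wpM2l ?mulr_ge0 ?nrm_ge0// nrm_bracket.
have a0 : 0 <= a by rewrite divr_ge0// ltW// -ltrBlDr sub0r.
by rewrite (le_trans (nrm_Jop eta0 hl _))// ler_wpM2l// [leRHS]nrm_X lerDr nrm_ge0.
Qed.

Lemma Eop_Jop_deriv v phi :
  buc_derivative (Eop l v + Jop l phi) (l *: (Eop l v + Jop l phi) - phi).
Proof.
have := buc_derivative_lin (a := 1) (@Eop_deriv R eta n eta0 l v hl')
  (@Jop_deriv R eta n eta0 l hl phi).
by rewrite !scale1r scalerDr addrA.
Qed.

(** The equation [(l - A - L) (0, psi) = (alpha, phi)] reads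
    [psi' = l psi - phi] and [Delta l (psi 0) = bracket l (alpha, phi)]. *)
Lemma Sop_resolvent : Delta Lh l \in unitmx -> is_resolvent (AL_op Lh) l Sop.
Proof.
move=> uD; split.
- have [K' hK'] := Sop_bounded; exact: bounded_continuous hK'.
- move=> x; rewrite -[Sop x]/(Sfun l x) /Sfun.
  set c := invmx (Delta Lh l) *m bracket l x; set psi := Eop l c + Jop l x.2.
  have dpsi : buc_derivative psi (l *: psi - x.2) by exact: Eop_Jop_deriv.
  have psi0 : psi 0 = c by rewrite /psi -[LHS]/(Eop l c 0 + Jop l x.2 0) Eop0// Jop0// addr0.
  have Dc : l *: c - LC (Eop l c) = bracket l x.
    by rewrite -Delta_mulmx// mulKVmx.
  split; first by split => //=; exists (l *: psi - x.2).
  rewrite /AL_op /A_op /L_op /=.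
  rewrite (buc_derivE dpsi).
  apply: X_ext.
    rewrite -[LHS]/(l *: 0 - (- ((l *: psi - x.2) 0) + LC psi)).
    rewrite scaler0 sub0r opprD opprK buc_subE -[(l *: psi) 0]/(l *: psi 0) psi0.
    have -> : LC psi = LC (Eop l c) + LC (Jop l x.2).
      by rewrite -[LHS]/(LCl Lh psi) linearD.
    by rewrite opprD addrA [l *: c - _ - _]addrAC Dc /bracket addrAC addrK addrK.
  rewrite -[LHS]/(l *: psi - (l *: psi - x.2 + 0)).
  by rewrite addr0 opprB addrC subrK.
move=> [a psi] [/= -> [D dD]].
rewrite -[LHS]/(Sfun l _) /AL_op /A_op /L_op /= (buc_derivE dD).
set y := (X in Sfun l X).
have y1 : y.1 = D 0 - LC psi.
  rewrite -[LHS]/(l *: 0 - (- D 0 + LC psi)).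
  by rewrite scaler0 sub0r opprD opprK.
have y2 : y.2 = l *: psi - D.
  by rewrite -[LHS]/(l *: psi - (D + 0)) addr0.
have J : Jop l y.2 = psi - Eop l (psi 0).
  apply: esym; apply: (Jop_unique eta0 hl); last by rewrite buc_subE Eop0// subrr.
  have := buc_derivativeB dD (@Eop_deriv R eta n eta0 l (psi 0) hl').
  congr (buc_derivative _ _).
  by rewrite y2 scalerBr opprB [RHS]addrC addrA subrK.
have br : bracket l y = Delta Lh l *m psi 0.
  rewrite Delta_mulmx// /bracket J y1 y2 buc_subE -[(l *: psi) 0]/(l *: psi 0).
  have -> : LC (psi - Eop l (psi 0)) = LC psi - LC (Eop l (psi 0)).
    by rewrite -[LHS]/(LCl Lh _) linearB.
  by rewrite addrAC [D 0 - _ + (LC psi - _)]addrA subrK addrC addrA subrK.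
rewrite /Sfun br mulKmx// J; apply: X_ext => //=.
by rewrite addrC subrK.
Qed.

End HalfPlane.
End Characteristic.

(** * Taylor expansions of the operators *)

Section TaylorOperators.
Variables (R : realType) (eta : R) (n : nat).
Hypothesis eta0 : 0 < eta.
Local Notation C := (cplx R).
Variable Lh : {linear BUC_R eta n -> 'cV[R]_n}.
Local Notation LC := (complexify Lh).
Local Notation BC := (BUC_C eta n).
Local Notation X := (X_C eta n).
Local Notation Eop := (@Eop R eta n).
Local Notation Jop := (@Jop R eta n).
Local Notation bracket := (bracket Lh).
Variable K : R.
Hypothesis K0 : 0 <= K.
Hypothesis hK : forall phi, nrm (LC phi) <= K * nrm phi.

Variable c : C.
Hypothesis hc : - eta < complex.Re c.
Let r0 : 0 < complex.Re c + eta. Proof. by rewrite -ltrBlDr sub0r. Qed.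
Let k := 4 / (complex.Re c + eta).
Let k0 : 0 < k. Proof. by rewrite divr_gt0. Qed.

(** The choice of [k]: the disc [k * nrm z <= 1 / 2] stays in the half-plane, and
    there [Jop (c + z)] is bounded by [k]. *)
Lemma near_halfplane (z : C) : k * nrm z <= 2^-1 ->
  - eta < complex.Re (c + z) /\ 2 / (complex.Re (c + z) + eta) <= k.
Proof.
rewrite /k mulrAC ler_pdivrMr// => hz.
have := nrm_Re z; rewrite ler_norml => /andP[h1 _].
have h : (complex.Re c + eta) / 2 <= complex.Re (c + z) + eta.
  have key (a b m : R) : 0 < a + eta -> 4 * m <= 2^-1 * (a + eta) -> - m <= b ->
    (a + eta) / 2 <= a + b + eta by lra.
  by rewrite reD; exact: key r0 hz h1.
have h2 : 0 < (complex.Re c + eta) / 2 by rewrite divr_gt0.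
split; first by lra.
rewrite ler_pdivrMr; last exact: lt_le_trans h.
rewrite mulrAC ler_pdivlMr//; lra.
Qed.

Lemma Nop_linear : linear (fun phi : BC => - Jop c phi).
Proof.
suff lin (a : C) (phi psi : BC) :
    - Jop c (a *: phi + psi) = a *: (- Jop c phi) + (- Jop c psi).
  exact: lin.
by rewrite (Jop_linear eta0 hc) opprD scalerN.
Qed.

Definition Nop : {linear BC -> BC} := lin_of Nop_linear.

Lemma NopE phi : Nop phi = - Jop c phi.
Proof. by []. Qed.

Lemma nrm_Nop phi : nrm (Nop phi) <= k * nrm phi.
Proof.
rewrite NopE nrmN (le_trans (nrm_Jop eta0 hc _))//.
by rewrite ler_wpM2r ?nrm_ge0// /k ler_wpM2r ?invr_ge0 ?(ltW r0)//; lra.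
Qed.

(** The resolvent identities make [- Jop c] the operator whose iterates carry the
    Taylor coefficients of both families. *)
Lemma expands_Eop v : expands c (fun j => iter j Nop (Eop c v)) (Eop ^~ v) (nrm v) k.
Proof.
apply: (expands_neumann (N := Nop) (X := Eop ^~ v)) => //; first exact: nrm_Nop.
move=> z /near_halfplane[hz _]; split; last by apply: nrm_Eop => //; exact: ltW.
rewrite {1}(Eop_resolvent eta0 _ hc hz) [c + z]addrC addrK.
by rewrite NopE scalerN.
Qed.

Lemma expands_Jop phi :
  expands c (fun j => iter j Nop (Jop c phi)) (Jop ^~ phi) (k * nrm phi) k.
Proof.
apply: (expands_neumann (N := Nop) (X := Jop ^~ phi)) => //; first exact: nrm_Nop.
move=> z /near_halfplane[hz hz']; split; last first.
  by rewrite (le_trans (nrm_Jop eta0 hz _))// ler_wpM2r ?nrm_ge0.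
rewrite {1}(Jop_resolvent eta0 _ hc hz) [c + z]addrC addrK.
by rewrite NopE scalerN.
Qed.

Definition bracket_coef (x : X) (j : nat) : 'cV[C]_n :=
  (if j is 0%N then x.1 + x.2 0 else 0) + LC (iter j Nop (Jop c x.2)).

Lemma expands_bracket (x : X) :
  expands c (bracket_coef x) (bracket ^~ x) ((1 + K * k) * nrm x) (k + 1).
Proof.
have k1 : k <= k + 1 by rewrite lerDl.
have k2 : 1 <= k + 1 by rewrite lerDr ltW.
have h1 := expandsW (lexx _) k2 (expands_cst c (x.1 + x.2 0)).
have h2 := expandsW (lexx _) k1 (expands_lin (L := LCl Lh) K0 hK (expands_Jop x.2)).
apply: expandsW (expandsD h1 h2) => //.
rewrite mulrDl mul1r lerD//.
  by rewrite nrm_X (le_trans (nrmD _ _))// lerD2l nrm_at0.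
rewrite mulrA; apply: ler_wpM2l; first by rewrite mulr_ge0// ltW.
by rewrite [leRHS]nrm_X lerDr nrm_ge0.
Qed.

Lemma iter_Nop j phi : iter j Nop phi = (-1) ^+ j *: iter j (Jop c) phi.
Proof.
elim: j => [|j ih]; first by rewrite expr0 scale1r.
have NZ a psi : Nop (a *: psi) = a *: Nop psi by exact: linearZ.
by rewrite iterS ih NZ NopE scalerN exprS mulN1r scaleNr.
Qed.

(** Repeated integration by parts turns iterates of [Jop c] into the integrals
    with the kernel [(t - u)^j]. *)
Lemma bracket_coefE (x : X) j : (0 < j)%N -> j`!%:R *: bracket_coef x j =
  LC (mkBUC (cplx_scalars R) eta (exp_integral j c x.2)).
Proof.
case: j => // j _; rewrite /bracket_coef add0r (mkBUC_exp_integral eta0 hc).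
have LZ a phi : LC (a *: phi) = a *: LC phi by exact: (linearZ_LR (LCl Lh) a phi).
by rewrite iter_Nop [in RHS]iterSr !LZ scalerA mulrC.
Qed.

Lemma bracket_derive (x : X) i :
  derivable (derive1n i (L20_bracket Lh x)) c 1 /\
  derive1n i (L20_bracket Lh x) c = i`!%:R *: bracket_coef x i.
Proof.
have -> : L20_bracket Lh x = bracket ^~ x by apply/funext => l; exact: L20_bracketE.
by rewrite scaler_nat; apply: expands_taylor (expands_bracket x); exact: matrix_geom_complete.
Qed.

Lemma iter_Eop_linear i : linear (fun v => iter i Nop (Eop c v)).
Proof.
suff lin (a : C) (v w : 'cV[C]_n) : iter i Nop (Eop c (a *: v + w)) =
    a *: iter i Nop (Eop c v) + iter i Nop (Eop c w).
  exact: lin.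
elim: i => [|i ih]; first exact: Eop_linear (ltW hc) _ _ _.
by rewrite !iterS ih linearP.
Qed.

Definition Ecoef i : {linear 'cV[C]_n -> BC} := lin_of (iter_Eop_linear i).

Lemma expands_Eop_app (a : nat -> 'cV[C]_n) f M q : k <= q -> expands c a f M q ->
  expands c (fun j => \sum_(i < j.+1) Ecoef i (a (j - i)%N)) (fun l => Eop l (f l))
    M (2 * q).
Proof.
move=> kq h; rewrite -[M]mul1r.
apply: (expands_app (A := Ecoef) (F := Eop)) h => // u.
rewrite mul1r; exact: expandsW (lexx _) kq (expands_Eop u).
Qed.

Definition eval_buc (t : R) (phi : BC) : 'cV[C]_n := phi t.

Lemma eval_linear t : linear (eval_buc t).
Proof. by []. Qed.

Lemma Ecoef_eval i v t : t <= 0 ->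
  eval_buc t (Ecoef i v) = ((t ^+ i)%:C / i`!%:R * cexp (c * t%:C)) *: v.
Proof. exact: iter_Jop_Eop. Qed.

Lemma nrm_evalbuc t phi : t <= 0 -> nrm (eval_buc t phi) <= expR (- (eta * t)) * nrm phi.
Proof.
by move=> t0; rewrite expRN ler_pdivlMl ?expR_gt0//; exact: nrm_eval.
Qed.

Lemma expands_eval t (a : nat -> BC) f M q : t <= 0 -> expands c a f M q ->
  expands c (fun j => eval_buc t (a j)) (fun l => eval_buc t (f l))
    (expR (- (eta * t)) * M) q.
Proof.
move=> t0; apply: (expands_lin (L := lin_of (eval_linear t))); first exact: expR_ge0.
by move=> u; exact: nrm_evalbuc.
Qed.

Lemma eval_sum t m (F : 'I_m -> BC) :
  eval_buc t (\sum_i F i) = \sum_i eval_buc t (F i).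
Proof. by rewrite -[LHS]/(lin_of (eval_linear t) _) linear_sum. Qed.

Lemma near_re : exists2 r : R, 0 < r & forall l, nrm (l - c) < r -> - eta < complex.Re l.
Proof.
exists (2^-1 / k); first by rewrite divr_gt0.
move=> l; rewrite ltr_pdivlMr// mulrC => /ltW/near_halfplane[].
by rewrite [c + _]addrC subrK.
Qed.

Definition L20_coef (x : X) (t : R) j : 'cV[C]_n :=
  \sum_(i < j.+1) ((t ^+ i)%:C / i`!%:R * cexp (c * t%:C)) *: bracket_coef x (j - i)%N.

Lemma expands_L20 (x : X) t : t <= 0 ->
  exists M q, expands c (L20_coef x t) (L20 Lh x t) M q.
Proof.
move=> t0; have k1 : k <= k + 1 by rewrite lerDl.
have h := expands_eval t0 (expands_Eop_app k1 (expands_bracket x)).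
have [r r00 hr] := near_re.
do 2 eexists; apply: (expands_congr r00 _ _ h).
  move=> j; rewrite eval_sum /L20_coef; apply: eq_bigr => i _; exact: Ecoef_eval.
move=> l /hr hl; rewrite /eval_buc Eop_fun//; last exact: ltW.
by rewrite /L20 L20_bracketE.
Qed.

Lemma L2_derive (x : X) t j : t <= 0 ->
  derivable (derive1n j (L20 Lh x t)) c 1 /\
  L2 Lh j c x t = j`!%:R *: L20_coef x t j.
Proof.
move=> t0; have [M [q h]] := expands_L20 x t0.
by rewrite scaler_nat; apply: expands_taylor h; exact: matrix_geom_complete.
Qed.

Lemma L2_leibniz (x : X) t j : t <= 0 -> L2 Lh j c x t =
  \sum_(i < j.+1) ('C(j, i)%:R * (t ^+ i)%:C * cexp (c * t%:C)) *:
    derive1n (j - i) (L20_bracket Lh x) c.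
Proof.
move=> t0; have [_ ->] := L2_derive x j t0.
rewrite /L20_coef scaler_sumr; apply: eq_bigr => i _.
have [_ ->] := bracket_derive x (j - i)%N.
rewrite !scalerA; congr (_ *: _).
have ij : (i <= j)%N by rewrite -ltnS.
have i0 : (i`!%:R : C) != 0 by rewrite pnatr_eq0 -lt0n fact_gt0.
rewrite -(bin_fact ij) !natrM; move: (cexp _) => e.
by field.
Qed.

End TaylorOperators.

(** * Expansion of the resolvent at a pole *)

Section ResolventExpansion.
Variables (R : realType) (eta : R) (n : nat).
Hypothesis eta0 : 0 < eta.
Local Notation C := (cplx R).
Variable Lh : {linear BUC_R eta n -> 'cV[R]_n}.
Local Notation LC := (complexify Lh).
Local Notation BC := (BUC_C eta n).
Local Notation X := (X_C eta n).
Local Notation Eop := (@Eop R eta n).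
Local Notation Jop := (@Jop R eta n).
Local Notation bracket := (bracket Lh).
Variable K : R.
Hypothesis K0 : 0 <= K.
Hypothesis hK : forall phi, nrm (LC phi) <= K * nrm phi.

Section AtPole.
Variable c : C.
Hypothesis hc : - eta < complex.Re c.
Local Notation Nop := (Nop n eta0 hc).
Local Notation Ecoef := (Ecoef n eta0 hc).
Local Notation bracket_coef := (bracket_coef eta0 Lh hc).
Variables (k0 : nat) (D : nat -> 'M[C]_n) (P : C -> 'M[C]_n) (M q : R).
Hypothesis hP : expands c D P M q.
Let k := 4 / (complex.Re c + eta).
Let rpos : 0 < complex.Re c + eta. Proof. by rewrite -ltrBlDr sub0r. Qed.
Let kpos : 0 < k. Proof. by rewrite divr_gt0. Qed.

(** [Gfun l] is [(l - c)^k0] times the resolvent, written so as to make sense at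
    [l = c]; [Gcoef] is its Cauchy product expansion. The term [Jop] being regular, it
    enters from the index [k0] on. *)
Definition Gfun (l : C) (x : X) : X :=
  mkX 0 (Eop l (P l *m bracket l x) + (l - c) ^+ k0 *: Jop l x.2).

Definition Gcoef (x : X) (j : nat) : X :=
  mkX 0 (\sum_(i < j.+1) Ecoef i (\sum_(m < (j - i).+1) D m *m bracket_coef x (j - i - m)) +
    (if (j < k0)%N then 0 else iter (j - k0) Nop (Jop c x.2))).

Lemma mkX0_linear : linear (fun phi : BC => mkX 0 phi : X).
Proof.
suff lin (a : C) (phi psi : BC) :
    mkX 0 (a *: phi + psi) = a *: mkX 0 phi + mkX 0 psi :> X by exact: lin.
by apply: X_ext => //=; rewrite -[RHS]/(a *: 0 + 0) scaler0 addr0.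
Qed.

Lemma nrm_mkX0 (phi : BC) : nrm (mkX 0 phi : X) = nrm phi.
Proof. by rewrite nrm_X /= nrm0 add0r. Qed.

Lemma expands_Gfun : exists MM qq, 0 <= MM /\
  forall x, expands c (Gcoef x) (Gfun ^~ x) (MM * nrm x) qq.
Proof.
have [M0 q0 _ _] := hP.
pose q1 := Num.max q (k + 1).
have q11 : q <= q1 by rewrite le_max lexx.
have q12 : k + 1 <= q1 by rewrite le_max lexx orbT.
have q10 : 0 < q1 by exact: lt_le_trans q11.
have kq1 : k <= 2 * q1 by have := kpos; lra.
have kq2 : k <= 2 * (2 * q1) by have := kpos; lra.
exists (n%:R * M * (1 + K * k) + k / k ^+ k0), (2 * (2 * q1)); split.
  have h1 : 0 <= 1 + K * k by rewrite addr_ge0// mulr_ge0// ltW.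
  have h2 : 0 <= k / k ^+ k0 by rewrite divr_ge0 ?exprn_ge0// ltW.
  by rewrite addr_ge0// mulr_ge0// mulr_ge0.
move=> x.
have h1 := expandsW (lexx _) q11 hP.
have h2 := expandsW (lexx _) q12 (expands_bracket eta0 K0 hK hc x).
have h3 := expands_Eop_app eta0 hc kq1 (expands_mulmx h1 h2).
have h4 := expandsW (lexx _) kq2 (expands_shift k0 (expands_Jop eta0 hc x.2)).
have := expands_lin (L := lin_of mkX0_linear) ler01 _ (expandsD h3 h4).
rewrite mul1r => h5; apply: (expandsW _ (lexx _) (h5 _)); last first.
  by move=> u; rewrite mul1r -[lin_of _ u]/(mkX 0 u : X) nrm_mkX0.
rewrite [leRHS]mulrDl lerD//; first by rewrite !mulrA.
rewrite -/k mulrAC ler_wpM2l // ?divr_ge0 ?exprn_ge0 ?(ltW kpos) ?(ltW rpos)//.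
by rewrite (nrm_X x) lerDr nrm_ge0.
Qed.

Lemma Gfun_linear l : - eta < complex.Re l -> linear (Gfun l).
Proof.
move=> hl; suff lin (a : C) (x y : X) : Gfun l (a *: x + y) = a *: Gfun l x + Gfun l y.
  exact: lin.
rewrite /Gfun (bracket_linear eta0 Lh hl) linearP (Eop_linear eta0 (ltW hl)).
rewrite -[(a *: x + y).2]/(a *: x.2 + y.2) (Jop_linear eta0 hl) scalerDr.
rewrite [_ *: (a *: Jop l x.2)]scalerA mulrC -scalerA.
by rewrite addrACA -scalerDr mkX0_linear.
Qed.

Lemma Gcoef_linear j : linear (Gcoef ^~ j).
Proof.
suff lin (a : C) (x y : X) : Gcoef (a *: x + y) j = a *: Gcoef x j + Gcoef y j.
  exact: lin.
have [MM [qq [_ hG]]] := expands_Gfun.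
have tG x' : taylor c (Gcoef x') (Gfun ^~ x') by do 2 eexists; exact: hG.
have [r r0 hr] := near_re hc.
move: j; apply: (taylor_uniq (tG _) (taylorD (taylorZ a (tG x)) (tG y)) r0).
by move=> l _ /hr /Gfun_linear; exact.
Qed.

Definition Bcoef j : {linear X -> X} := lin_of (Gcoef_linear j).

Lemma Gfun_resolvent l : l != c -> - eta < complex.Re l -> Delta Lh l \in unitmx ->
  P l = (l - c) ^+ k0 *: invmx (Delta Lh l) ->
  exists2 S : {linear X -> X}, is_resolvent (AL_op Lh) l S &
    (exists K' : R, forall x, nrm (S x) <= K' * nrm x) /\
    forall x, Gfun l x = (l - c) ^+ k0 *: S x.
Proof.
move=> lc hl uD PE; exists (Sop eta0 Lh hl); first exact: (Sop_resolvent eta0 hl K0 hK).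
split; first exact: (Sop_bounded eta0 hl K0 hK).
move=> x; rewrite -[Sop _ _ _ _]/(Sfun Lh l x) /Gfun /Sfun PE -scalemxAl.
have -> v : Eop l ((l - c) ^+ k0 *: v) = (l - c) ^+ k0 *: Eop l v.
  exact: (linearZ_LR (lin_of (Eop_linear eta0 (ltW hl))) ((l - c) ^+ k0) v).
rewrite -scalerDr; apply: X_ext => //=.
by rewrite -[RHS]/((l - c) ^+ k0 *: 0) scaler0.
Qed.

(** At [(delta_mx j 0, 0)] the leading coefficient takes the value of column [j] of
    [D 0] at 0. *)
Lemma Gcoef_neq0 : (0 < k0)%N -> D 0 != 0 -> exists x, Gcoef x 0 != 0.
Proof.
move=> k00 D0.
have [[i j] Dij] : exists ij : 'I_n * 'I_n, D 0 ij.1 ij.2 != 0.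
  apply/not_existsP => h; move/negP: D0; apply; apply/eqP/matrixP => i j.
  by rewrite [RHS]mxE; apply/eqP/negPn/negP; exact: h (i, j).
exists (mkX (delta_mx j 0) 0); apply/negP => /eqP /(congr1 (fun x : X => x.2 0)).
rewrite /Gcoef /= k00 big_ord1 sub0n big_ord1 addr0.
have J0 : Jop c (0 : BC) = 0.
  exact: (linear0 (lin_of (Jop_linear eta0 hc))).
have -> : bracket_coef (mkX (delta_mx j 0) 0) 0 = delta_mx j 0.
  rewrite /bracket_coef /= J0 -[LC 0]/(LCl Lh 0) linear0.
  by rewrite addr0 -[RHS]addr0; congr (_ + _).
rewrite -[iter _ _ _]/(Eop c _) Eop0//; last exact: ltW.
move=> /matrixP/(_ i 0); rewrite mxE (bigD1 j)//= big1 => [|m mj].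
  by rewrite mxE !eqxx mulr1 addr0 [RHS]mxE => /eqP; exact/negP.
by rewrite mxE (negbTE mj) mulr0.
Qed.

(** The term [Jop] is absent below the index [k0]; what remains is the expansion
    of [P l *m L20 Lh x t l]. *)
Lemma Gcoef_eval (x : X) t j : t <= 0 -> (j < k0)%N ->
  (Gcoef x j).2 t = \sum_(i < j.+1) D i *m L20_coef eta0 Lh hc x t (j - i).
Proof.
move=> t0 jk; rewrite /Gcoef /= jk addr0.
have [M1 [q1 h1]] := expands_L20 eta0 K0 hK hc x t0.
have [r r0 hr] := near_re hc.
have h0 := hP; have [M2 [q2 h2]] : taylor c
   (fun j => \sum_(i < j.+1) D i *m L20_coef eta0 Lh hc x t (j - i))
   (fun l => P l *m L20 Lh x t l).
  have an1 : exists M q, expands c D P M q by exists M, q.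
  pose q3 := Num.max q q1.
  have h3 := @expandsW _ _ _ _ _ _ _ M q3 (lexx _) _ h0.
  have h4 := @expandsW _ _ _ _ _ _ _ M1 q3 (lexx _) _ h1.
  do 2 eexists; apply: expands_mulmx (h3 _) (h4 _); by rewrite le_max lexx ?orbT.
pose q1' := Num.max q (k + 1).
have q11 : q <= q1' by rewrite le_max lexx.
have q12 : k + 1 <= q1' by rewrite le_max lexx orbT.
have kq1 : k <= 2 * q1' by have := kpos; lra.
have e1 := expandsW (lexx _) q11 hP.
have e2 := expandsW (lexx _) q12 (expands_bracket eta0 K0 hK hc x).
have e3 := expands_eval t0 (expands_Eop_app eta0 hc kq1 (expands_mulmx e1 e2)).
move: j {jk}; apply: (@taylor_uniq R _ c _ _ _ _ r _ _ r0 _).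
- by do 2 eexists; exact: e3.
- by do 2 eexists; exact: h2.
move=> l _ /hr hl; rewrite /eval_buc Eop_fun//; last exact: ltW.
by rewrite /L20 -scalemxAr L20_bracketE.
Qed.

End AtPole.

Lemma Delta_analytic c i j : - eta < complex.Re c ->
  analytic c (fun l => Delta Lh l i j : C^o).
Proof.
move=> hc; pose entry (v : 'cV[C]_n) : C^o := v i 0.
have entry_lin : linear entry by move=> a v w; rewrite /entry !mxE.
have h : analytic c (fun l => entry (LC (Eop l (delta_mx j 0)))).
  apply: (analytic_lin (L := lin_of entry_lin) (K := 1)) => //.
    by move=> u; rewrite mul1r; exact: nrm_entry.
  apply: (analytic_lin (L := LCl Lh) K0 hK).
  by do 3 eexists; exact: (expands_Eop eta0 hc).
apply: (eq_ind _ (analytic c) (analyticD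
  (analyticZ (analytic_id c) (analytic_cst c ((i == j)%:R : C^o)))
  (analyticZ (analytic_cst c (-1 : C^o)) h))); apply/funext => l; rewrite /Delta !mxE /entry EopE.
by rewrite [-1 *: _]mulN1r; congr (_ - _); [exact: (mulr_natr l)|rewrite ?mxE].
Qed.

(** [m v] dominates [LC (Eop m v)], whose norm is at most [K * nrm v]. *)
Lemma Delta_below (m : R) (v : 'cV[C]_n) : 0 <= m ->
  (m - K) * nrm v <= nrm (Delta Lh m%:C *m v).
Proof.
move=> m0; have hm : - eta <= complex.Re (m%:C : C) by rewrite /= (le_trans _ m0)// oppr_le0 ltW.
rewrite (Delta_mulmx eta0)//; have := nrmB (m%:C *: v - LC (Eop m%:C v)) (- LC (Eop m%:C v)).
rewrite opprK subrK nrmN nrmZ nrm_real ger0_norm// => h1.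
have h2 : nrm (LC (Eop m%:C v)) <= K * nrm v.
  by rewrite (le_trans (hK _))// ler_wpM2l// nrm_Eop.
by rewrite mulrBl; lra.
Qed.

Lemma unitmx_of_ker0 (A : 'M[C]_n) : (forall v : 'cV[C]_n, A *m v = 0 -> v = 0) ->
  A \in unitmx.
Proof.
move=> h; rewrite -unitmx_tr -row_free_unit -kermx_eq0; apply/eqP/row_matrixP => i.
rewrite row0; apply: trmx_inj; rewrite trmx0; apply: h.
by rewrite -[X in X *m _]trmxK -trmx_mul -row_mul mulmx_ker row0 trmx0.
Qed.

Lemma Delta_unit_large (m : R) : K < m -> Delta Lh m%:C \in unitmx.
Proof.
move=> Km; apply: unitmx_of_ker0 => v v0; apply: nrm_le0.
have := Delta_below v (ltW (le_lt_trans K0 Km)); rewrite v0 nrm0.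
by rewrite pmulr_rle0// subr_gt0.
Qed.

End ResolventExpansion.

(** * The spectral projector at a point of the half-plane *)

Section LimitOrder.
Variables (R : realType).
Local Notation C := (cplx R).
Variables (V : normedModType C) (c : C).

Lemma cvg_center : (l - c) @[l --> c^'] --> (0 : C).
Proof.
apply/cvg_nrmP => e e0; apply/dnbhs_nrmP; exists e => // l _.
by rewrite subr0.
Qed.

Lemma cvg_power_scale p (U : C -> V) (A : V) : U l @[l --> c^'] --> A ->
  (l - c) ^+ p.+1 *: U l @[l --> c^'] --> (0 : V).
Proof.
move=> hU; elim: p => [|p ih].
  by rewrite -(scale0r A); apply: cvgZ hU; exact: cvg_center.
under eq_fun do rewrite exprS -scalerA.
by rewrite -(scale0r 0); apply: cvgZ ih; exact: cvg_center.
Qed.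

Lemma dnbhs_lim_unique (U W : C -> V) (A B : V) : (\forall l \near c^', U l = W l) ->
  U l @[l --> c^'] --> A -> W l @[l --> c^'] --> B -> A = B.
Proof.
move=> UW hU hW; apply: (cvg_unique (@norm_hausdorff _ V)) hU _.
apply: cvg_trans hW; apply: near_eq_cvg.
by near=> l; apply/esym; near: l; exact: UW.
Unshelve. all: by end_near. Qed.

(** Multiplying by a further power of [l - c] sends a finite limit to 0, so only
    one power produces a nonzero finite limit. *)
Lemma pole_order_unique (k0 : nat) (H P : C -> V) (A : V) : A != 0 ->
  P l @[l --> c^'] --> A -> (\forall l \near c^', P l = (l - c) ^+ k0 *: H l) ->
  forall k : int, (exists2 B : V, B != 0 & (l - c) ^ k *: H l @[l --> c^'] --> B) <->
    k = k0%:Z.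
Proof.
move=> A0 hP PE k; split => [[B B0 hB]|->]; last first.
  exists A => //; apply: cvg_trans hP; apply: near_eq_cvg.
  by near=> l; near: l; exact: PE.
have [kk0|kk0|//] := ltgtP k k0%:Z.
- have [p kE] : exists p : nat, k0%:Z = p.+1%:Z + k.
    by exists `|k0%:Z - k|.-1%N; rewrite prednK; lia.
  case/eqP: A0; apply: dnbhs_lim_unique hP (cvg_power_scale p hB).
  near=> l; have -> : P l = (l - c) ^+ k0 *: H l by near: l; exact: PE.
  have lc : l - c != 0 by rewrite subr_eq0; near: l; exact: nbhs_dnbhs_neq.
  by rewrite -[(l - c) ^+ k0]/((l - c) ^ k0) kE expfzDr// scalerA.
- have [p kE] : exists p : nat, k = p.+1%:Z + k0%:Z.
    by exists `|k - k0%:Z|.-1%N; rewrite prednK; lia.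
  case/eqP: B0; apply: dnbhs_lim_unique hB (cvg_power_scale p hP).
  near=> l; have -> : P l = (l - c) ^+ k0 *: H l by near: l; exact: PE.
  have lc : l - c != 0 by rewrite subr_eq0; near: l; exact: nbhs_dnbhs_neq.
  by rewrite kE expfzDr// scalerA.
Unshelve. all: by end_near. Qed.

End LimitOrder.

Section SpectralProjector.
Variables (R : realType) (eta : R) (n : nat).
Hypothesis eta0 : 0 < eta.
Local Notation C := (cplx R).
Variable Lh : {linear BUC_R eta n -> 'cV[R]_n}.
Local Notation LC := (complexify Lh).
Variable K : R.
Hypothesis K0 : 0 <= K.
Hypothesis hK : forall phi, nrm (LC phi) <= K * nrm phi.
Hypothesis n0 : (0 < n)%N.
Variable c : C.
Hypothesis hc : - eta < complex.Re c.

Lemma Delta_spectrum : spectrum (AL_op Lh) c -> Delta Lh c \notin unitmx.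
Proof.
by move=> hs; apply/negP => uD; apply: hs; eexists; exact: (Sop_resolvent eta0 hc K0 hK uD).
Qed.

(** The determinant does not vanish far to the right on the real axis, and the
    half-plane is convex: by the identity theorem along a segment the determinant is
    not identically zero near [c]. *)
Lemma Delta_pole : Delta Lh c \notin unitmx ->
  exists k0 D N s P, [/\ (0 < k0)%N, expands c D P N s, D 0%N != 0 &
    exists2 r : R, 0 < r & forall l, l != c -> nrm (l - c) < r ->
      Delta Lh l \in unitmx /\ P l = (l - c) ^+ k0 *: invmx (Delta Lh l)].
Proof.
move=> uD.
have an l : - eta < complex.Re l -> analytic l (fun l => \det (Delta Lh l) : C^o).
  by move=> hl; apply: analytic_det => i j; exact: (Delta_analytic eta0 K0 hK i j hl).
have [a [M [q h]]] := an _ hc.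
apply: (inverse_pole n0 _ h _ uD) => [i j|]; first exact: (Delta_analytic eta0 K0 hK i j hc).
pose m : C := (K + 1)%:C.
apply: (identity_segment (c := m) _ _ h) => [t /andP[t0 t1]|]; last first.
  by rewrite -unitfE -unitmxE; apply: (Delta_unit_large eta0 K0 hK); rewrite ltrDl.
apply: an; rewrite reD reM reB /m /= mul0r subr0.
have key (x y : R) : - eta < x -> 0 <= y -> - eta < y + 1 + t * (x - (y + 1)).
  move=> hx hy; have h1 : 0 <= (1 - t) * (y + 1 + eta).
    by rewrite mulr_ge0 ?subr_ge0// !addr_ge0// ltW.
  have [->|t'] := eqVneq t 0; first by rewrite mul0r; have := eta0; lra.
  have : 0 < t * (x + eta) by apply: mulr_gt0; [rewrite lt_def t'|rewrite -ltrBlDr sub0r].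
  by move: h1; lra.
exact: key.
Qed.

End SpectralProjector.

Section SpectralProjectorFormula.
Variables (R : realType) (eta : R) (n : nat).
Hypothesis eta0 : 0 < eta.
Local Notation C := (cplx R).
Local Notation X := (X_C eta n).
Variable Lh : {linear BUC_R eta n -> 'cV[R]_n}.
Local Notation LC := (complexify Lh).
Variable K : R.
Hypothesis K0 : 0 <= K.
Hypothesis hK : forall phi, nrm (LC phi) <= K * nrm phi.

Lemma bracket_calculus (x : X) (l : C) : - eta < complex.Re l ->
  [/\ forall (theta : R) i, theta <= 0 -> derivable (derive1n i (L20 Lh x theta)) l 1,
      forall i, derivable (derive1n i (L20_bracket Lh x)) l 1,
      forall (theta : R) j, theta <= 0 -> (1 <= j)%N ->
        L2 Lh j l x theta =
        \sum_(k < j.+1) ('C(j, k)%:R * (theta ^+ k)%:C *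
           cexp (l * theta%:C)) *: derive1n (j - k) (L20_bracket Lh x) l &
      forall i, (1 <= i)%N ->
        derive1n i (L20_bracket Lh x) l =
        complexify Lh (mkBUC (cplx_scalars R) eta (exp_integral i l x.2))].
Proof.
move=> hl; split=> [theta i t0|i|theta j t0 _|i i0].
- exact: (L2_derive eta0 K0 hK hl x i t0).1.
- exact: (bracket_derive eta0 K0 hK hl x i).1.
- exact: (L2_leibniz eta0 K0 hK hl x j t0).
- by rewrite (bracket_derive eta0 K0 hK hl x i).2; exact: bracket_coefE.
Qed.

Variable c : C.
Hypothesis hc : - eta < complex.Re c.
Hypothesis n0 : (0 < n)%N.

(** The order [k0] and the matrices come from the pole of [invmx (Delta l)]; [P] is
    the analytic continuation of the function whose derivatives are taken.
    Reversing the sum turns the index [k0 - 1 - i] of [L20_coef] into [j]. *)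
Lemma spectral_projector : spectrum (AL_op Lh) c ->
  exists (k0 : nat) (B : int -> {linear X -> X}) (Dm : nat -> 'M[C]_n),
  let F := fun l : C => (l - c) ^+ k0 *: invmx (Delta Lh l) in
  [/\ pole_expansion (AL_op Lh) c k0 B,
      (\forall l \near c^', Delta Lh l \in unitmx) /\
      (forall k : int,
         (exists2 M : 'M[C]_n, M != 0 &
            (l - c) ^ k *: invmx (Delta Lh l) @[l --> c^'] --> M)
         <-> k = k0%:Z),
      (forall i, \forall l \near c^', derivable (derive1n i F) l 1) /\
      (forall j, (1 <= j <= k0)%N ->
         ((k0 - j)`!%:R)^-1 *: derive1n (k0 - j) F l @[l --> c^'] --> Dm j),
      projector_onto (B (-1)) (gen_eigenspace (AL_op Lh) c) &
      forall x : X,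
         (B (-1) x).1 = 0 /\
         forall theta : R, theta <= 0 -> (B (-1) x).2 theta =
           \sum_(j < k0) (j`!%:R)^-1 *: (Dm j.+1 *m L2 Lh j c x theta)].
Proof.
move=> /(Delta_spectrum eta0 K0 hK hc)/(Delta_pole eta0 K0 hK n0 hc).
move=> [k0 [D [N [s [P [k00 hP D0 [r1 r10 hr1]]]]]]].
have [r2 r20 hr2] := near_re hc.
pose r := Num.min r1 r2; have r0 : 0 < r by rewrite lt_min r10.
have [M [q [M0 hG]]] := expands_Gfun eta0 K0 hK hc k0 hP.
pose Bn := Bcoef eta0 K0 hK hc k0 hP.
have hG' x : expands c (Bn ^~ x) (Gfun Lh c k0 P ^~ x) (M * nrm x) q by exact: hG.
have hres l : l != c -> nrm (l - c) < r -> exists2 S : {linear X -> X},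
    is_resolvent (AL_op Lh) l S & (exists K : R, forall x, nrm (S x) <= K * nrm x) /\
    forall x, Gfun Lh c k0 P l x = (l - c) ^+ k0 *: S x.
  move=> lc; rewrite lt_min => /andP[/(hr1 _ lc)[uD PE] /hr2 hl].
  exact: (Gfun_resolvent eta0 K0 hK lc hl uD PE).
have Bn0 : exists x, Bn 0%N x != 0 by exact: Gcoef_neq0.
have PF : \forall l \near c^', P l = (l - c) ^+ k0 *: invmx (Delta Lh l).
  by apply/dnbhs_nrmP; exists r1 => // l lc /(hr1 _ lc)[].
have FP : \forall l \near c^', (l - c) ^+ k0 *: invmx (Delta Lh l) = P l.
  by near=> l; apply/esym; near: l; exact: PF.
exists k0, (laurent_coef k0 Bn), (fun j => D (k0 - j)%N); split.
- exact: (laurent_pole k00 M0 r0 hG' hres Bn0).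
- split; first by apply/(dnbhs_nrmP c (fun l => Delta Lh l \in unitmx)); exists r1 => // l lc /(hr1 _ lc)[].
  apply: (pole_order_unique D0 _ PF).
  have [_] := punctured_derive1n 0 (@matrix_geom_complete _ _ _) hP FP.
  rewrite mulr1n => h; apply: cvg_trans h; apply: near_eq_cvg.
  by near=> l; near: l; exact: FP.
- split=> [i|j /andP[j1 jk]].
    exact: (punctured_derive1n i (@matrix_geom_complete _ _ _) hP FP).1.
  have [_ h] := punctured_derive1n (k0 - j) (@matrix_geom_complete _ _ _) hP FP.
  have f0 : (k0 - j)`!%:R != 0 :> C by rewrite pnatr_eq0 -lt0n fact_gt0.
  have -> : D (k0 - j)%N = ((k0 - j)`!%:R)^-1 *: (D (k0 - j)%N *+ (k0 - j)`!).
    by rewrite -[X in _ *: X]scaler_nat scalerA mulVf// scale1r.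
  exact: cvgZl_tmp h.
- exact: (laurent_projector k00 r0 hG' hres).
move=> x; rewrite (laurent_coefN1 Bn k00); split=> // t t0.
rewrite -[(Bn _ x).2 t]/((Gcoef eta0 Lh hc k0 D x k0.-1).2 t).
rewrite (Gcoef_eval eta0 K0 hK hc hP)//; last by rewrite prednK.
rewrite prednK// (reindex_inj rev_ord_inj)/=; apply: eq_bigr => j _.
have -> : (k0.-1 - (k0 - j.+1))%N = j by have := ltn_ord j; lia.
have [_ ->] := L2_derive eta0 K0 hK hc x j t0.
have f0 : j`!%:R != 0 :> C by rewrite pnatr_eq0 -lt0n fact_gt0.
by rewrite -scalemxAr scalerA mulVf// scale1r.
Unshelve. all: by end_near. Qed.

End SpectralProjectorFormula.

(** * Orbits of a strongly continuous semigroup *)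

Section RightRegularity.
Variables (R : realType).
Local Notation C := (cplx R).
Variable V : normedModType C.

(** For each slope [e > 0], the times up to which [nrm (g r - g 0) <= e * r] have a
    supremum. It is such a time by continuity from the left, and it cannot be less
    than [t], since the derivative from the right is 0. *)
Lemma right_flat_constant (g : R -> V) (t : R) : 0 <= t ->
  (forall s, 0 <= s < t -> forall e : R, 0 < e -> exists2 d : R, 0 < d &
    forall h, 0 < h < d -> nrm (g (s + h) - g s) <= e * h) ->
  (forall s, 0 < s <= t -> forall e : R, 0 < e -> exists2 d : R, 0 < d &
    forall h, 0 < h < d -> nrm (g (s - h) - g s) <= e) ->
  g t = g 0.
Proof.
move=> t0 gr gl.
have main (e : R) : 0 < e -> nrm (g t - g 0) <= e * t.
  move=> e0.
  pose S : set R := [set s | 0 <= s <= t /\ forall r, 0 <= r <= s -> nrm (g r - g 0) <= e * r].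
  have S0 : S 0.
    split=> [|r]; first by rewrite lexx.
    by rewrite -eq_le => /eqP <-; rewrite subrr nrm0 mulr0.
  have Sub : has_ubound S by exists t => s [/andP[]].
  have Ssup : has_sup S by split=> //; exists 0.
  pose m := sup S.
  have m0 : 0 <= m by apply: ub_le_sup.
  have mt : m <= t by apply: ge_sup => [|s [/andP[]]//]; exists 0.
  have below r : 0 <= r < m -> nrm (g r - g 0) <= e * r.
    move=> /andP[r0 rm]; have [|s [_ hs]] := @sup_adherent _ S (m - r) _ Ssup.
      by rewrite subr_gt0.
    by rewrite -/m subKr => rs; apply: hs; rewrite r0 ltW.
  have at_m : nrm (g m - g 0) <= e * m.
    have [m1|m1] := leP m 0.
      have -> : m = 0 by apply/eqP; rewrite eq_le m1.
      by apply: S0.2; rewrite lexx.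
    apply/ler_addgt0Pl => e' e'0; have [|d d0 hd] := gl m _ e' e'0; first by rewrite m1.
    pose h := Num.min (d / 2) m.
    have h0 : 0 < h by rewrite lt_min m1 divr_gt0.
    have hd' : h < d by rewrite gt_min; apply/orP; left; rewrite ltr_pdivrMr// ltr_pMr// ltr1n.
    have hm : h <= m by rewrite ge_min lexx orbT.
    have := hd h; rewrite h0 hd' => /(_ isT) h1.
    have := below (m - h); rewrite subr_ge0 hm ltrBlDr ltrDl h0 => /(_ isT) h2.
    rewrite (le_trans (nrm_dist (g (m - h)) _ _))// nrm_distC lerD// (le_trans h2)//.
    by rewrite ler_pM2l// gerBl ltW.
  have [tm|tm] := leP t m; first by have -> : t = m by apply/eqP; rewrite eq_le tm.
  have [|d d0 hd] := gr m _ e e0; first by rewrite m0.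
  pose h := Num.min (d / 2) (t - m).
  have h0 : 0 < h by rewrite lt_min subr_gt0 tm divr_gt0.
  have hd' : h < d by rewrite gt_min; apply/orP; left; rewrite ltr_pdivrMr// ltr_pMr// ltr1n.
  have ht : m + h <= t by rewrite -lerBrDl ge_min lexx orbT.
  suff : S (m + h) by move=> /(ub_le_sup Sub); rewrite -/m gerDl leNgt h0.
  split=> [|r /andP[r0 rm]]; first by rewrite ht addr_ge0// ltW.
  have [rm'|mr] := leP r m.
    by move: rm'; rewrite le_eqVlt => /predU1P[->//|rm']; apply: below; rewrite r0.
  rewrite (le_trans (nrm_dist (g m) _ _))//.
  have := hd (r - m); rewrite subr_gt0 mr ltrBlDl (le_lt_trans rm) ?ltrD2l// => /(_ isT).
  rewrite [m + (r - m)]addrC subrK => h1.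
  by have := lerD h1 at_m; rewrite -mulrDr subrK.
apply/eqP; rewrite -subr_eq0; apply/eqP/nrm_le0/ler_addgt0Pl => e e0; rewrite addr0.
have t1 : 0 < t + 1 by rewrite ltr_wpDl.
rewrite (le_trans (main _ (divr_gt0 e0 t1)))// mulrAC ler_pdivrMr// ler_pM2l//.
by rewrite lerDl.
Qed.

(** Nested intervals on which the oscillation tends to 0. *)
Lemma right_continuous_has_continuity_point (u : R -> V) (b : R) : 0 < b ->
  (forall s, 0 <= s -> forall e : R, 0 < e -> exists2 d : R, 0 < d &
    forall h, 0 <= h < d -> nrm (u (s + h) - u s) < e) ->
  exists2 s, 0 < s < b & forall e : R, 0 < e -> exists2 d : R, 0 < d &
    forall r, `|r - s| < d -> nrm (u r - u s) < e.
Proof.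
move=> b0 ur.
pose good (p : R * R) := 0 <= p.1 < p.2.
have step (np : nat * (R * R)) : exists p : R * R, good np.2 ->
    [/\ np.2.1 < p.1, p.1 < p.2, p.2 < np.2.2 &
      forall s, p.1 <= s <= p.2 -> nrm (u s - u p.1) < np.1.+1%:R^-1].
  case: np => k [x y]; rewrite /good /=.
  have [/andP[x0 xy]|] := boolP (0 <= x < y); last by exists 0.
  pose m := (x + y) / 2; have xm : x < m by rewrite midf_lt.
  have my : m < y by rewrite midf_lt.
  have m0 : 0 <= m by exact: le_trans x0 (ltW xm).
  have [|e e0 he] := ur m m0 k.+1%:R^-1; first by rewrite invr_gt0.
  have h0 : 0 < Num.min e (y - m) / 2 by rewrite divr_gt0// lt_min e0 subr_gt0.
  have h1 : Num.min e (y - m) / 2 < Num.min e (y - m).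
    by rewrite ltr_pdivrMr// ltr_pMr ?ltr1n// lt_min e0 subr_gt0.
  exists (m, m + Num.min e (y - m) / 2) => _; split=> //=; first by rewrite ltrDl.
    by rewrite -ltrBrDl (lt_le_trans h1)// ge_min lexx orbT.
  move=> s /andP[ms sm]; have := he (s - m); rewrite [m + _]addrC subrK; apply.
  by rewrite subr_ge0 ms ltrBlDl (le_lt_trans sm)// ltrD2l (lt_le_trans h1)// ge_min lexx.
have [f hf] := choice step.
pose I := fix I k := if k is k'.+1 then f (k', I k') else (0, b).
have good_I k : good (I k).
  elim: k => [|k ih]; first by rewrite /good /= lexx.
  have [h1 h2 _ _] := hf (k, I k) ih; rewrite /good /= h2 andbT.
  by case/andP: ih => i1 _; rewrite (le_trans i1)// ltW.
have hI k := hf (k, I k) (good_I k).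
have mono k j : (I k).1 <= (I (k + j)%N).1 /\ (I (k + j)%N).2 <= (I k).2.
  elim: j => [|j [h1 h2]]; first by rewrite addn0.
  rewrite addnS; have [h3 _ h4 _] := hI (k + j)%N.
  by rewrite (le_trans h1 (ltW h3)) (le_trans (ltW h4) h2).
have cross k j : (I k).1 <= (I j).2.
  have [h1 _] := mono k j; have [_ h2] := mono j k.
  rewrite addnC in h2; rewrite (le_trans h1)// (le_trans _ h2)//.
  by have /andP[_ /ltW] := good_I (k + j)%N.
pose S : set R := [set x | exists k, x = (I k).1].
have Sub j : ubound S (I j).2 by move=> x [k ->].
have lo k : (I k).1 <= sup S by apply: ub_le_sup; [exists (I 0).2; exact: Sub|exists k].
have hi k : sup S <= (I k).2 by apply: ge_sup; [exists (I 0).1, 0%N|exact: Sub].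
have inn k : (I k).1 < sup S < (I k).2.
  have [h1 _ h2 _] := hI k.
  by rewrite (lt_le_trans h1 (lo k.+1)) (le_lt_trans (hi k.+1) h2).
exists (sup S); first exact: inn 0%N.
move=> e e0; (* on the interval number k + 1 the values of u differ by less than 2 / (k + 1) < e *)
pose k := Num.truncn (2 / e).
have ke : k.+1%:R^-1 < e / 2.
  rewrite -[e / 2]invrK ltf_pV2 ?posrE ?invr_gt0 ?divr_gt0// invf_div.
  exact: truncnS_gt.
have /andP[l1 l2] := inn k.+1.
exists (Num.min (sup S - (I k.+1).1) ((I k.+1).2 - sup S)).
  by rewrite lt_min !subr_gt0 l1.
move=> r; rewrite lt_min => /andP[]; rewrite !ltr_norml !ltrBlDr !ltrBrDr.
move=> /andP[h1 _] /andP[_ h2]; have [_ _ _ osc] := hI k.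
have o1 := osc (sup S); rewrite !ltW// in o1.
have o2 : nrm (u r - u (I k.+1).1) < k.+1%:R^-1.
  apply: osc; apply/andP; split; apply: ltW; first by move: h1; rewrite opprB subrK.
  by move: h2; rewrite subrK.
rewrite (le_lt_trans (nrm_dist (u (I k.+1).1) _ _))// [e]splitr.
rewrite ltrD//; first exact: lt_trans o2 ke.
by rewrite nrm_distC (lt_trans _ ke)// o1.
Qed.

Lemma at_right_epsP (P : R -> Prop) : (\forall t \near 0^'+, P t) ->
  exists2 d : R, 0 < d & forall t, 0 < t < d -> P t.
Proof.
move=> /nbhs_ballP[d /= d0 hd]; exists d => // t /andP[t0 td].
by apply: hd => //; rewrite /ball /= sub0r normrN gtr0_norm.
Qed.

End RightRegularity.

Section Orbits.
Variables (R : realType).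
Local Notation C := (cplx R).
Variables (V : normedModType C) (Y : set V) (T : R -> V -> V).
Hypothesis domain_linear : forall (a : C) x y, Y x -> Y y -> Y (a *: x + y).
Hypothesis hT : C0_semigroup Y T.

Lemma domainB x y : Y x -> Y y -> Y (x - y).
Proof. by move=> hx hy; rewrite addrC -scaleN1r; exact: domain_linear. Qed.

Lemma domainZ (a : C) x : Y x -> Y (a *: x).
Proof. by move=> hx; rewrite -[a](subrK 1) scalerDl scale1r; exact: domain_linear. Qed.

Lemma semigroupZ t (a : C) x : 0 <= t -> Y x -> T t (a *: x) = a *: T t x.
Proof.
move=> t0 hx; have [_ h _] := hT.1 t t0.
by rewrite -[in LHS](subrK 1 a) scalerDl scale1r h// scalerBl scale1r subrK.
Qed.

Lemma semigroupB t x y : 0 <= t -> Y x -> Y y -> T t (x - y) = T t x - T t y.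
Proof.
move=> t0 hx hy; have [_ h _] := hT.1 t t0.
by rewrite addrC -scaleN1r h// scaleN1r addrC.
Qed.

Lemma semigroup_bounded t : 0 <= t ->
  exists2 M : R, 0 < M & forall x, Y x -> nrm (T t x) <= M * nrm x.
Proof.
move=> /(hT.1 t)[_ _ [M hM]]; exists (Num.max 0 M + 1).
  by rewrite ltr_wpDl// le_max lexx.
move=> x /hM; rewrite !nrmE -rmorphM lecR => /le_trans; apply.
by rewrite ler_wpM2r ?nrm_ge0// (@le_trans _ _ (Num.max 0 M))// ?lerDl// le_max lexx orbT.
Qed.

Lemma semigroupS t x : 0 <= t -> Y x -> Y (T t x).
Proof. by move=> /(hT.1 t)[h _ _]; exact: h. Qed.

Lemma orbit_right_continuous x : Y x ->
  forall s, 0 <= s -> forall e : R, 0 < e -> exists2 d : R, 0 < d &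
    forall h, 0 <= h < d -> nrm (T (s + h) x - T s x) < e.
Proof.
move=> Yx s s0 e e0; have [M M0 hM] := semigroup_bounded s0.
have [_ [T0 TD /(_ x Yx)]] := hT.
move=> /cvg_nrmP/(_ _ (divr_gt0 e0 M0))/at_right_epsP[d d0 hd]; exists d => // h /andP[h0 hd'].
rewrite TD// -semigroupB//; last exact: semigroupS.
rewrite (le_lt_trans (hM _ (domainB (semigroupS h0 Yx) Yx)))// -ltr_pdivlMl// mulrC.
move: h0; rewrite le_eqVlt => /predU1P[<-|h0].
  by rewrite T0// subrr nrm0 divr_gt0.
by apply: hd; rewrite h0.
Qed.

(** A continuity point [s1] of the orbit propagates to every later time [s],
    since [T (s - s1)] is bounded. *)
Lemma orbit_left_continuous x : Y x ->
  forall s, 0 < s -> forall e : R, 0 < e -> exists2 d : R, 0 < d &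
    forall h, 0 < h < d -> h <= s /\ nrm (T (s - h) x - T s x) <= e.
Proof.
move=> Yx s s0 e e0.
have [s1 /andP[s10 s1s] hs1] :=
  right_continuous_has_continuity_point s0 (orbit_right_continuous Yx).
have ss1 : 0 <= s - s1 by rewrite subr_ge0 ltW.
have [M M0 hM] := semigroup_bounded ss1.
have [d d0 hd] := hs1 _ (divr_gt0 e0 M0).
exists (Num.min d s1); first by rewrite lt_min d0.
move=> h /andP[h0]; rewrite lt_min => /andP[hd' hs].
split; first by rewrite ltW// (lt_trans hs).
have sh : 0 <= s1 - h by rewrite subr_ge0 ltW.
have [_ [_ TD _]] := hT.
have -> : s - h = (s - s1) + (s1 - h) by rewrite addrA subrK.
have {2}-> : s = (s - s1) + s1 by rewrite subrK.
have s10' := ltW s10.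
have Y1 := semigroupS sh Yx; have Y2 := semigroupS s10' Yx.
rewrite (TD _ _ _ ss1 sh Yx) (TD _ _ _ ss1 s10' Yx) -semigroupB//.
rewrite (le_trans (hM _ (domainB Y1 Y2)))// -ler_pdivlMl// mulrC ltW//.
by apply: hd; rewrite addrAC subrr add0r normrN gtr0_norm.
Qed.

(** The difference quotient at time [s] is [T s] applied to the one at time 0. *)
Lemma orbit_right_derivative (A : operator V) x s : generates A Y T -> dom A x ->
  Y (act A x) -> 0 <= s -> dom A (T s x) /\
  forall e : R, 0 < e -> exists2 d : R, 0 < d & forall h, 0 < h < d ->
    nrm (T (s + h) x - T s x - h%:C *: act A (T s x)) <= e * h.
Proof.
move=> hg dx Yax s0; have [Yx hx] := (hg x (act A x)).1 (conj dx erefl).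
have Ys := semigroupS s0 Yx.
have [_ [_ TD _]] := hT; have [_ Tlin _] := hT.1 s s0.
have [M M0 hM] := semigroup_bounded s0.
have [ds _] : dom A (T s x) /\ act A (T s x) = T s (act A x).
  apply/hg; split=> //; apply/cvg_nrmP => e e0.
  move/cvg_nrmP: hx => /(_ _ (divr_gt0 e0 M0)).
  move=> /at_right_epsP[d d0 hd]; apply/nbhs_ballP; exists d => //= h.
  rewrite /ball /= sub0r normrN => hd' h0; rewrite gtr0_norm// in hd'.
  have Yh := semigroupS (ltW h0) Yx.
  have := hd h; rewrite h0 hd' => /(_ isT); rewrite ltr_pdivlMr// mulrC.
  apply: le_lt_trans; have Yd := domainB Yh Yx.
  have -> : T h (T s x) - T s x = T s (T h x - x).
    by rewrite semigroupB// -!TD ?[s + h]addrC// ltW.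
  rewrite -semigroupZ// -semigroupB//; last exact: domainZ.
  by apply: hM; apply: domainB => //; exact: domainZ.
split=> // e e0.
have [_] := (hg (T s x) (act A (T s x))).1 (conj ds erefl).
move=> /cvg_nrmP/(_ _ e0)/at_right_epsP[d d0 hd]; exists d => // h hh.
have /ltW := hd h hh; case/andP: hh => h0 _; have h0' := ltW h0.
have -> : T (s + h) x - T s x - h%:C *: act A (T s x) =
    h%:C *: ((h^-1)%:C *: (T h (T s x) - T s x) - act A (T s x)).
  rewrite scalerBr scalerA -rmorphM mulfV ?gt_eqF// scale1r -TD// [h + s]addrC//.
by rewrite nrmZ nrm_real gtr0_norm// mulrC => h1; rewrite ler_pM2r.
Qed.

End Orbits.

(** * The translation part of the semigroup *)

Section Translation.
Variables (R : realType) (eta : R) (n : nat).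
Hypothesis eta0 : 0 < eta.
Local Notation C := (cplx R).
Variable Lh : {linear BUC_R eta n -> 'cV[R]_n}.
Local Notation BC := (BUC_C eta n).
Local Notation X := (X_C eta n).
Local Notation X0 := (X0 n eta).

Lemma closure_nrmP (V : normedModType C) (S : set V) x :
  closure S x <-> forall e : R, 0 < e -> exists2 y, S y & nrm (y - x) < e.
Proof.
split=> [h e e0|h B /near_nrmP[e e0 hB]].
  have [|y [Sy hy]] := h [set y | nrm (y - x) < e]; last by exists y.
  by apply/near_nrmP; exists e.
by have [y Sy hy] := h e e0; exists y; split=> //; exact: hB.
Qed.

Lemma domA_linear (a : C) (x y : X) :
  dom (A_op n eta) x -> dom (A_op n eta) y -> dom (A_op n eta) (a *: x + y).
Proof.
move=> [x1 [p hp]] [y1 [q hq]]; split.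
  by rewrite -[LHS]/(a *: x.1 + y.1) x1 y1 scaler0 addr0.
by exists (a *: p + q); exact: (buc_derivative_lin (a := a) hp hq).
Qed.

Lemma X0_linear (a : C) (x y : X) : X0 x -> X0 y -> X0 (a *: x + y).
Proof.
move=> /closure_nrmP hx /closure_nrmP hy; apply/closure_nrmP => e e0.
have a1 : 0 < nrm a + 1 by rewrite ltr_wpDl// nrm_ge0.
have e2 : 0 < e / 2 by rewrite divr_gt0.
have [x' dx hx'] := hx _ (divr_gt0 e2 a1); have [y' dy hy'] := hy _ e2.
exists (a *: x' + y'); first exact: domA_linear.
rewrite opprD addrACA -scalerBr (le_lt_trans (nrmD _ _))// nrmZ [e]splitr ler_ltD//.
rewrite (le_trans (ler_wpM2l (nrm_ge0 _) (ltW hx')))// mulrA ler_pdivrMr//.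
by rewrite mulrC ler_wpM2l ?(ltW e2)// lerDl.
Qed.

Lemma buc_continuous (phi : BC) t (e : R) : 0 < e -> exists2 d : R, 0 < d &
  forall u, `|u - t| < d -> nrm (phi u - phi t) <= e.
Proof.
move=> e0; have e2 : 0 < e / 2 by rewrite divr_gt0.
have entry (i : 'I_n) : \forall u \near t, nrm (phi u i 0 - phi t i 0) <= e.
  have [c1 c2] := buc_ccontinuous phi i.
  have := c1 t; move=> /cvgrPdist_le/(_ _ e2) h1.
  have := c2 t; move=> /cvgrPdist_le/(_ _ e2) h2.
  near=> u; rewrite nrm_distC (le_trans (nrm_ReIm _))// reB imB [e]splitr lerD//.
    by near: u.
  by near: u.
have := @filter_forall _ _ _ _ (nbhs_filter t) entry.
move=> /nbhs_ballP[d /= d0 hd]; exists d => // u ut.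
apply: nrm_mx_le => [|i j]; first exact: ltW.
by rewrite ord1 !mxE; apply: hd; rewrite /ball /= distrC.
Unshelve. all: by end_near. Qed.

Lemma dom_AL0_deriv (x : X) : dom (AL0_op Lh) x ->
  X0 (act (AL0_op Lh) x) /\ buc_derivative x.2 (act (AL0_op Lh) x).2.
Proof.
move=> [[_ [p hp]] _ h]; split; first exact: h.
suff h' : buc_derivative x.2 (buc_deriv x.2 + 0) by exact: h'.
by rewrite addr0 (buc_derivE hp).
Qed.

(** Along an orbit, [u] satisfies the transport equation [u_t = u_theta], so it is
    constant on the characteristics [theta + t = tau]. *)
Lemma orbit_translation (T : R -> X -> X) (x : X) (tau t : R) :
  C0_semigroup X0 T -> generates (AL0_op Lh) X0 T -> dom (AL0_op Lh) x ->
  tau <= 0 -> 0 <= t -> (T t x).2 (tau - t) = x.2 tau.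
Proof.
move=> hT hg dx tau0 t0.
have Xx : X0 x by case: dx => [].
have [Xax _] := dom_AL0_deriv dx.
have [_ [T0 _ _]] := hT.
rewrite -{2}(T0 _ Xx) -{2}(subr0 tau).
apply: (right_flat_constant (g := fun s => (T s x).2 (tau - s))) => // s.
  move=> /andP[s0 _] e e0; pose W := expR (eta * (s + 1 - tau)).
  have W0 : 0 < W by exact: expR_gt0.
  have e3 : 0 < e / 3 by rewrite divr_gt0.
  have [ds /(_ _ (divr_gt0 e3 W0))[d1 d10 h1]] :=
    orbit_right_derivative X0_linear hT hg dx Xax s0.
  have [_ /buc_derivativeP hd] := dom_AL0_deriv ds.
  set z := T s x in ds h1 hd *; set D := (act _ z).2 in hd.
  have ts0 : tau - s <= 0 by rewrite subr_le0 (le_trans tau0).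
  have [d2 d20 h2] := hd _ ts0 _ e3.
  have [d3 d30 h3] := buc_continuous D (tau - s) e3.
  exists (Num.min (Num.min d1 1) (Num.min d2 d3)); first by rewrite !lt_min d10 d20 d30 ltr01.
  move=> h /andP[h0]; rewrite !lt_min => /andP[/andP[hd1 hlt1] /andP[hd2 hd3]].
  have dh : tau - (s + h) - (tau - s) = - h by ring.
  have th0 : tau - (s + h) <= 0 by rewrite subr_le0 (le_trans tau0)// addr_ge0// ltW.
  have b1 : nrm ((T (s + h) x).2 (tau - (s + h)) - z.2 (tau - (s + h)) -
      h%:C *: D (tau - (s + h))) <= e / 3 * h.
    have := h1 h; rewrite h0 hd1 => /(_ isT) h1'.
    pose y := (T (s + h) x - z - h%:C *: act (AL0_op Lh) z : X).
    rewrite -[X in nrm X]/(eval_buc (tau - (s + h)) y.2).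
    rewrite (le_trans (nrm_evalbuc _ th0))//.
    have hW : expR (- (eta * (tau - (s + h)))) <= W.
      rewrite ler_expR -mulrN ler_pM2l// opprB lerD2r lerD2l ltW//.
    have hy : nrm y.2 <= e / 3 / W * h.
      by apply: le_trans h1'; rewrite nrm_X lerDr nrm_ge0.
    rewrite (le_trans (ler_pM (expR_ge0 _) (nrm_ge0 _) hW hy))//.
    by rewrite mulrA mulrCA mulfV ?gt_eqF// mulr1.
  have b2 : nrm (z.2 (tau - (s + h)) - z.2 (tau - s) + h%:C *: D (tau - s)) <= e / 3 * h.
    have := h2 _ th0; rewrite -subr_eq0 dh oppr_eq0 gt_eqF// normrN gtr0_norm//.
    move=> /(_ isT hd2); set v := _ *: _ - _ => hv.
    have -> : z.2 (tau - (s + h)) - z.2 (tau - s) + h%:C *: D (tau - s) = (- h)%:C *: v.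
      rewrite /v scalerBr scalerA -rmorphM mulfV ?oppr_eq0 ?gt_eqF// scale1r.
      by rewrite rmorphN scaleNr opprK.
    by rewrite nrmZ nrm_real normrN gtr0_norm// mulrC ler_pM2r// ltW.
  have b3 : nrm (h%:C *: (D (tau - (s + h)) - D (tau - s))) <= e / 3 * h.
    rewrite nrmZ nrm_real gtr0_norm// mulrC ler_pM2r//; apply: h3.
    by rewrite dh normrN gtr0_norm.
  have -> : (T (s + h) x).2 (tau - (s + h)) - z.2 (tau - s) =
    ((T (s + h) x).2 (tau - (s + h)) - z.2 (tau - (s + h)) - h%:C *: D (tau - (s + h))) +
    (z.2 (tau - (s + h)) - z.2 (tau - s) + h%:C *: D (tau - s)) +
    h%:C *: (D (tau - (s + h)) - D (tau - s)).
    rewrite scalerBr; move: (h%:C *: D _) (h%:C *: D _) (z.2 _) (z.2 _) => a b c d.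
    by apply/matrixP => i j; rewrite !mxE; ring.
  rewrite (le_trans (nrmD _ _))//; have -> : e * h = (e / 3 * h + e / 3 * h) + e / 3 * h.
    by field.
  by rewrite lerD// (le_trans (nrmD _ _))// lerD.
move=> /andP[s0 _] e e0; pose W := expR (eta * (s - tau)).
have W0 : 0 < W by exact: expR_gt0.
have e2 : 0 < e / 2 by rewrite divr_gt0.
have [d1 d10 h1] := orbit_left_continuous X0_linear hT Xx s0 (divr_gt0 e2 W0).
have [d2 d20 h2] := buc_continuous (T s x).2 (tau - s) e2.
exists (Num.min d1 d2); first by rewrite lt_min d10.
move=> h /andP[h0]; rewrite lt_min => /andP[hd1 hd2].
have := h1 h; rewrite h0 hd1 => /(_ isT)[hs hy].
have th0 : tau - (s - h) <= 0 by rewrite subr_le0 (le_trans tau0)// subr_ge0.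
rewrite (le_trans (nrm_dist ((T s x).2 (tau - (s - h))) _ _))// [e]splitr lerD//.
  pose y := (T (s - h) x - T s x : X).
  rewrite -[X in nrm X]/(eval_buc (tau - (s - h)) y.2) (le_trans (nrm_evalbuc _ th0))//.
  have hW : expR (- (eta * (tau - (s - h)))) <= W.
    by rewrite ler_expR -mulrN ler_pM2l// opprB lerD2r gerBl ltW.
  have hy2 : nrm y.2 <= e / 2 / W by apply: le_trans hy; rewrite [leRHS]nrm_X lerDr nrm_ge0.
  rewrite (le_trans (ler_pM (expR_ge0 _) (nrm_ge0 _) hW hy2))//.
  by rewrite mulrCA mulfV ?gt_eqF// mulr1.
apply: h2; have -> : tau - (s - h) - (tau - s) = h by ring.
by rewrite gtr0_norm.
Qed.

End Translation.

(** * Lower bound for the essential growth bound *)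

Section EssentialGrowth.
Variables (R : realType) (eta : R) (n : nat).
Hypothesis eta0 : 0 < eta.
Local Notation C := (cplx R).
Variable Lh : {linear BUC_R eta n -> 'cV[R]_n}.
Local Notation LC := (complexify Lh).
Local Notation BC := (BUC_C eta n).
Local Notation X := (X_C eta n).
Local Notation Eop := (@Eop R eta n).
Local Notation X0 := (X0 n eta).
Variable K : R.
Hypothesis K0 : 0 <= K.
Hypothesis hK : forall phi, nrm (LC phi) <= K * nrm phi.
Hypothesis n0 : (0 < n)%N.

Lemma dom_AL0I (phi psi : BC) : buc_derivative phi psi -> BUC1 psi ->
  psi 0 = LC phi -> dom (AL0_op Lh) (mkX 0 phi).
Proof.
move=> hd psi1 e.
have A0 (chi : BC) : BUC1 chi -> dom (A_op n eta) (mkX 0 chi) by split.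
have phi1 : BUC1 phi by exists psi.
split; first exact: A0.
  by apply: subset_closure; exact: A0.
have -> : act (AL_op Lh) (mkX 0 phi) = mkX 0 psi.
  apply: X_ext.
    suff h : - buc_deriv phi 0 + LC phi = 0 by exact: h.
    by rewrite (buc_derivE hd) e addNr.
  suff h : buc_deriv phi + 0 = psi by exact: h.
  by rewrite addr0 (buc_derivE hd).
by apply: subset_closure; exact: A0.
Qed.

Lemma Eop_BUC1 (l m : C) (v w : 'cV[C]_n) :
  - eta <= complex.Re l -> - eta <= complex.Re m ->
  buc_derivative (Eop l v + Eop m w) (Eop l (l *: v) + Eop m (m *: w)).
Proof.
move=> hl hm.
have EZ (k : C) u : - eta <= complex.Re k -> k *: Eop k u = Eop k (k *: u).
  by move=> hk; exact: esym (linearZ_LR (lin_of (Eop_linear eta0 hk)) k u).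
have := buc_derivative_lin (a := 1) (@Eop_deriv R eta n eta0 l v hl)
  (@Eop_deriv R eta n eta0 m w hm).
by rewrite !scale1r !EZ.
Qed.

Lemma cexp_antipodal (a x y t : R) : (x - y) * t = pi ->
  cexp ((a +i* x : C) * t%:C) = - cexp ((a +i* y : C) * t%:C).
Proof.
move=> h; rewrite !cexpE /=; have -> : x * t = y * t + pi by rewrite -h; ring.
by rewrite cosDpi sinDpi; apply: cplx_eq; rewrite /= !mul0r; ring.
Qed.

Let freq (k : nat) : R := k.+1%:R^-1.
Let lam (k : nat) : C := (- eta) +i* freq k.

Lemma freq_inj k j : freq k = freq j -> k = j.
Proof. by move=> /invr_inj/eqP; rewrite eqr_nat eqSS => /eqP. Qed.

(** Exponentials of exponents [lam k] on the boundary line of the half-plane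
    become antipodal after a finite time. A small multiple of an exponential
    with large real exponent corrects the boundary condition at 0. *)
Lemma separated_family : exists y : nat -> X,
  [/\ forall k, dom (AL0_op Lh) (y k), forall k, nrm (y k) <= 1 &
    forall k j, k != j -> exists2 t : R, t <= 0 &
      3 / 4 <= expR (eta * t) * nrm ((y k).2 t - (y j).2 t)].
Proof.
have ar1 (a : R) : a <= 1 / 8 -> 1 / 2 + a <= 1 by lra.
have ar2 (a b : R) : a <= 1 / 8 -> b <= 1 / 8 -> a + b <= 1 / 4 by lra.
have ar3 (a b : R) : 1 <= a + b -> b <= 1 / 4 -> 3 / 4 <= a by lra.
have [v v1] : exists v : 'cV[C]_n, nrm v = 1 / 2.
  pose v0 : 'cV[C]_n := delta_mx (Ordinal n0) 0.
  have v00 : 0 < nrm v0.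
    apply: nrm_gt0; apply/negP => /eqP/matrixP/(_ (Ordinal n0) 0).
    by rewrite !mxE !eqxx => /eqP; rewrite oner_eq0.
  exists ((1 / 2 / nrm v0)%:C *: v0).
  by rewrite nrmZ nrm_real ger0_norm ?divr_ge0 ?(ltW v00)// mulfVK ?gt_eqF.
have hl k : - eta <= complex.Re (lam k) by rewrite /= lexx.
(* c0 bounds the right-hand side of the equation for the coefficient c k, and the
   choice of m makes that coefficient at most c0 / (m - K) = 1 / 8 *)
pose c0 := (K + eta + 1) / 2.
have c00 : 0 < c0 by rewrite divr_gt0// ltr_wpDl// addr_ge0// ltW.
pose m := K + 8 * c0.
have m0 : 0 <= m by rewrite addr_ge0// mulr_ge0// ltW.
have Km : K < m by rewrite ltrDl mulr_gt0.
have hm : - eta <= complex.Re (m%:C : C) by rewrite /= (le_trans _ m0)// oppr_le0 ltW.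
have uD := Delta_unit_large eta0 K0 hK Km.
pose c k := invmx (Delta Lh m%:C) *m (LC (Eop (lam k) v) - lam k *: v).
have Dc k : Delta Lh m%:C *m c k = LC (Eop (lam k) v) - lam k *: v by rewrite mulKVmx.
have nlam k : nrm (lam k) <= eta + 1.
  rewrite (le_trans (nrm_ReIm _))//= normrN gtr0_norm// lerD2l ger0_norm ?invr_ge0//.
  by rewrite invf_le1// ler1n.
have nc k : nrm (c k) <= 1 / 8.
  have := Delta_below eta0 K0 hK (c k) m0; rewrite Dc => h.
  have h1 : nrm (LC (Eop (lam k) v) - lam k *: v) <= c0.
    rewrite (le_trans (nrmB _ _))// nrmZ v1 /c0.
    have h2 := nrm_Eop eta0 v (hl k); rewrite v1 in h2.
    have h3 := hK (Eop (lam k) v).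
    have h4 : K * nrm (Eop (lam k) v) <= K * (1 / 2) by rewrite ler_wpM2l.
    have h5 := nlam k; move: (nrm (lam k)) h5 => a h5; lra.
  have {}h := le_trans h h1; rewrite /m addrAC subrr add0r in h.
  have : 8 * nrm (c k) <= 1.
    by rewrite -(ler_pM2l c00) mulr1 mulrA [c0 * 8]mulrC.
  by lra.
exists (fun k => mkX 0 (Eop (lam k) v + Eop m%:C (c k))); split.
- move=> k; apply: (dom_AL0I (@Eop_BUC1 _ _ v (c k) (hl k) hm)).
    by eexists; exact: Eop_BUC1.
  have -> : (Eop (lam k) (lam k *: v) + Eop m%:C (m%:C *: c k) : BC) 0 =
      Eop (lam k) (lam k *: v) 0 + Eop m%:C (m%:C *: c k) 0 by [].
  rewrite !Eop0//; have := Dc k; rewrite (Delta_mulmx eta0 Lh _ hm) => h.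
  have -> : LC (Eop (lam k) v + Eop m%:C (c k)) = LC (Eop (lam k) v) + LC (Eop m%:C (c k)).
    exact: (linearD (LCl Lh)).
  by move/eqP: h; rewrite subr_eq => /eqP ->; rewrite addrA addrCA subrr addr0.
- move=> k; rewrite nrm_X /= nrm0 add0r (le_trans (nrmD _ _))//.
  have h1 := nrm_Eop eta0 v (hl k); have h2 := nrm_Eop eta0 (c k) hm.
  rewrite v1 in h1; apply: le_trans (lerD h1 h2) _.
  exact: ar1.
move=> k j kj.
wlog jk : k j kj / freq j > freq k => [wl|].
  have : freq k != freq j by apply: contra_neq kj; exact: freq_inj.
  case/lt_total/orP => h; first exact: wl.
  have jk : j != k by rewrite eq_sym.
  have [t t0 ht] := wl _ _ jk h.
  exists t; first exact: t0.
  rewrite [X in _ <= _ * X]nrm_distC.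
  exact: ht.
have d0 : freq k - freq j < 0 by rewrite subr_lt0.
(* the first negative time at which the two phases differ by pi; the norm of the
   difference of the two exponentials is then 2 * (1 / 2), and the corrections
   take away at most 2 * (1 / 8) *)
exists (pi / (freq k - freq j)).
  by rewrite mulr_ge0_le0 ?pi_ge0// invr_le0 ltW.
set t := pi / _; have t0 : t <= 0 by rewrite mulr_ge0_le0 ?pi_ge0// invr_le0 ltW.
have ht : (freq k - freq j) * t = pi by rewrite mulrCA mulfV ?mulr1// lt_eqF.
have -> : (mkX 0 (Eop (lam k) v + Eop m%:C (c k)) : X).2 t -
          (mkX 0 (Eop (lam j) v + Eop m%:C (c j)) : X).2 t =
   (Eop (lam k) v t - Eop (lam j) v t) + (Eop m%:C (c k) t - Eop m%:C (c j) t).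
  rewrite -[LHS]/((Eop (lam k) v t + Eop m%:C (c k) t) - (Eop (lam j) v t + Eop m%:C (c j) t)).
  by rewrite opprD addrACA.
rewrite !(Eop_fun eta0 v _ t0)// (cexp_antipodal (- eta) ht).
set a := cexp _; have na : expR (eta * t) * nrm a = 1.
  by rewrite /a nrm_cexp /= mulNr expRN mulfV// gt_eqF// expR_gt0.
have -> : - a *: v - a *: v = (- 2 * a) *: v.
  by rewrite -scalerBl; congr (_ *: _); ring.
set w := Eop _ _ t - _.
have hw : expR (eta * t) * nrm w <= 1 / 4.
  have b i : expR (eta * t) * nrm (Eop m%:C (c i) t) <= 1 / 8.
    by rewrite (le_trans (nrm_eval _ t0))// (le_trans (nrm_Eop eta0 _ hm)).
  rewrite (le_trans (ler_wpM2l (expR_ge0 _) (nrmB _ _)))// mulrDr.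
  exact: ar2.
have : nrm ((- 2 * a) *: v) <= nrm ((- 2 * a) *: v + w) + nrm w.
  by have := nrmB ((- 2 * a) *: v + w) w; rewrite addrK.
move=> /(ler_wpM2l (expR_ge0 (eta * t))); rewrite mulrDr nrmZ nrmM nrmN nrm_nat v1.
have -> : expR (eta * t) * (2 * nrm a * (1 / 2)) = expR (eta * t) * nrm a by field.
by rewrite na => /ar3; apply.
Qed.

Variable T : R -> X -> X.
Hypothesis hT : C0_semigroup X0 T.
Hypothesis hg : generates (AL0_op Lh) X0 T.

(** The images of the family are [3 / 4 * e^(- eta t)] apart, so that a ball of radius
    less than half of this contains at most one of them. *)
Lemma ess_norm_ge (t : R) : 0 <= t -> expR (- (eta * t)) / 4 <= ess_norm X0 (T t).
Proof.
move=> t0; have [y [ydom y1 ysep]] := separated_family.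
have Xy k : X0 (y k) by case: (ydom k).
have sep k j : k != j -> 3 / 4 * expR (- (eta * t)) <= nrm (T t (y k) - T t (y j)).
  move=> /ysep[u u0 hu].
  have ut0 : u - t <= 0 by rewrite subr_le0 (le_trans u0).
  have := nrm_eval (T t (y k) - T t (y j)).2 ut0.
  have -> : (T t (y k) - T t (y j)).2 (u - t) = (y k).2 u - (y j).2 u.
    rewrite -[LHS]/((T t (y k)).2 (u - t) - (T t (y j)).2 (u - t)).
    by rewrite !(orbit_translation eta0 hT hg).
  have h1 : nrm (T t (y k) - T t (y j)).2 <= nrm (T t (y k) - T t (y j)).
    by rewrite [leRHS]nrm_X lerDr nrm_ge0.
  move=> h2; apply: le_trans (le_trans h2 h1).
  by rewrite mulrBr expRD [expR (eta * u) * _]mulrC -[leRHS]mulrA [leLHS]mulrC ler_wpM2l ?expR_ge0.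
rewrite /ess_norm /noncompactness; apply: lb_le_inf.
  (* one ball suffices because T t is bounded *)
  have [M M0 hM] := semigroup_bounded hT t0.
  exists (M + 1); split; first by rewrite addr_gt0.
  exists [:: (0, M + 1)].
    move=> p; rewrite inE => /eqP ->; split=> //=.
    have := X0_linear (a := -1) (Xy 0%N) (Xy 0%N).
    by rewrite scaleN1r addNr.
  move=> _ [x [Xx x1] <-]; exists (0, M + 1); first by rewrite inE.
  rewrite subr0 nrmE ltcR /= (le_lt_trans (hM _ Xx))//.
  rewrite nrmE -[1]/(1%:C) lecR in x1.
  by rewrite (@le_lt_trans _ _ M) ?ltrDl// ler_piMr// ltW.
move=> e [e0 [cr hcr cov]].
have ball k : exists p, [/\ p \in cr, p.2 <= e & nrm (T t (y k) - p.1) < p.2].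
  have [|p pcr hp] := cov (T t (y k)).
    exists (y k) => //; split; first exact: Xy.
    by rewrite nrmE -[1]/(1%:C) lecR.
  exists p; split => //; first by case: (hcr p pcr).
  by rewrite nrmE ltcR in hp.
have [p hp] := choice ball.
(* pigeonhole: two images share a ball *)
have [k [j [kj pkj]]] : exists k j, k != j /\ p k = p j.
  apply/not_existsP => /= hn.
  have inj k j : p k = p j -> k = j.
    move=> pkj; apply/eqP/negPn/negP => kj; apply: (hn k); exists j; split=> //.
  have := @uniq_leq_size _ [seq p k | k <- iota 0 (size cr).+1] cr.
  rewrite map_inj_uniq// iota_uniq size_map size_iota ltnn => h.
  by apply: notF; apply: h => // _ /mapP[k _ ->]; case: (hp k).
have [_ pe pk] := hp k; have [_ _ pj] := hp j; rewrite -pkj in pj.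
have := nrm_dist (p k).1 (T t (y k)) (T t (y j)); rewrite [nrm ((p k).1 - _)]nrm_distC => h.
have := sep k j kj; have := expR_gt0 (- (eta * t)).
by move: (nrm _) (nrm _) (nrm _) (expR _) pk pj h pe => a b d x; lra.
Qed.

(** The constant 4 contributes [ln 4 / t], which tends to 0. *)
Lemma ess_growth_bound_ge (w : \bar R) : ess_growth_bound X0 T w -> ((- eta)%:E <= w)%E.
Proof.
move=> hw; apply/lee_addgt0Pr => e e0.
have : ((- eta - e)%:E <= w)%E.
  apply: cvge_ge hw.
  near=> t; have t0 : 0 < t by near: t; exact: nbhs_pinfty_gt.
  have te : ln 4 / e <= t by near: t; apply: nbhs_pinfty_ge; exact: num_real.
  have h := ess_norm_ge (ltW t0).
  have h0 : 0 < expR (- (eta * t)) / 4 by rewrite divr_gt0// expR_gt0.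
  rewrite lne_EFin ?(lt_le_trans h0)// -EFinM lee_fin ler_pdivlMl//.
  apply: le_trans (_ : ln (expR (- (eta * t)) / 4) <= _); last first.
    by rewrite ler_ln// posrE// (lt_le_trans h0).
  rewrite ln_div ?posrE ?expR_gt0// expRK.
  move: te; rewrite ler_pdivrMr//; move: (ln 4) => a; lra.
by rewrite EFinB leeBlDr.
Unshelve. all: by end_near. Qed.

End EssentialGrowth.

Theorem proposition5p4 (R : realType) (n : nat) (hn : (0 < n)%N)
  (eta : R) (heta : 0 < eta)
  (Lh : {linear BUC_R eta n -> 'cV[R]_n})
  (hLh : exists M : R, forall phi, `|Lh phi| <= M * `|phi|)
  (T : R -> X_C eta n -> X_C eta n)
  (hT : C0_semigroup (X0 n eta) T)
  (hgen : generates (AL0_op Lh) (X0 n eta) T)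
  (w : \bar R) (hw : ess_growth_bound (X0 n eta) T w)
  (lam0 : cplx R) (hspec : spectrum (AL_op Lh) lam0)
  (hre : (w < (complex.Re lam0)%:E)%E) :
  exists (k0 : nat) (B : int -> {linear X_C eta n -> X_C eta n})
         (Dm : nat -> 'M[cplx R]_n),
  let F := fun l : cplx R => (l - lam0) ^+ k0 *: invmx (Delta Lh l) in
  [/\ pole_expansion (AL_op Lh) lam0 k0 B,
      (\forall l \near lam0^', Delta Lh l \in unitmx) /\
      (forall k : int,
         (exists2 M : 'M[cplx R]_n, M != 0 &
            (l - lam0) ^ k *: invmx (Delta Lh l) @[l --> lam0^'] --> M)
         <-> k = k0%:Z),
      (forall i, \forall l \near lam0^', derivable (derive1n i F) l 1) /\
      (forall j, (1 <= j <= k0)%N ->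
         ((k0 - j)`!%:R)^-1 *: derive1n (k0 - j) F l @[l --> lam0^'] --> Dm j),
      projector_onto (B (-1)) (gen_eigenspace (AL_op Lh) lam0) /\
      (forall x : X_C eta n,
         (B (-1) x).1 = 0 /\
         forall theta : R, theta <= 0 -> (B (-1) x).2 theta =
           \sum_(j < k0) (j`!%:R)^-1 *: (Dm j.+1 *m L2 Lh j lam0 x theta)) &
      forall (x : X_C eta n) (l : cplx R), - eta < complex.Re l ->
        [/\ forall (theta : R) i, theta <= 0 -> derivable (derive1n i (L20 Lh x theta)) l 1,
            forall i, derivable (derive1n i (L20_bracket Lh x)) l 1,
            forall (theta : R) j, theta <= 0 -> (1 <= j)%N ->
              L2 Lh j l x theta =
              \sum_(k < j.+1) ('C(j, k)%:R * (theta ^+ k)%:C *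
                 cexp (l * theta%:C)) *: derive1n (j - k) (L20_bracket Lh x) l &
            forall i, (1 <= i)%N ->
              derive1n i (L20_bracket Lh x) l =
              complexify Lh (mkBUC (cplx_scalars R) eta (exp_integral i l x.2))]].

Proof.
have [K K0 hK] := complexify_bounded hLh.
have hc : - eta < complex.Re lam0.
  by rewrite -lte_fin (le_lt_trans _ hre)// (ess_growth_bound_ge heta K0 hK hn hT hgen).
have [k0 [B [Dm [h1 h2 h3 h4 h5]]]] := spectral_projector heta K0 hK hc hn hspec.
exists k0, B, Dm; split=> // x l hl.
exact: (bracket_calculus heta K0 hK x hl).
Qed.
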